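(* Suppose $\Phi^*$ holds and $\mathsf{Cov}(\mathcal{K}) \geq \aleph_2$. Let $T$ be a complete theory in a language of cardinality $\aleph_1$ such that $T$ has atomic models. Suppose further that $T$ has no constructible models. Then $T$ has $2^{\aleph_1}$ pairwise nonisomorphic atomic models of size $\aleph_1$.
   Context: A model $M$ is atomic if for every finite tuple $\overline{a}$ from $M$ the type $tp(\overline{a})$ over $\emptyset$ is isolated by a single formula. A model $M$ is constructible if it can be enumerated as a (transfinite) sequence $M = (a_\alpha : \alpha < \alpha^* )$ such that for each $\alpha<\alpha^*$ the type $tp(a_\alpha / \{a_\beta : \beta < \alpha\})$ is isolated by a single formula. For stationary $S \subseteq \omega_1$, $\Phi(S)$ (weak diamond on $S$) is the statement: for every $F: 2^{<\omega_1} \to 2$ there is $g: S \to 2$ such that for every $f: \omega_1 \to 2$ the set $\{\alpha \in S : F(f\restriction_\alpha) = g(\alpha)\}$ is stationary. $\Phi^*$ is the statement: for all stationary $S \subseteq \omega_1$, $\Phi(S)$ holds. $\mathsf{Cov}(\mathcal{K})$ is the covering number of the meager ideal: the least $\kappa$ such that $2^\omega$ is the union of $\kappa$-many closed nowhere dense sets. *)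

(* Defs.v *)
From HB Require Import structures.
From mathcomp Require Import all_boot all_order all_classical wochoice.
From mathcomp Require Import topology cantor.

Set Implicit Arguments.
Unset Strict Implicit.
Unset Printing Implicit Defensive.

Import Order.TTheory.

Local Open Scope classical_set_scope.
Local Open Scope card_scope.
Local Open Scope order_scope.

(** * The ordinals omega_1 and omega_2 *)

(* [succ_card T] is the least ordinal whose cardinality is greater than that of
   [T], realized inside an arbitrary well-ordering of the power set of [T]: it
   consists of the points below which there are at most [#|T|] points. *)
Definition power_le (T : Type) : rel (T -> bool) :=
  sval (well_ordering_principle (T -> bool)).

Definition power_lt (T : Type) : rel (T -> bool) :=
  fun x y => (x != y) && power_le x y.

Definition succ_card (T : Type) : Type :=
  {x : T -> bool | `[< [set y | power_lt y x] #<= [set: T] >]}.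

HB.instance Definition _ (T : Type) := Choice.on (succ_card T).

Lemma power_le_wo (T : Type) : well_order (@power_le T).
Proof. exact: (svalP (well_ordering_principle (T -> bool))). Qed.

Lemma well_order_chain (T : eqType) (R : rel T) : well_order R -> wo_chain R T.
Proof. by move=> woR A _; exact: woR. Qed.

Lemma well_order_refl (T : eqType) (R : rel T) : well_order R -> reflexive R.
Proof. by move=> /well_order_chain /wo_chain_reflexive R_refl x; apply: R_refl. Qed.

Lemma well_order_anti (T : eqType) (R : rel T) :
  well_order R -> antisymmetric R.
Proof.
by move=> /well_order_chain /wo_chain_antisymmetric R_anti x y; apply: R_anti.
Qed.

Lemma well_order_total (T : eqType) (R : rel T) : well_order R -> total R.
Proof. by move=> /well_order_chain /wo_chainW R_tot x y; apply: R_tot. Qed.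

Lemma well_order_trans (T : eqType) (R : rel T) : well_order R -> transitive R.
Proof.
move=> woR y x z xy yz.
have [|m [[mA lb] _]] := woR (mem [:: x; y; z]).
  by exists x; rewrite inE eqxx.
have [lx ly lz] : [/\ R m x, R m y & R m z].
  by split; apply: lb; rewrite !inE eqxx ?orbT.
have anti u v : R u v -> R v u -> u = v.
  by move=> uv vu; apply: (well_order_anti woR); rewrite uv vu.
move: mA; rewrite !inE => /or3P[]/eqP me; subst m => //.
  by rewrite (anti _ _ xy lx).
by rewrite -(anti _ _ yz ly).
Qed.

Definition succ_card_le (T : Type) : rel (succ_card T) :=
  fun x y => power_le (val x) (val y).

Fact succ_card_display : Order.disp_t. Proof. exact: Order.default_display. Qed.

Lemma succ_card_le_refl (T : Type) : reflexive (@succ_card_le T).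
Proof. by move=> x; apply: (well_order_refl (@power_le_wo T)). Qed.

Lemma succ_card_le_anti (T : Type) : antisymmetric (@succ_card_le T).
Proof. by move=> x y /(well_order_anti (@power_le_wo T)) /val_inj. Qed.

Lemma succ_card_le_trans (T : Type) : transitive (@succ_card_le T).
Proof. by move=> y x z; apply: (well_order_trans (@power_le_wo T)). Qed.

HB.instance Definition _ (T : Type) :=
  Order.Le_isPOrder.Build succ_card_display (succ_card T)
    (@succ_card_le_refl T) (@succ_card_le_anti T) (@succ_card_le_trans T).

Lemma succ_card_le_total (T : Type) :
  total (<=%O : rel (succ_card T)).
Proof. by move=> x y; apply: (well_order_total (@power_le_wo T)). Qed.

HB.instance Definition _ (T : Type) :=
  Order.POrder_isTotal.Build succ_card_display (succ_card T)
    (@succ_card_le_total T).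

Lemma card_leTT (S T : Type) :
  [set: S] #<= [set: T] <-> exists f : S -> T, injective f.
Proof.
split=> [/card_leP[g]|[f finj]].
  exists (fun x => val (g (SigSub (mem_setT x)))) => x y /val_inj e.
  by have /= [] := 'inj_g (mem_setT _) (mem_setT _) e.
have /injfunPex[g] : exists2 f : S -> T, set_fun setT setT f & set_inj setT f.
  by exists f => // x y _ _ /finj.
exact: (inj_card_le g).
Qed.

(* [succ_card_wo], [succ_card_segment] and [succ_card_gt] determine the ordered
   type [succ_card T] up to isomorphism. *)
Lemma succ_card_wo (T : Type) : well_order (<=%O : rel (succ_card T)).
Proof.
apply: antisymmetric_well_order; first exact: le_anti.
move=> A [x0 Ax0].
pose B : {pred (T -> bool)} := [pred y | `[< exists2 x, x \in A & val x = y >]].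
have [|y [[]]] := power_le_wo (A := B).
  by exists (val x0); apply/asboolP; exists x0.
move=> /asboolP[x Ax <-] lb _; exists x; split=> // z Az.
by apply: lb; apply/asboolP; exists z.
Qed.

Lemma succ_card_segment (T : Type) (x : succ_card T) :
  [set y | y < x] #<= [set: T].
Proof.
apply: (fun h => card_le_trans h (asboolW (svalP x))).
have : set_inj [set y | y < x] (val : succ_card T -> T -> bool).
  by move=> y z _ _ /val_inj.
have : set_fun [set y | y < x] [set y | power_lt y (val x)] val.
  by move=> y /=; rewrite lt_neqAle.
move=> vf vi; have /injfunPex[g] := ex_intro2 _ _ _ vf vi.
exact: inj_card_le g.
Qed.

Lemma succ_card_gt (T : Type) : ~ ([set: succ_card T] #<= [set: T]).
Proof.
move=> le_ST.
have noinj : ~ exists f : (T -> bool) -> T, injective f.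
  move=> [f finj]; pose D t := `[< exists2 A, f A = t & ~~ A t >].
  have [DfD|DfD] := boolP (D (f D)).
    by have /asboolP[A /finj-> /negP] := DfD.
  by move: (DfD) => /asboolPn; apply; exists D.
apply: noinj; apply/card_leTT.
have [allS|] := pselect (forall x : T -> bool, [set y | power_lt y x] #<= [set: T]).
  apply: (fun h => card_le_trans h le_ST); apply/card_leTT.
  by exists (fun x => exist _ x (asboolT (allS x))) => x y [].
rewrite -existsNE => -[x1 Nx1].
have [|x [[Nx lb] _]] := power_le_wo
  (A := [pred x : T -> bool | `[< ~ ([set y | power_lt y x] #<= [set: T]) >]]).
  by exists x1; apply/asboolP.
case: (asboolW Nx); apply: (fun h => card_le_trans h le_ST).
have below (y : T -> bool) : power_lt y x -> [set z | power_lt z y] #<= [set: T].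
  move=> /andP[yx le_yx]; apply: contrapT => /asboolT Ny.
  move: yx; rewrite (well_order_anti (@power_le_wo T) (x := y) (y := x)) ?eqxx//.
  by rewrite le_yx lb.
pose h (y : [set y | power_lt y x]) : [set: succ_card T] := SigSub (mem_setT
  (exist _ (val y) (asboolT (below _ (set_mem (valP y)))) : succ_card T)).
have /injfunPex : exists2 h : [set y | power_lt y x] -> [set: succ_card T],
    set_fun setT setT h & set_inj setT h.
  by exists h => // y z _ _ [] /val_inj.
by move=> ?; apply/card_leP.
Qed.

Definition omega1 : Type := succ_card nat.
Definition omega2 : Type := succ_card omega1.

(** * Weak diamond *)

Definition unbounded (C : set omega1) :=
  forall a : omega1, exists2 b, C b & a < b.

(* A limit point of [C] is an ordinal [a > 0] such that [C] is unbounded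
   below [a]; such an [a] is automatically a limit ordinal. *)
Definition limit_point (C : set omega1) (a : omega1) :=
  (exists b, b < a) /\ forall b, b < a -> exists2 c, C c & b < c < a.

Definition club (C : set omega1) :=
  unbounded C /\ forall a, limit_point C a -> C a.

Definition stationary (S : set omega1) :=
  forall C, club C -> S `&` C !=set0.

Definition below (a : omega1) : set omega1 := [set b | b < a].

(* 2^{<omega_1} *)
Definition binseq : Type := {a : omega1 & below a -> bool}.

Definition restr (f : omega1 -> bool) (a : omega1) : binseq :=
  existT _ a (fun b => f (val b)).

Definition weak_diamond (S : set omega1) :=
  forall F : binseq -> bool, exists g : S -> bool,
  forall f : omega1 -> bool,
    stationary (val @` [set a : S | F (restr f (val a)) = g a]).

Definition Phi_star := forall S, stationary S -> weak_diamond S.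

(** * The covering number of the meager ideal *)

Definition nowhere_dense (X : topologicalType) (A : set X) :=
  interior (closure A) = set0.

Definition meager_cover (I : Type) (A : I -> set cantor_space) :=
  (forall i, closed (A i) /\ nowhere_dense (A i)) /\
  \bigcup_(i in [set: I]) A i = [set: cantor_space].

(* Cardinals are represented by types: [kappa] has cardinality Cov(K). *)
Definition is_cov_meager (kappa : Type) :=
  (exists A : kappa -> set cantor_space, meager_cover A) /\
  forall (I : Type) (A : I -> set cantor_space),
    meager_cover A -> [set: kappa] #<= [set: I].

Definition cov_meager_ge (mu : Type) :=
  exists kappa : Type, is_cov_meager kappa /\ [set: mu] #<= [set: kappa].

(** * First-order logic *)

Record language := Language {
  fsym : Type;
  farity : fsym -> nat;
  rsym : Type;
  rarity : rsym -> nat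
}.

Definition symbol (L : language) : Type := (fsym L + rsym L)%type.

(* [term L n] and [formula L n] have their free variables among [n] de Bruijn
   indices; [All] binds the index [0]. *)
Inductive term (L : language) (n : nat) : Type :=
| Var of 'I_n
| App (f : fsym L) of ('I_(farity f) -> term L n).

Inductive formula (L : language) : nat -> Type :=
| Bot n : formula L n
| Equ n of term L n & term L n : formula L n
| Rel n (r : rsym L) of ('I_(rarity r) -> term L n) : formula L n
| Imp n of formula L n & formula L n : formula L n
| All n of formula L n.+1 : formula L n.

Definition sentence (L : language) := formula L 0.
Definition Neg (L : language) n (phi : formula L n) := Imp phi (Bot L n).

Record structure (L : language) := Structure {
  carrier :> Type;
  carrier_inhabited : inhabited carrier;
  finterp : forall f : fsym L, ('I_(farity f) -> carrier) -> carrier;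
  rinterp : forall r : rsym L, ('I_(rarity r) -> carrier) -> Prop
}.

Section Semantics.
Variables (L : language) (M : structure L).

Definition env_cons n (x : M) (e : 'I_n -> M) : 'I_n.+1 -> M :=
  fun i => oapp e x (unlift ord0 i).

Definition env_cat n k (e : 'I_n -> M) (e' : 'I_k -> M) : 'I_(n + k) -> M :=
  fun i => match fintype.split i with inl j => e j | inr j => e' j end.

Fixpoint eval n (e : 'I_n -> M) (t : term L n) : M :=
  match t with
  | Var i => e i
  | App f ts => finterp (fun i => eval e (ts i))
  end.

Fixpoint sat n (phi : formula L n) : ('I_n -> M) -> Prop :=
  match phi with
  | Bot _ => fun=> False
  | Equ _ t u => fun e => eval e t = eval e u
  | Rel _ r ts => fun e => rinterp (fun i => eval e (ts i))
  | Imp _ phi psi => fun e => sat phi e -> sat psi e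
  | All _ phi => fun e => forall x, sat phi (env_cons x e)
  end.

Definition env_nil : 'I_0 -> M := fun i => False_rect M (notF (ltn_ord i)).

Definition holds (s : sentence L) := sat s env_nil.

Definition models (T : set (sentence L)) := forall s, T s -> holds s.

(* Formulas in [n] free variables with parameters from [B]. *)
Record pformula (B : set M) (n : nat) := PFormula {
  nparam : nat;
  pform : formula L (n + nparam);
  param : 'I_nparam -> B
}.

Definition psat (B : set M) n (phi : pformula B n) (a : 'I_n -> M) :=
  sat (pform phi) (env_cat a (fun j => val (param (p := phi) j))).

Definition tp (B : set M) n (a : 'I_n -> M) : set (pformula B n) :=
  [set phi | psat phi a].
Arguments tp B [n] a.

Definition isolated (B : set M) n (p : set (pformula B n)) :=
  exists2 phi, p phi &
    forall psi, p psi -> forall x : 'I_n -> M, psat phi x -> psat psi x.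

Definition atomic :=
  forall n (a : 'I_n -> M), isolated (tp set0 a).

(* The index ordinal is given as a well-ordered type. *)
Definition constructible :=
  exists (d : Order.disp_t) (I : orderType d) (a : I -> M),
    [/\ well_order (<=%O : rel I),
        range a = [set: M] &
        forall i, isolated (tp (a @` [set j | j < i]) (fun _ : 'I_1 => a i))].

End Semantics.

Definition isomorphic (L : language) (M N : structure L) :=
  exists h : M -> N,
    [/\ bijective h,
        forall f (x : 'I_(farity f) -> M), h (finterp x) = finterp (h \o x) &
        forall r (x : 'I_(rarity r) -> M), rinterp x <-> rinterp (h \o x)].

Definition entails (L : language) (T : set (sentence L)) (s : sentence L) :=
  forall M : structure L, models M T -> holds M s.

Definition complete_theory (L : language) (T : set (sentence L)) :=
  (exists M : structure L, models M T) /\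
  forall s, entails T s \/ entails T (Neg s).

(* Main.v *)
From HB Require Import structures.
From mathcomp Require Import all_boot all_order all_classical wochoice.
From mathcomp Require Import topology cantor.
Require Import Defs.

(** Atomic models of [T] of size [omega_1] are built by a transfinite forcing.
    A condition is a countable approximation [q] of such a model, in the form of
    a countable set of names whose finite tuples have been given isolated types,
    together with a level [lev q], such that [q] realises exactly the types that
    are realised in the piece of this level of a fixed atomic model [M]
    (filtered by countable homogeneous pieces), and with countably many types
    that later stages promise to omit.  As [Cov(K)] is greater than [aleph_1], a
    generic extension of a condition can meet [aleph_1] dense requirements at
    once ([generic_sequence], [generic_extension]); this is what allows it to
    keep its promises.

    Call [q] dense if the isolated types over [q] are dense.  Whether [q] is
    dense depends only on its level ([dense_level]).  A dense condition has an
    extension that is atomic over it ([atomic_extension]), so if the conditions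
    were dense at all levels of a closed unbounded set, the union of a chain of
    such extensions would be a constructible model
    ([closed_dense_constructible]).  As [T] has none, the levels of non-dense
    conditions form a stationary set ([stationary_nondense]).

    A type over the names of [q] is possible if some extension of [q] realises
    it, and [q'] is stable over these names if no further extension loses a
    possible type.  A type that could be omitted would be lost once its omission
    is promised; so over a stable condition each possible type is forced by a
    finite test ([stable_forced]) and there are at most [aleph_1] of them.

    First suppose that below some [q0] no condition is stable over the names of
    [q0].  Then every condition splits into two that disagree on the types over
    [q0], and the [2 ^ aleph_1] branches of the resulting tree have limits that
    are pairwise non-isomorphic over the names of [q0] ([first_tree]).  The weak
    diamond gives [2 ^ aleph_0 < 2 ^ aleph_1], so forgetting the countably many
    constants leaves [2 ^ aleph_1] isomorphism classes ([first_case]).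

    Otherwise every condition has an extension that is stable over it, so it has
    at most [aleph_1] possible types from then on; if the condition is not
    dense, another extension realises a type that is not among them
    ([avoid_types]).  In the tree of these choices ([second_tree]), an
    isomorphism between two limits is approximated at a closed unbounded set of
    levels by a countable map, and at a non-dense level it must carry the choice
    made on one side to the choice made on the other.  The weak diamond guesses, from this countable map, a
    choice that refutes the isomorphism.  Each of [aleph_1] disjoint stationary
    sets of non-dense levels ([ulam]) has its own guesses, and the limits of the
    branches that follow the guesses on different subfamilies of these sets are
    not isomorphic ([second_case]).

    All of this only refers to the finite partial elementary maps of [M].  The
    limits are turned back into structures by reading the functions and
    relations off the types ([model], [truth]). *)

Set Implicit Arguments.
Unset Strict Implicit.
Unset Printing Implicit Defensive.

Import Order.TTheory.

Local Open Scope classical_set_scope.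
Local Open Scope card_scope.
Local Open Scope order_scope.

(** * Injections between types *)

Definition embeds (A B : Type) := exists f : A -> B, injective f.

Lemma embeds_trans A B C : embeds A B -> embeds B C -> embeds A C.
Proof. by move=> [f fi] [g gi]; exists (g \o f); apply: inj_comp. Qed.

Lemma embeds_prod A A' B B' : embeds A A' -> embeds B B' -> embeds (A * B) (A' * B').
Proof.
move=> [f fi] [g gi]; exists (fun x => (f x.1, g x.2)).
by move=> [a b] [c d] [/fi -> /gi ->].
Qed.

Lemma countableW T (A : set T) :
  countable A -> exists f : T -> nat, forall x y, A x -> A y -> f x = f y -> x = y.
Proof.
by move=> /countable_injP[f fi]; exists f => x y Ax Ay; apply: fi; apply/mem_set.
Qed.

Lemma countableI T (A : set T) (f : T -> nat) :
  (forall x y, A x -> A y -> f x = f y -> x = y) -> countable A.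
Proof.
by move=> fi; apply/countable_injP; exists f => x y /set_mem Ax /set_mem Ay; apply: fi.
Qed.

Lemma countable_sub T (A B : set T) : A `<=` B -> countable B -> countable A.
Proof. by move=> AB; apply: sub_countable; apply: subset_card_le. Qed.

Lemma countable_cup T (A B : set T) : countable A -> countable B -> countable (A `|` B).
Proof. by move=> cA cB; rewrite -bigcup2E; apply: bigcup_countable => // -[|[|i]] _. Qed.

Lemma countable_im T U (A : set T) (f : T -> U) : countable A -> countable (f @` A).
Proof. exact: (sub_countable (card_image_le f A)). Qed.

Lemma countable_enum T (A : set T) (x0 : T) :
  countable A -> exists e : nat -> T, forall x, A x -> exists n, e n = x.
Proof.
move=> /countableW[f fi].
have h n : exists y, forall x, A x -> f x = n -> y = x.
  have [[x [Ax fx]]|H] := pselect (exists x, A x /\ f x = n).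
    by exists x => y Ay fy; apply: fi => //; rewrite fx fy.
  by exists x0 => x Ax fx; case: H; exists x.
have [e eP] := choice h; exists e => x Ax; exists (f x); exact: eP.
Qed.

Lemma countable_seq T (A : set T) (Q : seq T -> Prop) :
  (forall s, Q s -> forall n, (n < size s)%N -> forall x0, A (nth x0 s n)) ->
  countable A -> countable Q.
Proof.
move=> QA /countableW[f fi].
apply: (@countableI _ _ (fun s => choice.pickle (map f s))) => s t Qs Qt e.
have {}e : map f s = map f t by apply: (pcan_inj choice.pickleK).
have sz : size s = size t by rewrite -(size_map f s) e size_map.
case: s => [|x s] in sz e Qs *; first by case: t sz {e Qt}.
apply: (@eq_from_nth _ x) => // i ltis.
have ltit : (i < size t)%N by rewrite -sz.
apply: fi; [exact: QA|exact: QA|].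
by rewrite -!(nth_map x 0) // e.
Qed.

Lemma countable_seqP (T : eqType) (A : set T) :
  countable A -> countable [set s : seq T | forall x, x \in s -> A x].
Proof.
by move=> cA; apply: countable_seq cA => s Qs n ns x0; apply: Qs; apply: mem_nth.
Qed.

Lemma embeds_total A B : embeds A B \/ embeds B A.
Proof.
pose P (X : set (A * B)) := forall p q, X p -> X q -> (p.1 = q.1 <-> p.2 = q.2).
have [F FP Ftot|X [PX maxX]] := @Zorn_bigcup _ P.
  move=> p q [X FX Xp] [Y FY Yq].
  have [XY|YX] := Ftot _ _ FX FY.
    by apply: (FP Y FY) => //; apply: XY.
  by apply: (FP X FX) => //; apply: YX.
have [allA|] := pselect (forall a, exists b, X (a, b)).
  left; have [f fP] := choice allA; exists f => a a' e.
  exact/(PX _ _ (fP a) (fP a')).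
move=> /existsNP[a0 a0P].
have [allB|] := pselect (forall b, exists a, X (a, b)).
  right; have [f fP] := choice allB; exists f => a a' e.
  exact/(PX _ _ (fP a) (fP a')).
move=> /existsNP[b0 b0P]; exfalso; apply: (maxX (X `|` [set (a0, b0)])).
  by split; [left | move=> h; apply: a0P; exists b0; apply: h; right].
have na p : X p -> p.1 = a0 -> False by case: p => a b /= Xp e; apply: a0P; exists b; rewrite -e.
have nb p : X p -> p.2 = b0 -> False by case: p => a b /= Xp e; apply: b0P; exists a; rewrite -e.
move=> p q [Xp|->] [Xq|->] //=; first exact: PX.
  by split=> [/(na _ Xp)|/(nb _ Xp)].
by split=> [/esym/(na _ Xq)|/esym/(nb _ Xq)].
Qed.

(** A maximal disjoint family of copies of [D] in [Q] leaves over fewer than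
    [#|D|] points, so [Q] is [D] times something; the factor [D] then swallows
    another copy of itself. *)
Lemma embeds_absorb D Q (d0 d1 : D) : d0 <> d1 -> embeds (D * D) D -> embeds D Q ->
  embeds (D * Q) Q.
Proof.
move=> d01 [c ci] [j ji].
pose P (F : set (D -> Q)) := forall f g, F f -> F g -> forall d e, f d = g e -> f = g /\ d = e.
have [F FP Ftot|F [PF maxF]] := @Zorn_bigcup _ P.
  move=> f g [X FX Xf] [Y FY Yg].
  have [XY|YX] := Ftot _ _ FX FY.
    by apply: (FP Y FY) => //; apply: XY.
  by apply: (FP X FX) => //; apply: YX.
pose rest := {q | ~ exists f d, F f /\ f d = q}.
have noD : ~ embeds D rest.
  move=> [h hi]; pose f d := sval (h d).
  have nf g d e : F g -> g d = f e -> False.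
    by move=> Fg e1; apply: (svalP (h e)); exists g, d.
  apply: (maxF (F `|` [set f])).
    by split; [left | move=> /(_ f) H; apply: (nf f d0 d0) => //; apply: H; right].
  move=> g g' [Fg|->] [Fg'|->] d e E; first exact: PF.
  - by case: (nf _ _ _ Fg E).
  - by case: (nf _ _ _ Fg' (esym E)).
  - by split=> //; apply: hi; apply: eq_sig_hprop E => x; exact: Prop_irrelevance.
have [D_rest|[r ri]] := embeds_total D rest; first by [].
have [f0 Ff0] : exists f, F f.
  apply: contrapT => F0; apply: noD.
  have h d : ~ exists f e, F f /\ f e = j d by move=> [f [e [Ff _]]]; apply: F0; exists f.
  by exists (fun d => exist _ (j d) (h d)) => d e [/ji].
have h q : exists fd : (D -> Q) * D,
    (F fd.1 /\ fd.1 fd.2 = q) \/ exists n : ~ exists f d, F f /\ f d = q,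
      fd.1 = f0 /\ fd.2 = r (exist _ q n).
  have [[f [d [Ff fd]]]|n] := pselect (exists f d, F f /\ f d = q).
    by exists (f, d); left.
  by exists (f0, r (exist _ q n)); right; exists n.
have [fd fdP] := choice h.
pose flag q := `[< F (fd q).1 /\ (fd q).1 (fd q).2 = q >].
exists (fun x => (fd x.2).1 (c (if flag x.2 then d0 else d1, c (x.1, (fd x.2).2)))).
have Ffd q : F (fd q).1 by case: (fdP q) => [[]|[n [-> _]]].
move=> [d q] [d' q'] /= /(PF _ _ (Ffd q) (Ffd q')) [ef /ci [ei /ci [-> e2]]].
have {}ei : flag q = flag q' by move: ei; do 2 case: (flag _) => // /esym.
congr (_, _); case: (boolP (flag q)) => fq.
  have /asboolP[_ <-] := fq; move: fq; rewrite ei => /asboolP[_ <-].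
  by rewrite ef e2.
case: (fdP q) => [/asboolP|[n [_ e3]]]; first by rewrite -/(flag q) (negbTE fq).
move: fq; rewrite ei => fq'.
case: (fdP q') => [/asboolP|[n' [_ e4]]]; first by rewrite -/(flag q') (negbTE fq').
by have := congr1 sval (ri _ _ (etrans (esym e3) (etrans e2 e4))).
Qed.

(** The domain of [t] embeds into [D * Q], which embeds into [D] or into [Q], and
    [D] is too small. *)
Lemma embeds_fibers P Q D (d0 d1 : D) (t : P -> Q) (e : P -> D) : d0 <> d1 ->
  embeds (D * D) D -> ~ embeds P D ->
  (forall x y, t x = t y -> e x = e y -> x = y) -> embeds P Q.
Proof.
move=> d01 DD nPD te.
have PDQ : embeds P (D * Q) by exists (fun x => (e x, t x)) => x y [/[swap]]; apply: te.
have [DQ|QD] := embeds_total D Q.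
  exact: embeds_trans PDQ (embeds_absorb d01 DD DQ).
case: nPD; apply: embeds_trans PDQ _; apply: embeds_trans _ DD.
by apply: embeds_prod => //; exists id.
Qed.

(** * The ordinals below omega_1 *)

Lemma omega1_min (A : set omega1) a : A a -> exists2 m, A m & forall x, A x -> m <= x.
Proof.
move=> Aa; have [|m [[Am lb] _]] := @succ_card_wo nat (mem [set` [pred x | `[< A x >]]]).
  by exists a; apply/mem_set; apply/asboolP.
exists m; first by apply/asboolP; apply: (set_mem Am).
by move=> x Ax; apply: lb; apply/mem_set/asboolP.
Qed.

Lemma omega1_ind (P : omega1 -> Prop) :
  (forall a, (forall b, b < a -> P b) -> P a) -> forall a, P a.
Proof.
move=> H a; apply: contrapT => nPa.
have [m nPm mlb] := omega1_min (A := [set x | ~ P x]) nPa.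
apply: nPm; apply: H => b ltbm; apply: contrapT => /mlb.
by rewrite leNgt ltbm.
Qed.

Lemma omega1_wf : well_founded (fun a b : omega1 => a < b).
Proof. by apply: omega1_ind => a H; constructor. Qed.

Lemma omega1_rec (T : Type) (F : omega1 -> (omega1 -> T) -> T) (t0 : T) :
  exists f, forall a, f a = F a (fun b => if b < a then f b else t0).
Proof.
pose body a (rec : forall b, b < a -> T) :=
  F a (fun b => match pselect (b < a) with left h => rec b h | right _ => t0 end).
exists (Fix omega1_wf (fun=> T) body) => a; rewrite Fix_eq => [|x f g fg].
  by congr (F a _); apply/funext => b; case: pselect => [->|/negP/negbTE ->].
by congr (F x _); apply/funext => b; case: pselect.
Qed.

Lemma omega1_uncountable : ~ countable [set: omega1].
Proof. exact: succ_card_gt. Qed.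

Lemma below_countable (a : omega1) : countable [set b | b < a].
Proof. exact: succ_card_segment. Qed.

Lemma countable_bound (A : set omega1) : countable A -> exists b, forall x, A x -> x < b.
Proof.
move=> cA; apply: contrapT => H; apply: omega1_uncountable.
apply: (@countable_sub _ _ ((\bigcup_(x in A) [set y | y < x]) `|` A)).
  move=> b _; apply: contrapT => nb; apply: H; exists b => x Ax.
  rewrite ltNge; apply/negP; rewrite le_eqVlt => /orP[/eqP e|lt]; apply: nb.
    by right; rewrite e.
  by left; exists x.
apply: countable_cup => //; apply: bigcup_countable => // x _; apply: below_countable.
Qed.

Lemma omega1_gt (a : omega1) : exists b, a < b.
Proof. by have [b /(_ a erefl)] := countable_bound (@countable1 _ a); exists b. Qed.

Lemma omega1_inhabited : exists a : omega1, True.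
Proof. by have [b _] := countable_bound (@countable0 omega1); exists b. Qed.

(** A strict upper bound of each countable set of ordinals. *)
Definition bound (A : set omega1) : omega1 :=
  projT1 (cid (P := fun b => countable A -> forall x, A x -> x < b)
    (match pselect (countable A) with
     | left cA => let: ex_intro b bP := countable_bound cA in ex_intro _ b (fun=> bP)
     | right n => let: ex_intro b _ := omega1_inhabited in ex_intro _ b (fun cA => False_ind _ (n cA))
     end)).

Lemma boundP (A : set omega1) : countable A -> forall x, A x -> x < bound A.
Proof. by rewrite /bound; case: cid. Qed.

Lemma omega1_lub (A : set omega1) : countable A ->
  exists a, (forall x, A x -> x <= a) /\ (forall b, b < a -> exists2 x, A x & b < x).
Proof.
move=> cA; have [|m mA mlb] := @omega1_min [set b | forall x, A x -> x <= b] (bound A).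
  by move=> x Ax; apply/ltW/boundP.
exists m; split=> // b ltbm; apply: contrapT => H.
suff : m <= b by rewrite leNgt ltbm.
apply: mlb => x Ax; rewrite leNgt; apply/negP => lt; apply: H; by exists x.
Qed.

(** * Closed unbounded and stationary sets *)

(** Every closed unbounded set contains, for some [B], all the ordinals closed
    under [B], and these form a closed unbounded set.  So stationarity can be
    tested on them alone. *)
Definition closed_under (B : omega1 -> omega1) (a : omega1) :=
  (exists b, b < a) /\ forall b, b < a -> B b < a.

Lemma closed_under_gt (B : omega1 -> omega1) a : exists2 c, closed_under B c & a < c.
Proof.
pose nxt x := bound ([set x] `|` B @` ([set y | y < x] `|` [set x])).
have cnt x : countable ([set x] `|` B @` ([set y | y < x] `|` [set x])).
  apply: countable_cup => //; apply: countable_im; apply: countable_cup => //.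
  exact: below_countable.
have nxt_gt x : x < nxt x by apply: (boundP (cnt x)); left.
have nxt_B x y : y <= x -> B y < nxt x.
  move=> yx; apply: (boundP (cnt x)); right; exists y => //.
  by move: yx; rewrite le_eqVlt => /orP[/eqP ->|]; [right|left].
have [|m mP mlb] := @omega1_min [set b | forall n, iter n nxt a < b]
   (bound (range (fun n => iter n nxt a))).
  by move=> n; apply: boundP; [apply: countable_im|exists n].
exists m; last exact: (mP 0%N).
split; first by exists a; exact: (mP 0%N).
move=> b ltbm; apply: contrapT => nB.
suff : m <= b by rewrite leNgt ltbm.
apply: mlb => n /=; rewrite ltNge; apply/negP => /nxt_B h; apply: nB.
by apply: lt_trans h _; exact: (mP n.+1).
Qed.

Lemma closed_under_club B : club (closed_under B).
Proof.
split=> [a|a [[b ba] lim]]; first by have [c cc ac] := closed_under_gt B a; exists c.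
split; first by exists b.
move=> {b ba} b /lim[c [_ cB] /andP[bc ca]].
exact: lt_trans (cB _ bc) ca.
Qed.

Lemma club_closed_under C : club C -> exists B, forall a, closed_under B a -> C a.
Proof.
move=> [unbC limC]; have h a : exists b, C b /\ a < b by have [b ? ?] := unbC a; exists b.
have [B BP] := choice h; exists B => a [a0 aB]; apply: limC; split=> // b ba.
by exists (B b); [case: (BP b)|rewrite aB // andbT; case: (BP b)].
Qed.

Lemma stationaryP (S : set omega1) :
  stationary S <-> forall B, exists2 a, S a & closed_under B a.
Proof.
split=> [statS B|H C /club_closed_under[B BC]].
  by have [a [Sa aB]] := statS _ (closed_under_club B); exists a.
by have [a Sa aB] := H B; exists a; split=> //; apply: BC.
Qed.

Lemma closed_under_all (I : Type) (B : I -> omega1 -> omega1) : countable [set: I] ->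
  exists B', forall a, closed_under B' a -> forall i, closed_under (B i) a.
Proof.
move=> cI; exists (fun x => bound (range (B^~ x))) => a [a0 aB] i; split=> // b /aB.
by apply: le_lt_trans; apply: ltW; apply: boundP; [apply: countable_im|exists i].
Qed.

Lemma closed_under2 (B B' : omega1 -> omega1) :
  exists B2, forall a, closed_under B2 a -> closed_under B a /\ closed_under B' a.
Proof.
have [B2 B2P] := @closed_under_all bool (fun b => if b then B else B') (countableP _).
by exists B2 => a /B2P H; split; [exact: (H true)|exact: (H false)].
Qed.

Lemma embeds_uncountable (U : set omega1) : ~ countable U -> embeds omega1 {x | U x}.
Proof.
move=> ncU; have unb a : exists i : {x | U x}, a < sval i.
  apply: contrapT => H; apply: ncU.
  apply: countable_sub (countable_cup (below_countable a) (countable1 a)) => i Ui.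
  case: (ltgtP i a) => [|lt|->]; [by left| |by right].
  by case: H; exists (exist _ i Ui).
have [i0 _] := unb (bound set0).
have [up upP] := choice unb.
have [j jE] := omega1_rec (fun a f => up (bound ((fun b => sval (f b)) @` [set b | b < a]))) i0.
have jlt a b : b < a -> sval (j b) < sval (j a).
  move=> ba; rewrite (jE a); apply: lt_trans (upP _).
  apply: boundP; first by apply/countable_im/below_countable.
  by exists b => //=; rewrite ba.
by exists j => a b E; case: (ltgtP a b) => // /jlt; rewrite E ltxx.
Qed.

(** Ulam's matrix: the sets [A n i] of its column [i] cover almost all of [S], so
    one of them is stationary, and those of each row [n] are disjoint.  Some row
    contains uncountably many stationary sets. *)
Lemma ulam (S : set omega1) : stationary S ->
  exists St : omega1 -> set omega1,
    [/\ forall i, stationary (St i), forall i, St i `<=` S &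
        forall i j a, St i a -> St j a -> i = j].
Proof.
move=> /stationaryP statS.
have h a : exists f : omega1 -> nat, forall x y, x < a -> y < a -> f x = f y -> x = y.
  by have [f fi] := countableW (below_countable a); exists f.
have [e eP] := choice h.
pose A n i := [set a | [/\ S a, i < a & e a i = n]].
have statA i : exists n, stationary (A n i).
  apply: contrapT => /forallNP nst.
  have {}nst n : exists B, forall a, A n i a -> ~ closed_under B a.
    have /stationaryP/existsNP[B HB] := nst n.
    by exists B => a Aa aB; apply: HB; exists a.
  have [B BP] := choice nst.
  have [B1 B1P] := closed_under_all B (countableP _).
  have [B' B'P] := closed_under2 B1 (fun=> i).
  have [a Sa /B'P[/B1P aB [[b ba] /(_ _ ba) ia]]] := statS B'.
  exact: (BP (e a i) a).
have [n nP] := choice statA.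
(* Uncountably many [i] share the same row of the matrix. *)
have [k kP] : exists k, ~ countable [set i | n i = k].
  apply: contrapT => /forallNP H; apply: omega1_uncountable.
  apply: (@countable_sub _ _ (\bigcup_k [set i | n i = k])); first by move=> i _; exists (n i).
  by apply: bigcup_countable => // k _; apply: contrapT => /H.
have [j ji] := embeds_uncountable kP.
exists (fun i => A k (sval (j i))); split.
- by move=> i; case: (j i) => x /= <-.
- by move=> i a [].
move=> i i' a [_ lt e1] [_ lt' e2]; apply: ji; apply: eq_sig_hprop => [x|]; first exact: Prop_irrelevance.
by apply: (eP a) => //; rewrite e1 e2.
Qed.

(** * Sets of size omega_1 *)

Lemma embeds_nat_omega1 : embeds nat omega1.
Proof.
have [//|emb] := embeds_total nat omega1.
by case: omega1_uncountable; apply/card_leTT.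
Qed.

Lemma embeds_omega1_nat : embeds (nat * omega1) omega1.
Proof.
apply: (@embeds_absorb nat omega1 0%N 1%N) => //; last exact: embeds_nat_omega1.
by exists choice.pickle; apply: (pcan_inj choice.pickleK).
Qed.

(** A pair is coded by its maximum and by two integers, which number the
    coordinates in the countable set of the ordinals up to the maximum. *)
Lemma embeds_omega1_square : embeds (omega1 * omega1) omega1.
Proof.
have h (a : omega1) : exists f : omega1 -> nat,
    forall x y, x <= a -> y <= a -> f x = f y -> x = y.
  have [|f fi] := @countableW _ ([set b | b < a] `|` [set a]).
    by apply: countable_cup => //; apply: below_countable.
  exists f => x y; rewrite !le_eqVlt => xa ya; apply: fi.
    by case/orP: xa => [/eqP ->|]; [right|left].
  by case/orP: ya => [/eqP ->|]; [right|left].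
have [e eP] := choice h.
apply: embeds_trans embeds_omega1_nat.
exists (fun x => (choice.pickle (e (Order.max x.1 x.2) x.1, e (Order.max x.1 x.2) x.2), Order.max x.1 x.2)).
move=> [x y] [x' y'] /= [/(pcan_inj choice.pickleK) + em].
have [xm ym] : x <= Order.max x' y' /\ y <= Order.max x' y'.
  by rewrite -em !le_max !lexx ?orbT.
rewrite em => -[e1 e2]; congr (_, _).
  by apply: (eP _ _ _ xm _ e1); rewrite le_max lexx.
by apply: (eP _ _ _ ym _ e2); rewrite le_max lexx orbT.
Qed.

Definition small (A : Type) := embeds A omega1.

Lemma small_prod A B : small A -> small B -> small (A * B).
Proof. by move=> sA sB; apply: embeds_trans (embeds_prod sA sB) embeds_omega1_square. Qed.

Lemma small_seq A : small A -> small (seq A).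
Proof.
move=> [f fi]; have [c ci] := embeds_omega1_square.
have [a0 _] := omega1_inhabited.
have [d di] := embeds_omega1_nat.
pose code := foldr (fun x y => c (f x, y)) a0.
exists (fun s => d (size s, code s)) => s t /di[].
elim: s t => [|x s IH] [|y t] //= [sz] /ci[/fi -> /IH ->] //.
Qed.

Lemma small_enum A (a0 : A) : small A -> exists e : omega1 -> A, forall a, exists i, e i = a.
Proof.
move=> [f fi]; have h i : exists a, forall b, f b = i -> a = b.
  have [[a fa]|n] := pselect (exists a, f a = i); last by exists a0 => b fb; case: n; exists b.
  by exists a => b fb; apply: fi; rewrite fa fb.
by have [e eP] := choice h; exists e => a; exists (f a); apply: eP.
Qed.

(** The first coordinates of an enumeration of all pairs of ordinals. *)
Lemma omega1_cofinal_enum : exists sg : omega1 -> omega1, forall i b, exists2 a, b < a & sg a = i.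
Proof.
have [c ci] := embeds_omega1_square.
have [d0 _] := omega1_inhabited.
have [e eP] := @small_enum (omega1 * omega1) (d0, d0) embeds_omega1_square.
exists (fun a => (e a).1) => i b; apply: contrapT => H.
have [g gP] := choice (fun j => eP (i, j)).
apply: omega1_uncountable.
have /countableW[f fi] := countable_cup (below_countable b) (countable1 b).
have gb j : ([set y | y < b] `|` [set b]) (g j).
  case: (ltgtP (g j) b) => [|lt|->]; [by left| |by right].
  by case: H; exists (g j) => //; rewrite gP.
apply: (@countableI _ _ (f \o g)) => j j' _ _ fE; have E := fi _ _ (gb j) (gb j') fE.
by have := gP j; rewrite E gP => -[].
Qed.

(** * Generic sequences *)

(** The cylinders form a basis of the Cantor space. *)
Definition agree (n : nat) (x y : cantor_space) := forall i, (i < n)%N -> y i = x i.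

Lemma nbhs_agree (x : cantor_space) n : nbhs x (agree n x).
Proof.
elim: n => [|n IH]; first by apply: filterS filterT => y _ i.
have nb : nbhs x [set y : cantor_space | y n = x n].
  apply: (@proj_continuous nat (fun=> bool) n x [set b | b = x n]).
  by apply: open_nbhs_nbhs; split => //; apply: discrete_open.
apply: filterS (filterI IH nb) => y [H /= e] i; rewrite ltnS leq_eqVlt => /orP[/eqP ->//|].
exact: H.
Qed.

Lemma nbhs_agreeE (x : cantor_space) U : nbhs x U -> exists n, forall y, agree n x y -> U y.
Proof.
pose F : set_system cantor_space := [set U | exists n, forall y, agree n x y -> U y].
have FF : Filter F.
  split; first by exists 0%N.
    move=> P Q [n nP] [m mQ]; exists (maxn n m) => y xy; split.
      by apply: nP => i lti; apply: xy; rewrite leq_max lti.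
    by apply: mQ => i lti; apply: xy; rewrite leq_max lti orbT.
  by move=> P Q PQ [n nP]; exists n => y /nP /PQ.
suff : F --> x by exact.
apply/cvg_sup => i V [B] [[W] oW <-] Wx WV.
by exists i.+1 => y xy; apply: WV; rewrite /= xy.
Qed.

Lemma closed_agree (A : set cantor_space) :
  (forall x, ~ A x -> exists n, forall y, agree n x y -> ~ A y) -> closed A.
Proof.
move=> H; rewrite -[A]setCK; apply: open_closedC; rewrite openE => x nAx.
by have [n nP] := H _ nAx; apply: filterS (nbhs_agree x n) => y /nP.
Qed.

Lemma nowhere_dense_agree (A : set cantor_space) : closed A ->
  (forall x n, exists2 y, agree n x y & ~ A y) -> nowhere_dense A.
Proof.
move=> cA H; rewrite /nowhere_dense -(closure_id A).1 //.
apply/seteqP; split=> // x /nbhs_agreeE[n nP].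
by have [y /nP] := H x n.
Qed.

(** A point [x] of the Cantor space is read as a list of instructions for a
    descending sequence in a countable partial order: a block of [k] ones closed
    by a zero asks to move to the [k]-th condition if it is stronger.  The points
    whose sequence misses a given dense set form a closed nowhere dense set, and
    [aleph_1] such sets do not cover the space. *)
Section Generic.
Hypothesis Hcov : cov_meager_ge omega2.
Variables (X : Type) (le : X -> X -> Prop).
Hypothesis le_refl : forall p, le p p.
Hypothesis le_trans : forall p q r, le q p -> le r q -> le r p.

Section Decode.
Variables (e : nat -> X) (p0 : X).

Definition decode_step (s : X * nat) (b : bool) : X * nat :=
  if b then (s.1, s.2.+1) else (if `[< le (e s.2) s.1 >] then e s.2 else s.1, 0%N).

Fixpoint decode (x : nat -> bool) (n : nat) : X * nat :=
  if n is m.+1 then decode_step (decode x m) (x m) else (p0, 0%N).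

Lemma decode_agree n (x y : cantor_space) : agree n x y -> decode y n = decode x n.
Proof.
elim: n => //= n IH xy; rewrite IH ?xy // => i lti; apply: xy; exact: ltnW.
Qed.

Lemma decode_le x m n : (m <= n)%N -> le (decode x n).1 (decode x m).1.
Proof.
move=> /subnKC <-; elim: (n - m)%N => [|k IH]; first by rewrite addn0.
rewrite addnS /=; apply: le_trans IH _; rewrite /decode_step.
by case: (x _) => //=; case: asboolP.
Qed.

Lemma decode_reset (x : cantor_space) n : exists y, agree n x y /\ (decode y n.+1).2 = 0%N.
Proof.
exists (fun i => if (i < n)%N then x i else false); split=> [i ->//|] /=.
by rewrite ltnn.
Qed.

Lemma decode_reach (x : cantor_space) n k : (decode x n).2 = 0%N -> le (e k) (decode x n).1 ->
  exists (y : cantor_space) m, agree n x y /\ (decode y m).1 = e k.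
Proof.
move=> x0 lek; pose y : cantor_space := fun i => if (i < n)%N then x i else (i < n + k)%N.
have xy : agree n x y by move=> i lti; rewrite /y lti.
have dy j : (j <= k)%N -> decode y (n + j) = ((decode x n).1, j).
  elim: j => [_|j IH ltjk].
    by rewrite addn0 (decode_agree xy); case: (decode x n) x0 => a b /= ->.
  rewrite addnS /= IH 1?ltnW // /y ltnNge leq_addr /= ltn_add2l ltjk.
  by [].
exists y, (n + k).+1; split=> //=; rewrite dy // /decode_step {1}/y ltnNge leq_addr /= ltnn /=.
by case: asboolP.
Qed.

End Decode.

Lemma generic_sequence (P : set X) (I : Type) (D : I -> set X) p0 : countable P -> small I ->
  P p0 -> (forall i p, P p -> exists q, [/\ P q, le q p & D i q]) ->
  exists s : nat -> X, [/\ s 0%N = p0, forall n, P (s n), forall m n, (m <= n)%N -> le (s n) (s m) &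
    forall i, exists n, D i (s n)].
Proof.
move=> cP sI Pp0 dense.
have [e0 e0P] := countable_enum p0 cP.
pose e n := if `[< P (e0 n) >] then e0 n else p0.
have eP n : P (e n) by rewrite /e; case: asboolP.
have e_onto p : P p -> exists n, e n = p.
  by move=> Pp; have [n en] := e0P _ Pp; exists n; rewrite /e en; case: asboolP.
have Pd x n : P (decode e p0 x n).1.
  elim: n => //= n IH; rewrite /decode_step; case: (x n) => //=.
  by case: asboolP.
pose A i : set cantor_space := [set x | forall n, ~ D i (decode e p0 x n).1].
have cA i : closed (A i).
  apply: closed_agree => x /existsNP[n /contrapT Dn]; exists n => y xy /(_ n).
  by rewrite (decode_agree _ _ xy).
have nA i : nowhere_dense (A i).
  apply: nowhere_dense_agree => // x n.
  have [y [xy y0]] := decode_reset e p0 x n.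
  have [q [Pq leq Dq]] := dense i _ (Pd y n.+1).
  have [k ek] := e_onto _ Pq; rewrite -ek in leq Dq.
  have [z [m [yz dz]]] := decode_reach y0 leq.
  exists z => [j ltj|/(_ m)]; last by rewrite dz.
  by rewrite yz ?xy // ltnW.
have [x xA] : exists x, forall i, ~ A i x.
  apply: contrapT => /forallNP H; have [kappa [[_ cov] le_kappa]] := Hcov.
  have : [set: kappa] #<= [set: I].
    apply: (cov I A); split=> [i|]; first by split.
    apply/seteqP; split=> // x _; have /existsNP[i /contrapT Aix] := H x.
    by exists i.
  move=> /(card_le_trans le_kappa)/card_leTT o2I.
  by apply: (@succ_card_gt omega1); apply/card_leTT; apply: embeds_trans o2I sI.
exists (fun n => (decode e p0 x n).1); split=> //; first by move=> m n; apply: decode_le.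
by move=> i; have /existsNP[n /contrapT Dn] := xA i; exists n.
Qed.

End Generic.

(** * The weak diamond *)

Lemma stationary_sub (A B : set omega1) : A `<=` B -> stationary A -> stationary B.
Proof. by move=> AB sA C /sA[a [/AB Ba Ca]]; exists a. Qed.

Definition trunc (f : omega1 -> bool) (a x : omega1) := (x < a) && f x.

(** The restriction of [f] to [a] is replaced by its extension by [false], so
    that all the guesses bear on functions with domain omega_1. *)
Lemma weak_diamond_trunc (S : set omega1) : weak_diamond S ->
  forall F : (omega1 -> bool) -> omega1 -> bool, exists g : omega1 -> bool,
  forall f, stationary [set a | S a /\ F (trunc f a) a = g a].
Proof.
move=> wd F.
pose ext (eta : binseq) x := if pselect (below (projT1 eta) x) is left h
  then projT2 eta (SigSub (mem_set h)) else false.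
have extE f a : ext (restr f a) = trunc f a.
  apply/funext => x; rewrite /ext /trunc /=; case: pselect => [/= h|/negP /=].
    by move: (h); rewrite /below /= => ->.
  by rewrite /below /= => /negbTE ->.
have [g gP] := wd (fun eta => F (ext eta) (projT1 eta)).
pose g' a := if pselect (S a) is left h then g (SigSub (mem_set h)) else false.
exists g' => f; apply: stationary_sub (gP f) => _ [[a aS] /= fa <-] /=.
split; first exact: set_mem.
rewrite -extE fa /g'; case: pselect => [h|]; last by case; apply: set_mem.
by congr g; apply: val_inj.
Qed.

(** This is [2 ^ aleph_0 < 2 ^ aleph_1].  An injection [J] into the countable
    sequences would code [g] by a sequence that is determined by its restriction
    to a countable ordinal; from this restriction [F] recovers [g a] and guesses
    the opposite value, against the choice of [g] as its guessing function. *)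
Lemma weak_diamond_no_embedding : weak_diamond setT -> ~ embeds (omega1 -> bool) (nat -> omega1).
Proof.
move=> wd [J Ji]; have [pr pri] := embeds_omega1_nat.
pose code (d : nat -> omega1) x := `[< exists n, pr (n, d n) = x >].
have hd (e : omega1 -> bool) n : exists y, forall y', e (pr (n, y')) -> (forall z, e (pr (n, z)) -> z = y') -> y = y'.
  have [[y ey]|H] := pselect (exists y, e (pr (n, y))).
    by exists y => y' _ /(_ y ey).
  by exists (bound set0) => y' ey'; case: H; exists y'.
pose dec e := projT1 (choice (hd e)); have decP e := projT2 (choice (hd e)).
have hg (d : nat -> omega1) : exists g, forall g', J g' = d -> g = g'.
  have [[g Jg]|H] := pselect (exists g, J g = d).
    by exists g => g' Jg'; apply: Ji; rewrite Jg.
  by exists (fun=> false) => g' Jg'; case: H; exists g'.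
have [inv invP] := choice hg.
have [g gP] := weak_diamond_trunc wd (fun e a => ~~ inv (dec e) a).
have [a [_ aE] [a0 aB]] := (stationaryP _).1 (gP (code (J g)))
  (fun=> bound (range (fun n => pr (n, J g n)))).
suff E : dec (trunc (code (J g)) a) = J g by move: aE; rewrite E (invP _ g) //; case: (g a).
have [b ba] := a0.
apply/funext => n; apply: (decP (trunc (code (J g)) a)).
  rewrite /trunc; apply/andP; split; last by apply/asboolP; exists n.
  by apply: lt_trans (aB b ba); apply: boundP; [apply: countable_im|exists n].
by move=> z /andP[_ /asboolP[m /pri [-> ->]]].
Qed.

(** * Finite relations *)

Definition conv (X Y : eqType) (w : seq (X * Y)) : seq (Y * X) :=
  [seq (p.2, p.1) | p <- w].

Definition comp_rel (X Y Z : eqType) (u : seq (X * Y)) (w : seq (Y * Z)) : seq (X * Z) :=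
  [seq (p.1, q.2) | p <- u, q <- [seq q <- w | p.2 == q.1]].

Lemma mem_conv (X Y : eqType) (w : seq (X * Y)) x y : ((y, x) \in conv w) = ((x, y) \in w).
Proof.
apply/mapP/idP => [[[a b] ? [-> ->]]//|h]; by exists (x, y).
Qed.

Lemma comp_relP (X Y Z : eqType) (u : seq (X * Y)) (w : seq (Y * Z)) x z :
  reflect (exists y, (x, y) \in u /\ (y, z) \in w) ((x, z) \in comp_rel u w).
Proof.
apply: (iffP allpairsPdep) => [[[a b] [[c d] [/= au]]]|[y [xu yw]]].
  by rewrite mem_filter => /andP[/eqP /= e dw] [-> ->]; exists b; rewrite {2}e.
by exists (x, y), (y, z); rewrite mem_filter /= eqxx.
Qed.

Lemma mem_unzip1 (X Y : eqType) (w : seq (X * Y)) x :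
  reflect (exists y, (x, y) \in w) (x \in unzip1 w).
Proof. by apply: (iffP mapP) => [[[a b] h ->]|[y h]]; [exists b|exists (x, y)]. Qed.

Lemma mem_unzip2 (X Y : eqType) (w : seq (X * Y)) y :
  reflect (exists x, (x, y) \in w) (y \in unzip2 w).
Proof. by apply: (iffP mapP) => [[[a b] h ->]|[x h]]; [exists a|exists (x, y)]. Qed.

Lemma extend_cover (X Y : eqType) (P : seq (X * Y) -> Prop) (Q : X -> Prop) (w : seq (X * Y)) (s : seq X) :
  (forall v x, P v -> {subset w <= v} -> Q x -> exists y, P ((x, y) :: v)) ->
  P w -> (forall x, x \in s -> Q x) ->
  exists v, [/\ P v, {subset w <= v} & forall x, x \in s -> exists y, (x, y) \in v].
Proof.
move=> ext Pw; elim: s => [|x s IH] sQ; first by exists w; split.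
have [z zs|v [Pv wv vs]] := IH; first by apply: sQ; rewrite inE zs orbT.
have [y Py] := ext v x Pv wv (sQ x (mem_head _ _)); exists ((x, y) :: v); split=> //.
  by move=> p /wv pv; rewrite inE pv orbT.
move=> z; rewrite inE => /orP[/eqP ->|/vs[t zt]]; first by exists y; rewrite inE eqxx.
by exists t; rewrite inE zt orbT.
Qed.

(** * Homogeneous systems of finite maps *)

(** [G] is the set of finite partial elementary maps of an atomic model [M], as
    lists of pairs, and [rk] filters [M] into countable homogeneous pieces
    [rk x < g], for [g] below omega_1. *)
Record system (M : choiceType) (G : seq (M * M) -> Prop) (rk : M -> omega1) : Prop := {
  sys_inhabited : exists m : M, True;
  G_refl : forall w, (forall a b, (a, b) \in w -> a = b) -> G w;
  G_conv : forall w, G w -> G (conv w);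
  G_comp : forall w1 w2 w, G w1 -> G w2 ->
    (forall a c, (a, c) \in w -> exists b, (a, b) \in w1 /\ (b, c) \in w2) -> G w;
  G_ext : forall w a, G w -> exists b, G ((a, b) :: w);
  G_inj : forall w a b a' b', G w -> (a, b) \in w -> (a', b') \in w -> a = a' <-> b = b';
  rk_countable : forall g, countable [set x | rk x < g];
  rk_homogeneous : forall g w a, G w -> (forall x y, (x, y) \in w -> rk x < g /\ rk y < g) ->
    rk a < g -> exists2 b, rk b < g & G ((a, b) :: w)
}.

Section System.
Variables (M : choiceType) (G : seq (M * M) -> Prop) (rk : M -> omega1).
Hypothesis sysM : system G rk.

Lemma G_sub w v : G w -> {subset v <= w} -> G v.
Proof.
move=> Gw vw; apply: (G_comp sysM Gw (w2 := [seq (b, b) | b <- unzip2 w])).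
  by apply: (G_refl sysM) => a b /mapP[x _ [-> ->]].
move=> a c /vw acw; exists c; split=> //; apply/mapP; exists c => //.
by apply/mem_unzip2; exists a.
Qed.

Lemma G_cover w (s : seq M) : G w ->
  exists v, [/\ G v, {subset w <= v} & forall a, a \in s -> exists b, (a, b) \in v].
Proof.
move=> Gw; apply: (@extend_cover _ _ G (fun=> True)) => // v x Gv _ _.
exact: (G_ext sysM).
Qed.

Lemma homogeneous_cover g w (s : seq M) : G w ->
  (forall x y, (x, y) \in w -> rk x < g /\ rk y < g) -> (forall a, a \in s -> rk a < g) ->
  exists v, [/\ G v, {subset w <= v}, forall x y, (x, y) \in v -> rk x < g /\ rk y < g
    & forall a, a \in s -> exists b, (a, b) \in v].
Proof.
move=> Gw wg sg.
have [v x [Gv vg] _ xg|v [[Gv vg] wv vs]] := @extend_cover _ _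
    (fun v => G v /\ forall x y, (x, y) \in v -> rk x < g /\ rk y < g) (fun a => rk a < g)
    w s _ (conj Gw wg) sg; last by exists v.
have [y yg Gy] := rk_homogeneous sysM Gv vg xg; exists y; split=> // z t.
by rewrite inE => /orP[/eqP[-> ->]|/vg].
Qed.

Lemma small_system : small M.
Proof.
have h (a : omega1) : exists f : M -> nat, forall x y, rk x = a -> rk y = a -> f x = f y -> x = y.
  have [b ab] := omega1_gt a.
  have [f fi] := countableW (rk_countable sysM b).
  by exists f => x y xa ya; apply: fi; rewrite /= ?xa ?ya.
have [e eP] := choice h; apply: embeds_trans embeds_omega1_nat.
by exists (fun x => (e (rk x) x, rk x)) => x y [ee er]; apply: (eP (rk y)) => //; rewrite -{1}er.
Qed.

(** * Atomic sets *)

(** An atomic set is a set of names with, for each finite tuple of its members,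
    the set of tuples of [M] that have the same type.  It is given by the set
    [R] of its finite elementary maps into [M]. *)
Notation pmap := (seq (omega1 * M)).
Implicit Types (R : pmap -> Prop) (u v : pmap) (A V : set omega1) (s z : seq M).

Definition univ (R : pmap -> Prop) : set omega1 := [set x | exists m, R [:: (x, m)]].

Record atomic_set (R : pmap -> Prop) : Prop := {
  as_nil : R [::];
  as_comp : forall u w v, R u -> G w ->
    (forall x m, (x, m) \in v -> exists m0, (x, m0) \in u /\ (m0, m) \in w) -> R v;
  as_uniq : forall u v w, R u -> R v ->
    (forall a b, (a, b) \in w -> exists x, (x, a) \in u /\ (x, b) \in v) -> G w;
  as_inj : forall u x m y n, R u -> (x, m) \in u -> (y, n) \in u -> x = y <-> m = n;
  as_ext : forall u x, R u -> univ R x -> exists m, R ((x, m) :: u)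
}.

Definition within (A : set omega1) (u : pmap) := forall x m, (x, m) \in u -> A x.
Definition bounded (g : omega1) (u : pmap) := forall x m, (x, m) \in u -> rk m < g.

Lemma as_sub R u v : atomic_set R -> R u -> {subset v <= u} -> R v.
Proof.
move=> aR Ru vu; apply: (as_comp aR Ru (w := [seq (b, b) | b <- unzip2 u])).
  by apply: (G_refl sysM) => a b /mapP[x _ [-> ->]].
move=> x m /vu xm; exists m; split=> //; apply/mapP; exists m => //.
by apply/mem_unzip2; exists x.
Qed.

Lemma as_within R u : atomic_set R -> R u -> within (univ R) u.
Proof.
move=> aR Ru x m xm; exists m; apply: (as_sub aR Ru) => y; rewrite inE => /eqP -> //.
Qed.

Lemma as_cover R u (s : seq omega1) : atomic_set R -> R u -> (forall x, x \in s -> univ R x) ->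
  exists v, [/\ R v, {subset u <= v} & forall x, x \in s -> exists m, (x, m) \in v].
Proof.
move=> aR Ru; apply: (@extend_cover _ _ R (univ R)) => // v x Rv _ Rx.
exact: (as_ext aR Rv Rx).
Qed.

(** Write [M_g] for the piece [rk m < g] of [M].  Back and forth, a set at level
    [g] realises the same types as [M_g]; if it is countable, it is a copy of
    [M_g]. *)
Definition embeddable R g :=
  forall u x, R u -> bounded g u -> univ R x -> exists2 m, rk m < g & R ((x, m) :: u).
Definition level R g := embeddable R g /\
  forall u m, R u -> bounded g u -> rk m < g -> exists x, R ((x, m) :: u).

Lemma embeddable_cover R g u (s : seq omega1) : atomic_set R -> embeddable R g -> R u -> bounded g u ->
  (forall x, x \in s -> univ R x) ->
  exists v, [/\ R v, bounded g v, {subset u <= v} & forall x, x \in s -> exists m, (x, m) \in v].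
Proof.
move=> aR eR Ru ug sR.
have [v x [Rv vg] _ Rx|v [[Rv vg] uv vs]] := @extend_cover _ _
    (fun v => R v /\ bounded g v) (univ R) u s _ (conj Ru ug) sR; last by exists v.
have [m mg Rm] := eR _ _ Rv vg Rx; exists m; split=> // y n.
by rewrite inE => /orP[/eqP[_ ->]|/vg].
Qed.

Lemma level_embeddable R g g' : atomic_set R -> level R g -> g <= g' -> embeddable R g'.
Proof.
move=> aR [eR _] gg' u x Ru ug' Rx.
have b0 : bounded g [::] by [].
have [|v [Rv vg _ vs]] := embeddable_cover aR eR (as_nil aR) b0 (s := x :: unzip1 u).
  by move=> y; rewrite inE => /orP[/eqP -> //|/mem_unzip1[m ym]]; apply: (as_within aR Ru ym).
have [m xm] := vs _ (mem_head _ _).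
have Gw : G (comp_rel (conv v) u).
  apply: (as_uniq aR Rv Ru) => a b /comp_relP[y [ya yb]]; exists y.
  by rewrite mem_conv in ya.
have [|n ng' Gn] := rk_homogeneous sysM Gw _ (lt_le_trans (vg _ _ xm) gg').
  move=> a b /comp_relP[y [ya yb]]; rewrite mem_conv in ya.
  by split; [apply: lt_le_trans (vg _ _ ya) gg'|apply: ug' yb].
exists n => //; apply: (as_comp aR Rv Gn) => y l; rewrite inE => /orP[/eqP[-> ->]|yl].
  by exists m; rewrite inE eqxx.
have [|l' yl'] := vs y; first by rewrite inE; apply/orP; right; apply/mem_unzip1; exists l.
exists l'; split=> //; rewrite inE; apply/orP; right; apply/comp_relP; exists y.
by rewrite mem_conv.
Qed.

(** The atomic set that makes [k : V -> M] elementary. *)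
Definition induced (V : set omega1) (k : omega1 -> M) : pmap -> Prop :=
  fun u => within V u /\ G [seq (k p.1, p.2) | p <- u].

Lemma univ_induced V k : univ (induced V k) = V.
Proof.
apply/seteqP; split=> [x [m [xV _]]|x Vx]; first by apply: (xV x m); rewrite inE.
exists (k x); split; first by move=> y m; rewrite inE => /eqP[-> _].
by apply: (G_refl sysM) => a b; rewrite inE => /eqP[-> ->].
Qed.

Lemma mem_mapk (k : omega1 -> M) (u : pmap) a m :
  reflect (exists2 x, a = k x & (x, m) \in u) ((a, m) \in [seq (k p.1, p.2) | p <- u]).
Proof.
by apply: (iffP mapP) => [[[x n] h [-> ->]]|[x -> h]]; [exists x|exists (x, m)].
Qed.

Lemma induced_atomic V k : (forall x y, V x -> V y -> k x = k y -> x = y) ->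
  atomic_set (induced V k).
Proof.
move=> ki; split.
- by split=> //; apply: (G_refl sysM).
- move=> u w v [uV Gu] Gw vuw; split; first by move=> x m /vuw[n [/uV]].
  apply: (G_comp sysM Gu Gw) => a c /mem_mapk[x -> /vuw[n [xn nc]]].
  by exists n; split=> //; apply/mem_mapk; exists x.
- move=> u v w [uV Gu] [vV Gv] uvw; apply: (G_comp sysM (G_conv sysM Gu) Gv) => a b /uvw[x [xa xb]].
  by exists (k x); rewrite mem_conv; split; apply/mem_mapk; exists x.
- move=> u x m y n [uV Gu] xm yn.
  have -> : x = y <-> k x = k y by split=> [->//|]; apply: ki; [apply: uV xm|apply: uV yn].
  by apply: (G_inj sysM Gu); apply/mem_mapk; [exists x|exists y].
- move=> u x [uV Gu] [m [xV _]]; have [n Gn] := G_ext sysM (k x) Gu.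
  exists n; split=> // y l; rewrite inE => /orP[/eqP[-> _]|/uV //].
  by apply: (xV x m); rewrite inE.
Qed.

Lemma induced_level V k g : (forall x, V x -> rk (k x) < g) ->
  (forall m, rk m < g -> exists2 x, V x & k x = m) -> level (induced V k) g.
Proof.
move=> kg konto; have ug u : within V u -> bounded g u ->
    forall a b, (a, b) \in [seq (k p.1, p.2) | p <- u] -> rk a < g /\ rk b < g.
  by move=> uV ug a b /mem_mapk[x -> xb]; split; [apply/kg/(uV _ _ xb)|apply: ug xb].
split=> [u x [uV Gu] bu|u m [uV Gu] bu mg].
  rewrite univ_induced => Vx; have [m mg Gm] := rk_homogeneous sysM Gu (ug u uV bu) (kg x Vx).
  by exists m => //; split=> // y n; rewrite inE => /orP[/eqP[-> _]|/uV].
have [|n ng Gn] := rk_homogeneous sysM (G_conv sysM Gu) (g := g) _ mg.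
  by move=> a b; rewrite mem_conv => /(ug u uV bu)[].
have [x Vx kx] := konto _ ng; exists x; split.
  by move=> y l; rewrite inE => /orP[/eqP[-> _]|/uV].
apply: (G_sub (G_conv sysM Gn)) => -[a b].
rewrite [map _ _]/= kx inE mem_conv inE mem_conv => /orP[/eqP[-> ->]|->]; first by rewrite eqxx.
by rewrite orbT.
Qed.

(** * Omitting types *)

(** The type over [A] of a tuple [c] of names is represented by the pairs [(z, u)]
    for which [u] is defined on a part of [A] and the map that extends [u] and
    sends [c] to [z] is elementary. *)
Definition ptype := seq M -> pmap -> Prop.

Definition type_of (A : set omega1) R (c : seq omega1) : ptype :=
  fun z u => [/\ within A u, size c = size z & R (zip c z ++ u)].

(** The type of [s] is realised in [M_g]. *)
Definition into g (s : seq M) := exists w, [/\ G w, forall a b, (a, b) \in w -> rk b < g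
  & forall a, a \in s -> exists b, (a, b) \in w].

(** A test [(u0, ys, z)] asks for the finite maps [u] of [R] that extend [u0] and
    whose image is admissible for [ys], and it forces the type [p] over [A] if all
    of them give [z] the type [p].  For empty [ys] this means that [u0] isolates
    [p].  A block [(b, g)] of [ys] stands for parameters [b] taken in an
    extension of [R] to the level [g]; so isolation of [p] over such an extension
    can be expressed, and excluded in advance, without leaving [R]. *)
Fixpoint admissible (ys : seq (seq M * omega1)) (s : seq M) : Prop :=
  if ys is (b, g) :: ys' then into g (b ++ s) /\ admissible ys' (b ++ s) else True.

Definition valid R u0 ys := [/\ R u0, admissible ys (unzip2 u0) &
  forall u x, R u -> {subset u0 <= u} -> admissible ys (unzip2 u) -> univ R x ->
    exists2 d, R ((x, d) :: u) & admissible ys (d :: unzip2 u)].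

Definition forces R (A : set omega1) (p : ptype) u0 ys (z : seq M) :=
  forall u v, R u -> {subset u0 <= u} -> admissible ys (unzip2 u) ->
    {subset v <= u} -> within A v -> p z v.

Definition omitted R A p := forall u0 ys z, valid R u0 ys -> ~ forces R A p u0 ys z.

Lemma into_sub g s s' : into g s -> {subset s' <= s} -> into g s'.
Proof. by move=> [v [Gv vg vs]] ss; exists v; split=> // a /ss /vs. Qed.

Lemma admissible_sub ys s s' : admissible ys s -> {subset s' <= s} -> admissible ys s'.
Proof.
elim: ys s s' => [|[b g] ys IH] s s' //= [ig adm] ss.
have ss' : {subset b ++ s' <= b ++ s}.
  by move=> x; rewrite !mem_cat => /orP[->//|/ss ->]; rewrite orbT.
by split; [apply: into_sub ig ss'|apply: IH adm ss'].
Qed.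

(** By homogeneity, a copy of [s] in [M_g] can be moved so as to be compatible
    with the map [w1] from [M_g]. *)
Lemma into_align g w1 (s : seq M) : G w1 -> (forall a b, (a, b) \in w1 -> rk a < g) ->
  into g (unzip2 w1 ++ s) ->
  exists w2, [/\ G w2, forall a b, (a, b) \in w2 -> rk a < g, {subset w1 <= w2},
    {subset unzip2 w2 <= unzip2 w1 ++ s} & forall d, d \in unzip2 w1 ++ s -> exists a, (a, d) \in w2].
Proof.
move=> G1 g1 [v [Gv vg vs]].
pose v' := [seq p <- v | p.1 \in unzip2 w1 ++ s].
have Gv' : G v' by apply: (G_sub Gv) => p; rewrite mem_filter => /andP[].
have v'P a b : (a, b) \in v' = (a \in unzip2 w1 ++ s) && ((a, b) \in v) by rewrite mem_filter.
pose w0 := comp_rel (conv v') (conv w1).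
have w0P b m : (b, m) \in w0 -> exists d, (d, b) \in v' /\ (m, d) \in w1.
  by move=> /comp_relP[d]; rewrite !mem_conv => ?; exists d.
have Gw0 : G w0.
  apply: (G_comp sysM (G_conv sysM Gv') (G_conv sysM G1)) => b m /w0P[d ?].
  by exists d; rewrite !mem_conv.
have [||w3 [G3 w03 g3 c3]] := @homogeneous_cover g w0 (unzip2 v') Gw0.
- by move=> b m /w0P[d [+ /g1 ?]]; rewrite v'P => /andP[_ /vg].
- by move=> b /mem_unzip2[d]; rewrite v'P => /andP[_ /vg].
exists (comp_rel (conv w3) (conv v')); have w2P m d :
    (m, d) \in comp_rel (conv w3) (conv v') <-> exists b, (b, m) \in w3 /\ (d, b) \in v'.
  split=> [/comp_relP[b]|[b h]]; first by rewrite !mem_conv => h; exists b.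
  by apply/comp_relP; exists b; rewrite !mem_conv.
split.
- apply: (G_comp sysM (G_conv sysM G3) (G_conv sysM Gv')) => m d /w2P[b ?].
  by exists b; rewrite !mem_conv.
- by move=> m d /w2P[b [/g3[]]].
- move=> [m d] md; apply/w2P.
  have ds : d \in unzip2 w1 ++ s by rewrite mem_cat; apply/orP; left; apply/mem_unzip2; exists m.
  have [b db] := vs _ ds; exists b; rewrite v'P ds db; split=> //.
  by apply: w03; apply/comp_relP; exists d; rewrite !mem_conv v'P ds db.
- by move=> d /mem_unzip2[m /w2P[b [_]]]; rewrite v'P => /andP[].
move=> d ds; have [b db] := vs _ ds.
have dbv : (d, b) \in v' by rewrite v'P ds db.
have [|m bm] := c3 b; first by apply/mem_unzip2; exists d.
by exists m; apply/w2P; exists b.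
Qed.

(** The same notions for [M_g] in place of an atomic set. *)
Definition below_map g (w : seq (M * M)) := G w /\ forall a b, (a, b) \in w -> rk a < g.

Definition valid_below g (w0 : seq (M * M)) ys := [/\ below_map g w0, admissible ys (unzip2 w0) &
  forall w a, below_map g w -> {subset w0 <= w} -> admissible ys (unzip2 w) -> rk a < g ->
    exists2 d, G ((a, d) :: w) & admissible ys (d :: unzip2 w)].

(** The finite map [v] into [M_g] is a reason why the test does not force [p]. *)
Definition breaks g A (p : ptype) (w0 : seq (M * M)) ys z v := exists w u3,
  [/\ below_map g w, {subset w0 <= w} & admissible ys (unzip2 w)] /\
  [/\ forall x d, (x, d) \in u3 -> A x /\ exists m, (x, m) \in v /\ (m, d) \in w & ~ p z u3].

Lemma valid_below_cover g w0 ys (s : seq M) : valid_below g w0 ys ->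
  (forall a, a \in s -> rk a < g) ->
  exists w, [/\ below_map g w, {subset w0 <= w}, admissible ys (unzip2 w)
    & forall a, a \in s -> exists d, (a, d) \in w].
Proof.
move=> [b0 a0 ext] sg.
have [v x [bv va] wv xg|v [[bv va] wv vs]] := @extend_cover _ _
    (fun w => below_map g w /\ admissible ys (unzip2 w)) (fun a => rk a < g) w0 s _ (conj b0 a0) sg;
  last by exists v.
have [d Gd ad] := ext _ _ bv wv va xg; exists d; split=> //; split=> // y z.
by rewrite inE => /orP[/eqP[-> _]|/(bv.2 _ _)].
Qed.

(** A test over [M_g], seen along an embedding of [R] into [M_g] that is only
    known on a finite set [u], becomes a test over [R]: its first block names the
    members of [M_g] in use, at level [g].  As the latter does not force [p],
    the former can be made to fail by extending [u]. *)
Lemma breaks_dense R g A p w0 ys z : atomic_set R -> embeddable R g -> omitted R A p ->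
  valid_below g w0 ys -> forall u, R u -> bounded g u ->
  exists v, [/\ R v, bounded g v, {subset u <= v} & breaks g A p w0 ys z v].
Proof.
move=> aR eR om vw0 u Ru ug.
have [|w1 [[G1 g1] w01 a1 c1]] := @valid_below_cover g w0 ys (unzip2 u) vw0.
  by move=> a /mem_unzip2[x /ug].
have [_ _ ext] := vw0.
pose u1 := comp_rel u w1.
have Ru1 : R u1 by apply: (as_comp aR Ru G1) => x d /comp_relP.
have align u2 : R u2 -> into g (unzip2 w1 ++ unzip2 u2) -> exists w2,
    [/\ below_map g w2, {subset w1 <= w2}, {subset unzip2 w2 <= unzip2 w1 ++ unzip2 u2},
     forall d, d \in unzip2 w1 ++ unzip2 u2 -> exists a, (a, d) \in w2 &
     R (comp_rel u2 (conv w2)) /\ bounded g (comp_rel u2 (conv w2))].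
  move=> Ru2 i2; have [w2 [G2 g2 w12 s2 c2]] := into_align G1 g1 i2.
  exists w2; split=> //; split; first by apply: (as_comp aR Ru2 (G_conv sysM G2)) => x d /comp_relP.
  by move=> x m /comp_relP[d []]; rewrite mem_conv => _ /g2.
have val1 : valid R u1 ((unzip2 w1, g) :: ys).
  split=> //.
    have sub1 : {subset unzip2 w1 ++ unzip2 u1 <= unzip2 w1}.
      move=> d; rewrite mem_cat => /orP[//|/mem_unzip2[x /comp_relP[m [_ md]]]].
      by apply/mem_unzip2; exists m.
    split; last exact: admissible_sub a1 sub1.
    exists (conv w1); split; [exact: (G_conv sysM)|by move=> a b; rewrite mem_conv => /g1|].
    by move=> d /sub1/mem_unzip2[m md]; exists m; rewrite mem_conv.
  move=> u2 x Ru2 u12 [i2 ad2] Rx.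
  have [w2 [bw2 w12 s2 c2 [Rv gv]]] := align u2 Ru2 i2.
  have [m mg Rm] := eR _ _ Rv gv Rx.
  have w02 : {subset w0 <= w2} by move=> y /w01 /w12.
  have [d Gd add] := ext w2 m bw2 w02 (admissible_sub ad2 s2) mg.
  have sub3 : {subset unzip2 w1 ++ d :: unzip2 u2 <= d :: unzip2 w2}.
    move=> e; rewrite mem_cat !inE orbCA => /orP[->//|e2].
    have [|a ae] := c2 e; first by rewrite mem_cat.
    by apply/orP; right; apply/mem_unzip2; exists a.
  exists d.
    apply: (as_comp aR Rm Gd) => y e; rewrite inE => /orP[/eqP[-> ->]|ye].
      by exists m; rewrite !inE !eqxx.
    have [|a ae] := c2 e; first by rewrite mem_cat; apply/orP; right; apply/mem_unzip2; exists y.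
    exists a; rewrite !inE ae !orbT; split=> //; apply/orP; right; apply/comp_relP.
    by exists e; rewrite mem_conv.
  split; last exact: admissible_sub add sub3.
  exists (conv ((m, d) :: w2)); split; first exact: (G_conv sysM).
    by move=> a b; rewrite mem_conv inE => /orP[/eqP[-> _]|/(bw2.2 _ _)].
  move=> e /sub3; rewrite inE => /orP[/eqP ->|/mem_unzip2[a ae]].
    by exists m; rewrite mem_conv inE eqxx.
  by exists a; rewrite mem_conv inE ae orbT.
have /existsNP[u2 /existsNP[v3]] := om _ _ z val1.
move=> /not_implyP[Ru2 /not_implyP[u12 /not_implyP[[i2 ad2] /not_implyP[v32 /not_implyP[v3A npz]]]]].
have [w2 [bw2 w12 s2 c2 [Rv gv]]] := align u2 Ru2 i2.
exists (comp_rel u2 (conv w2)); split=> //.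
  move=> [x m] xm; have [|d md] := c1 m; first by apply/mem_unzip2; exists x.
  apply/comp_relP; exists d; rewrite mem_conv; split; last exact: w12.
  by apply: u12; apply/comp_relP; exists m.
exists w2, v3; split; split=> //.
- by move=> y /w01 /w12.
- exact: admissible_sub ad2 s2.
move=> x d xd; split; first exact: v3A xd.
have [|a ae] := c2 d; first by rewrite mem_cat; apply/orP; right; apply/mem_unzip2; exists x; apply: v32.
by exists a; split=> //; apply/comp_relP; exists d; rewrite mem_conv; split=> //; apply: v32.
Qed.

(** * Generic extensions *)

(** The conditions: the names with their types, the types promised to be
    omitted, each with the set of names that it is over, and the level. *)
Record state := State {
  rel : pmap -> Prop;
  prom : set (set omega1 * ptype);
  lev : omega1
}.

Definition members q : set omega1 := univ (rel q).

Definition good q := [/\ atomic_set (rel q), countable (members q),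
  level (rel q) (lev q), countable (prom q) & forall A p, prom q (A, p) -> omitted (rel q) A p].

Definition extends q q' := [/\ forall u, rel q u -> rel q' u,
  forall u, rel q' u -> within (members q) u -> rel q u, prom q `<=` prom q' & lev q <= lev q'].

Lemma members_extends q q' : extends q q' -> members q `<=` members q'.
Proof. by move=> [qq' _ _ _] x [m /qq' qm]; exists m. Qed.

Lemma extends_refl q : extends q q. Proof. by split. Qed.

Lemma extends_trans q1 q2 q3 : extends q1 q2 -> extends q2 q3 -> extends q1 q3.
Proof.
move=> e12 e23; have [h1 r1 p1 l1] := e12; have [h2 r2 p2 l2] := e23.
split; [by move=> u /h1 /h2| |by move=> x /p1 /p2|exact: le_trans l1 l2].
move=> u /r2 ru wu; apply: r1 => //; apply: ru => x m /wu.
exact: members_extends.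
Qed.

Lemma fresh_names (A : set omega1) : countable A ->
  exists2 f : nat -> omega1, injective f & forall n, ~ A (f n).
Proof.
move=> /countable_bound[b bP]; have [nxt nxtP] := choice omega1_gt.
have up m n : iter m nxt b < iter (m + n.+1) nxt b.
  elim: n => [|n IH]; first by rewrite addn1 /=.
  by rewrite addnS /=; apply: lt_trans IH _.
have lt m n : (m < n)%N -> iter m nxt b < iter n nxt b.
  by move=> mn; have := up m (n - m.+1)%N; rewrite addnS -addSn subnKC.
exists (fun n => iter n nxt b) => [m n e|n /bP].
  by case: (ltngtP m n) => // /lt; rewrite e ltxx.
by case: n => [|n]; rewrite ?ltxx // => /(lt_trans (lt 0%N n.+1 isT)); rewrite ltxx.
Qed.

Lemma small_sum (A B : Type) : small A -> small B -> small (A + B).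
Proof.
move=> [f fi] [g gi]; apply: embeds_trans embeds_omega1_nat.
exists (fun x => match x with inl a => (0%N, f a) | inr b => (1%N, g b) end).
by move=> [a|b] [a'|b'] //= [] => [/fi|/gi] ->.
Qed.

Lemma small_sub (A : Type) (P : set A) : countable P -> small {x | P x}.
Proof.
move=> /countableW[f fi]; apply: embeds_trans embeds_nat_omega1.
exists (fun x => f (sval x)) => -[x Px] [y Py] /= /fi xy.
by apply: eq_exist; apply: xy.
Qed.

Definition test := ((seq (M * M) * seq (seq M * omega1)) * seq M)%type.

Lemma small_test X : small X -> small ((seq (X * M) * seq (seq M * omega1)) * seq M).
Proof.
have sM := small_system; have s1 : small omega1 by exists id.
by move=> sX; do !apply: small_prod; do ?[apply: small_seq|apply: small_prod].
Qed.

Hypothesis Hcov : cov_meager_ge omega2.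

(** The generic extension of [q] to level [g] is obtained from a generic
    embedding of [q] into [M_g], by adding new names for the rest of [M_g].  Its
    promises are kept because the embedding breaks each of the [aleph_1] valid
    tests over [M_g], by [breaks_dense]. *)
Lemma generic_extension q g u0 (I : Type) (D : I -> set pmap) : good q ->
  lev q <= g -> rel q u0 -> bounded g u0 -> small I ->
  (forall i u, rel q u -> bounded g u -> {subset u0 <= u} ->
     exists v, [/\ rel q v, bounded g v, {subset u <= v} & D i v]) ->
  exists V k, let q' := State (induced V k) (prom q) g in
    [/\ extends q q', good q',
        forall x m, (x, m) \in u0 -> k x = m &
        forall i, exists v, [/\ rel q v, D i v & forall x m, (x, m) \in v -> k x = m]] /\
    ((forall x, V x -> rk (k x) < g) /\ forall m, rk m < g -> exists2 x, V x & k x = m).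
Proof.
move=> [aR cV l0 cP oP] g0g R0 b0 sI dense.
set R := rel q in aR oP l0 R0 dense *.
have eR : embeddable R g := level_embeddable aR l0 g0g.
pose P : set pmap := [set u | [/\ R u, bounded g u & {subset u0 <= u}]].
pose J := (I + omega1 + {Ap | prom q Ap} * test)%type.
pose DJ (j : J) : set pmap := match j with
  | inl (inl i) => D i
  | inl (inr x) => [set u | univ R x -> exists m, (x, m) \in u]
  | inr (Ap, t) => [set u | valid_below g t.1.1 t.1.2 ->
                      breaks g (sval Ap).1 (sval Ap).2 t.1.1 t.1.2 t.2 u]
  end.
have [||||||s [s0 sP sle sD]] := @generic_sequence Hcov pmap
    (fun v u => {subset u <= v}) _ _ P J DJ u0.
- by move=> p x.
- by move=> p r t pr rt x /pr /rt.
- apply: (@countable_sub _ _ [set u | forall p, p \in u -> (members q `*` [set m | rk m < g]) p]).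
    move=> u [Ru ug _] [x m] xm; split; [exact: (as_within aR Ru xm)|exact: (ug x)].
  by apply: countable_seqP; apply: countableX => //; apply: (rk_countable sysM).
- by apply: small_sum; [apply: small_sum => //; exists id|apply: small_prod; [exact: small_sub|exact: small_test small_system]].
- by split.
- move=> [[i|x]|[[[A p] pq] [[w0 ys] z]]] u [Ru ug uu0].
  + have [v [Rv vg uv Dv]] := dense i u Ru ug uu0.
    by exists v; split=> //; split=> // y /uu0 /uv.
  + have [Rx|nRx] := pselect (univ R x); last by exists u; split.
    have [m mg Rm] := eR _ _ Ru ug Rx.
    exists ((x, m) :: u); split; last by move=> _; exists m; rewrite inE eqxx.
    * split=> //; last by move=> y /uu0 yu; rewrite inE yu orbT.
      by move=> y n; rewrite inE => /orP[/eqP[_ ->]|/ug].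
    * by move=> y yu; rewrite inE yu orbT.
  + have [val|nval] := pselect (valid_below g w0 ys); last by exists u; split.
    have [v [Rv vg uv bv]] := breaks_dense z aR eR (oP _ _ pq) val Ru ug.
    by exists v; split=> //; split=> // y /uu0 /uv.
pose K x m := exists n, (x, m) \in s n.
have Rs n : R (s n) by case: (sP n).
have Kg x m : K x m -> rk m < g by move=> [n]; case: (sP n) => _ + _ => /[apply].
have Kinj x m y n : K x m -> K y n -> x = y <-> m = n.
  move=> [i xi] [j yj]; apply: (as_inj aR (Rs (maxn i j))).
    exact: (sle _ _ (leq_maxl i j)).
  exact: (sle _ _ (leq_maxr i j)).
have KR x m : K x m -> univ R x by move=> [n]; apply: (as_within aR (Rs n)).
have Ktot x : univ R x -> exists m, K x m.
  by move=> Rx; have [n /(_ Rx)[m xm]] := sD (inl (inr x)); exists m, n.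
have [e ei] := countableW (rk_countable sysM g).
have [new newi newP] := fresh_names cV.
pose N m := rk m < g /\ ~ exists x, K x m.
pose V := univ R `|` [set new (e m) | m in N].
have h x : exists m, (univ R x -> K x m) /\ (forall m', N m' -> new (e m') = x -> m = m').
  have [Rx|nRx] := pselect (univ R x).
    have [m xm] := Ktot _ Rx; exists m; split=> // m' _ ex.
    by case: (newP (e m')); rewrite ex.
  have [[m [Nm em]]|nN] := pselect (exists m, N m /\ new (e m) = x).
    exists m; split=> // m' Nm' em'; apply: ei; [by case: Nm|by case: Nm'|].
    by apply: newi; rewrite em em'.
  have [m0 _] := sys_inhabited sysM.
  by exists m0; split=> // m' Nm' em'; case: nN; exists m'.
have [k kP] := choice h.
have kK x m : K x m -> k x = m.
  by move=> Kxm; apply/(Kinj _ _ _ _ (proj1 (kP x) (KR _ _ Kxm)) Kxm).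
have kN m : N m -> k (new (e m)) = m by move=> Nm; apply: (proj2 (kP _)).
have Kk x : univ R x -> K x (k x) by move=> /(proj1 (kP x)).
have kV x : V x -> rk (k x) < g.
  by move=> [/Kk/Kg//|[m Nm <-]]; rewrite kN //; case: Nm.
have ki x y : V x -> V y -> k x = k y -> x = y.
  move=> [/Kk Kx|[m Nm <-]] [/Kk Ky|[n Nn <-]].
  - by move=> E; apply/(Kinj _ _ _ _ Kx Ky).
  - by rewrite kN // => E; case: Nn => _ []; exists x; rewrite -E.
  - by rewrite kN // => E; case: Nm => _ []; exists y; rewrite E.
  - by rewrite !kN // => ->.
have konto m : rk m < g -> exists2 x, V x & k x = m.
  move=> mg; have [[x Kx]|n] := pselect (exists x, K x m).
    by exists x; [left; apply: KR Kx|exact: kK].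
  by exists (new (e m)); [right; exists m|apply: kN].
have sk n x m : (x, m) \in s n -> k x = m by move=> xm; apply: kK; exists n.
(* A finite map on old members is elementary iff it is so on the generic sequence. *)
have cover u : within (univ R) u -> exists n, forall x m, (x, m) \in u -> (x, k x) \in s n.
  elim: u => [|[x m] u IH] uR; first by exists 0%N.
  have [y l yl|n nP] := IH; first by apply: (uR y l); rewrite inE yl orbT.
  have [|i xi] := Kk x; first by apply: (uR x m); rewrite inE eqxx.
  exists (maxn n i) => y l; rewrite inE => /orP[/eqP[-> _]|/nP yn].
    exact: (sle _ _ (leq_maxr n i)).
  exact: (sle _ _ (leq_maxl n i)).
have ind u : within (univ R) u -> R u <-> G [seq (k p.1, p.2) | p <- u].
  move=> uR; have [n nP] := cover u uR; split=> [Ru|Gu].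
    apply: (as_uniq aR (Rs n) Ru) => a b /mem_mapk[x -> xb]; exists x; split=> //; exact: nP xb.
  apply: (as_comp aR (Rs n) Gu) => x m xm; exists (k x); split; first exact: nP xm.
  by apply/mem_mapk; exists x.
exists V, k; split=> //.
have aV := induced_atomic ki.
split=> /=.
- split=> //= u; rewrite /members /=.
    move=> Ru; split; last exact/(ind u (as_within aR Ru)).
    by move=> x m /(as_within aR Ru); left.
  by move=> [_ Gu] uR; apply/ind.
- split=> //=.
  + rewrite /members /= univ_induced; apply: countable_cup => //; apply: countable_im.
    by apply: countable_sub (rk_countable sysM g) => m [].
  + exact: induced_level.
  + move=> A p pq u0' ys z [[V0 G0] a0 ext] frc.
    pose w0 := [seq (k p.1, p.2) | p <- u0'].
    have w2 u : unzip2 [seq (k p.1, p.2) | p <- u] = unzip2 u by rewrite /unzip2 -map_comp.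
    (* A map on [M_g] is pulled back along [k]. *)
    have pull (w : seq (M * M)) : below_map g w -> exists u, [/\ induced V k u,
        unzip2 u = unzip2 w & forall x m, V x -> (x, m) \in u <-> (k x, m) \in w].
      move=> [Gw wg]; have h' m : exists x, rk m < g -> V x /\ k x = m.
        have [mg|] := pselect (rk m < g); last by exists (bound set0).
        by have [x Vx kx] := konto _ mg; exists x.
      have [l lP] := choice h'; exists [seq (l p.1, p.2) | p <- w].
      have wE : [seq (k p.1, p.2) | p <- [seq (l p.1, p.2) | p <- w]] = w.
        rewrite -map_comp; rewrite -[RHS]map_id; apply/eq_in_map => -[a b] ab /=.
        by case: (lP a (wg _ _ ab)) => _ ->.
      split; [split|by rewrite /unzip2 -map_comp|].
      - by move=> x m /mapP[[a b] ab [-> _]] /=; case: (lP a (wg _ _ ab)).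
      - by rewrite wE.
      move=> x m Vx; split=> [xm|kxm]; last first.
        apply/mapP; exists (k x, m) => //=; have [Vl kl] := lP _ (wg _ _ kxm).
        by congr (_, _); apply: ki.
      by rewrite -wE; apply/mem_mapk; exists x.
    have val : valid_below g w0 ys.
      split; first by split=> // a b /mem_mapk[x -> /V0/kV].
        by rewrite /w0 w2.
      move=> w a bw w0w aw ag; have [u [iu u2 uP]] := pull w bw.
      have [y Vy ky] := konto _ ag.
      have [||//|d [_ Gd] ad] := ext u y iu.
      - by move=> [x m] xm; apply/(uP x m (V0 _ _ xm))/w0w/mem_mapk; exists x.
      - by rewrite u2.
      - by rewrite univ_induced.
      exists d; last by rewrite -u2.
      apply: (G_sub Gd) => -[b c]; rewrite !inE /= ky => /orP[->//|bc].
      apply/orP; right; apply/mem_mapk.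
      have [x Vx kx] := konto _ (bw.2 _ _ bc); exists x => //; apply/uP => //; by rewrite kx.
    have [n] := sD (inr (exist _ (A, p) pq, ((w0, ys), z))).
    move=> /(_ val)[w [u3 [[bw w0w aw] [u3P npz]]]].
    have [u [iu u2 uP]] := pull w bw.
    apply: npz; apply: (frc u) => //.
    * by move=> [x m] xm; apply/(uP x m (V0 _ _ xm))/w0w/mem_mapk; exists x.
    * by rewrite u2.
    * move=> [x d] /u3P[_ [m [xm md]]]; apply/uP; last by rewrite (sk _ _ _ xm).
      by left; apply: KR; exists n; exact: xm.
    * by move=> x d /u3P[].
- by move=> x m xm; apply: (sk 0%N); rewrite s0.
move=> i; have [n Dn] := sD (inl (inl i)).
by exists (s n); split=> // x m; apply: sk.
Qed.

(** * Types realised in extensions *)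

Lemma zip_mid (X Y Z : eqType) (c : seq X) (z : seq Y) (z' : seq Z) a b :
  size c = size z -> size c = size z' -> (a, b) \in zip z z' ->
  exists x, (x, a) \in zip c z /\ (x, b) \in zip c z'.
Proof.
elim: c z z' => [|x c IH] [|y z] [|y' z'] //= [sz] [sz'].
rewrite inE => /orP[/eqP[-> ->]|/(IH _ _ sz sz')[x' [h h']]].
  by exists x; rewrite !inE !eqxx.
by exists x'; rewrite !inE h h' !orbT.
Qed.

Lemma zip_lift (X Y Z : eqType) (c : seq X) (z : seq Y) (z' : seq Z) x b :
  size c = size z -> size c = size z' -> (x, b) \in zip c z' ->
  exists a, (x, a) \in zip c z /\ (a, b) \in zip z z'.
Proof.
elim: c z z' => [|x' c IH] [|y z] [|y' z'] //= [sz] [sz'].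
rewrite inE => /orP[/eqP[-> ->]|/(IH _ _ sz sz')[a [h h']]].
  by exists y; rewrite !inE !eqxx.
by exists a; rewrite !inE h h' !orbT.
Qed.

Lemma as_tuple R u (c : seq omega1) : atomic_set R -> R u -> (forall x, x \in c -> univ R x) ->
  exists z, size c = size z /\ R (zip c z ++ u).
Proof.
move=> aR Ru; elim: c => [|x c IH] cR; first by exists [::].
have [y yc|z [sz Rz]] := IH; first by apply: cR; rewrite inE yc orbT.
have [m Rm] := as_ext aR Rz (cR x (mem_head _ _)).
by exists (m :: z); rewrite /= sz.
Qed.

(** The realising tuple, taken as a parameter, isolates the type. *)
Lemma realised_not_omitted R A c : atomic_set R -> (forall x, x \in c -> univ R x) ->
  ~ omitted R A (type_of A R c).
Proof.
move=> aR cR om; have [z [sz Rz]] := as_tuple aR (as_nil aR) cR.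
rewrite cats0 in Rz; apply: (om (zip c z) [::] z).
  by split=> // u x Ru _ _ Rx; have [d Rd] := as_ext aR Ru Rx; exists d.
move=> u v Ru zu _ vu vA; split=> //; apply: (as_sub aR Ru) => x.
by rewrite mem_cat => /orP[/zu|/vu].
Qed.

Lemma valid_cover R u0 ys (s : seq omega1) : valid R u0 ys -> (forall x, x \in s -> univ R x) ->
  exists u, [/\ R u, {subset u0 <= u}, admissible ys (unzip2 u)
    & forall x, x \in s -> exists d, (x, d) \in u].
Proof.
move=> [R0 a0 ext] sR.
have [v x [Rv va] uv Rx|v [[Rv va] uv vs]] := @extend_cover _ _
    (fun v => R v /\ admissible ys (unzip2 v)) (univ R) u0 s _ (conj R0 a0) sR; last by exists v.
by have [d Rd ad] := ext _ _ Rv uv va Rx; exists d.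
Qed.

(** An admissible map gives [z] both types; as the finite part [(z', u')] of the
    first type differs from this one by an elementary map, it also belongs to the
    second type. *)
Lemma type_of_sub q q1 q2 A c1 c2 u0 ys z :
  atomic_set (rel q1) -> atomic_set (rel q2) -> A `<=` members q -> valid (rel q) u0 ys ->
  forces (rel q) A (type_of A (rel q1) c1) u0 ys z ->
  forces (rel q) A (type_of A (rel q2) c2) u0 ys z ->
  forall z' u', type_of A (rel q1) c1 z' u' -> type_of A (rel q2) c2 z' u'.
Proof.
move=> a1 a2 Aq val f1 f2 z' u' [uA sz1 R1].
have [|u [Ru u0u au cu]] := valid_cover (s := unzip1 u') val.
  by move=> x /mem_unzip1[m /uA /Aq].
pose u3 := [seq p <- u | p.1 \in unzip1 u'].
have u3u : {subset u3 <= u} by move=> p; rewrite mem_filter => /andP[].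
have u3A : within A u3.
  by move=> x m; rewrite mem_filter => /andP[/= /mem_unzip1[n /uA]].
have [_ sz R1'] := f1 u u3 Ru u0u au u3u u3A.
have [_ sz2 R2'] := f2 u u3 Ru u0u au u3u u3A.
have sz2' : size c2 = size z' by rewrite sz2 -sz sz1.
have Gw : G (zip z z' ++ comp_rel (conv u3) u').
  apply: (as_uniq a1 R1' R1) => a b; rewrite mem_cat => /orP[/(zip_mid sz sz1)[x [xa xb]]|].
    by exists x; rewrite !mem_cat xa xb.
  by move=> /comp_relP[x [+ xb]]; rewrite mem_conv => xa; exists x; rewrite !mem_cat xa xb !orbT.
split=> //; apply: (as_comp a2 R2' Gw) => x m; rewrite mem_cat => /orP[/(zip_lift sz2 sz2')[a [xa am]]|xm].
  by exists a; rewrite !mem_cat xa am.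
have xu' : x \in unzip1 u' by apply/mem_unzip1; exists m.
have [d xd] := cu x xu'; have xd3 : (x, d) \in u3 by rewrite mem_filter /= xu'.
exists d; rewrite !mem_cat xd3 orbT; split=> //; apply/orP; right.
by apply/comp_relP; exists x; rewrite mem_conv.
Qed.

Lemma forces_inj q q1 q2 A c1 c2 u0 ys z :
  atomic_set (rel q1) -> atomic_set (rel q2) -> A `<=` members q -> valid (rel q) u0 ys ->
  forces (rel q) A (type_of A (rel q1) c1) u0 ys z ->
  forces (rel q) A (type_of A (rel q2) c2) u0 ys z ->
  type_of A (rel q1) c1 = type_of A (rel q2) c2.
Proof.
move=> a1 a2 Aq val f1 f2; apply/funext => z'; apply/funext => u'; apply/propext.
by split; [exact: (type_of_sub a1 a2 Aq val f1 f2)|exact: (type_of_sub a2 a1 Aq val f2 f1)].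
Qed.

Lemma type_of_extends q q' A c : extends q q' -> A `<=` members q ->
  (forall x, x \in c -> members q x) -> type_of A (rel q') c = type_of A (rel q) c.
Proof.
move=> [qq' q'q _ _] Aq cq; apply/funext => z; apply/funext => u; apply/propext; split=> -[uA sz Rz].
  split=> //; apply: q'q => // x m; rewrite mem_cat => /orP[xm|/uA/Aq//].
  apply: cq; have := map_f fst xm; rewrite -/unzip1 unzip1_zip ?sz //.
by split=> //; apply: qq'.
Qed.

(** * Unions of chains *)

Definition lub (A : set omega1) : omega1 :=
  xget (bound set0) [set a | (forall x, A x -> x <= a) /\ (forall b, b < a -> exists2 x, A x & b < x)].

Lemma lubP (A : set omega1) : countable A ->
  (forall x, A x -> x <= lub A) /\ (forall b, b < lub A -> exists2 x, A x & b < x).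
Proof. by move=> /omega1_lub[a aP]; rewrite /lub; case: xgetP => [_ _ //|/(_ a)]. Qed.

Definition sup_state (I : Type) (P : set I) (q : I -> state) : state :=
  State (fun u => exists2 i, P i & rel (q i) u) (\bigcup_(i in P) prom (q i))
        (lub [set lev (q i) | i in P]).

Section Chain.
Variables (I : Type) (P : set I) (q : I -> state).
Hypothesis Pc : countable P.
Hypothesis chainP : forall i j, P i -> P j -> extends (q i) (q j) \/ extends (q j) (q i).
Hypothesis goodP : forall i, P i -> good (q i).

Lemma chain2 i j : P i -> P j -> exists k, [/\ P k, extends (q i) (q k) & extends (q j) (q k)].
Proof.
move=> Pi Pj; have [ij|ji] := chainP Pi Pj; first by exists j; split=> //; apply: extends_refl.
by exists i; split=> //; apply: extends_refl.
Qed.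

Lemma extends_sup i : P i -> extends (q i) (sup_state P q).
Proof.
move=> Pi; split=> /=.
- by move=> u Ru; exists i.
- move=> u [j Pj Rj] ui; have [[_ h _ _]|[h _ _ _]] := chainP Pi Pj; [exact: h|exact: h].
- by move=> x Px; exists i.
- by apply: (lubP (countable_im _ Pc)).1; exists i.
Qed.

Lemma members_sup : members (sup_state P q) = \bigcup_(i in P) members (q i).
Proof.
apply/seteqP; split=> [x [m [i Pi Rx]]|x [i Pi [m Rx]]]; first by exists i => //; exists m.
by exists m, i.
Qed.

Hypothesis P0 : exists i, P i.

Lemma sup_atomic : atomic_set (rel (sup_state P q)).
Proof.
have aP i : P i -> atomic_set (rel (q i)) by move=> /goodP[].
split=> /=.
- by have [i Pi] := P0; exists i => //; apply: as_nil (aP i Pi).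
- by move=> u w v [i Pi Ri] Gw vuw; exists i => //; apply: (as_comp (aP i Pi) Ri Gw).
- move=> u v w [i Pi Ri] [j Pj Rj] uvw; have [k [Pk [hi _ _ _] [hj _ _ _]]] := chain2 Pi Pj.
  exact: (as_uniq (aP k Pk) (hi _ Ri) (hj _ Rj)).
- by move=> u x m y n [i Pi Ri]; apply: (as_inj (aP i Pi) Ri).
- move=> u x [i Pi Ri] [m [j Pj Rj]]; have [k [Pk [hi _ _ _] [hj _ _ _]]] := chain2 Pi Pj.
  have [|n Rn] := as_ext (aP k Pk) (hi _ Ri) (x := x); first by exists m; apply: hj.
  by exists n, k.
Qed.

Lemma sup_level : level (rel (sup_state P q)) (lev (sup_state P q)).
Proof.
have aP i : P i -> atomic_set (rel (q i)) by move=> /goodP[].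
have lP i : P i -> level (rel (q i)) (lev (q i)) by move=> /goodP[].
have below_lub b : b < lev (sup_state P q) -> exists2 i, P i & b < lev (q i).
  by move=> /(lubP (countable_im _ Pc)).2[_ [i Pi <-]]; exists i.
have dir i u : P i -> bounded (lev (sup_state P q)) u ->
    exists j, [/\ P j, extends (q i) (q j) & bounded (lev (q j)) u].
  move=> Pi; elim: u => [|[x m] u IH] ug; first by exists i; split=> //; apply: extends_refl.
  have [y n yn|j [Pj ij ju]] := IH; first by apply: (ug y n); rewrite inE yn orbT.
  have [|k Pk mk] := @below_lub (rk m); first by apply: (ug x m); rewrite inE eqxx.
  have [l [Pl jl kl]] := chain2 Pj Pk; exists l; split=> //; first exact: extends_trans ij jl.
  have [_ _ _ jl4] := jl; have [_ _ _ kl4] := kl.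
  move=> y n; rewrite inE => /orP[/eqP[_ ->]|/ju yn]; first exact: lt_le_trans mk kl4.
  exact: lt_le_trans yn jl4.
have up j m : P j -> rk m < lev (q j) -> rk m < lev (sup_state P q).
  by move=> Pj mj; apply: lt_le_trans mj _; have [] := extends_sup Pj.
split=> [u x [i Pi Ri] ug [m [j Pj Rj]]|u m [i Pi Ri] ug mg].
  have [k [Pk [hi _ _ _] [hj _ _ _]]] := chain2 Pi Pj.
  have [l [Pl [hk _ _ _] lu]] := dir k u Pk ug.
  have [|n nl Rn] := (lP l Pl).1 u x (hk _ (hi _ Ri)) lu; first by exists m; apply/hk/hj.
  by exists n; [apply: up nl|exists l].
have mu : bounded (lev (sup_state P q)) ((bound set0, m) :: u).
  by move=> y n; rewrite inE => /orP[/eqP[_ ->]|/ug].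
have [l [Pl [hl _ _ _] lu]] := dir i _ Pi mu.
have [||x Rx] := (lP l Pl).2 u m (hl _ Ri).
- by move=> y n yn; apply: (lu y n); rewrite inE yn orbT.
- by apply: (lu (bound set0) m); rewrite inE eqxx.
by exists x, l.
Qed.

Lemma sup_omitted A p i : P i -> prom (q i) (A, p) -> omitted (rel (sup_state P q)) A p.
Proof.
move=> Pi pi u0 ys z [[j Pj R0] a0 ext] frc.
have [k [Pk [hi _ pik _] [hj _ _ _]]] := chain2 Pi Pj.
have [_ _ _ _ ok] := goodP Pk; apply: (ok A p (pik _ pi) u0 ys z).
  split=> //; first exact: hj.
  move=> u x Ru u0u au [m kx]; have [||d [l Pl Rl] ad] := ext u x _ u0u au.
  - by exists k.
  - by exists m, k.
  exists d => //; have [_ h _ _] := extends_sup Pk; apply: h; first by exists l.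
  have [ak _ _ _ _] := goodP Pk.
  move=> y n; rewrite inE => /orP[/eqP[-> _]|]; first by exists m.
  exact: (as_within ak Ru).
by move=> u v Ru; apply: frc; exists k.
Qed.

Lemma sup_good : good (sup_state P q).
Proof.
split.
- exact: sup_atomic.
- by rewrite members_sup; apply: bigcup_countable => // i /goodP[].
- exact: sup_level.
- by apply: bigcup_countable => // i /goodP[].
- by move=> A p [i Pi]; apply: sup_omitted.
Qed.

End Chain.

(** * Isolated types *)

Definition diag (X : eqType) (s : seq X) : seq (X * X) := [seq (x, x) | x <- s].

Lemma mem_diag (X : eqType) (s : seq X) a b : ((a, b) \in diag s) = (a \in s) && (a == b).
Proof.
apply/mapP/andP => [[x xs [-> ->]]|[aS /eqP <-]]; first by rewrite eqxx.
by exists a.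
Qed.

Lemma zip_diag (X : eqType) (s : seq X) : zip s s = diag s.
Proof. by elim: s => //= x s ->. Qed.

Lemma zip_mapr (X Y : eqType) (f : X -> Y) (s : seq X) : zip s (map f s) = [seq (x, f x) | x <- s].
Proof. by elim: s => //= x s ->. Qed.

Lemma zip_mapl (X Y : eqType) (f : X -> Y) (s : seq X) : zip (map f s) s = [seq (f x, x) | x <- s].
Proof. by elim: s => //= x s ->. Qed.

(** The type of [m] over the tuple [u] has a unique extension over [R]. *)
Definition isolates R u (m : seq M) := forall u', R u' -> {subset u <= u'} ->
  forall m', size m = size m' -> G (zip m m' ++ diag (unzip2 u)) ->
  G (zip m m' ++ diag (unzip2 u')).

Definition dense R := forall u m, R u ->
  exists v, [/\ R v, {subset u <= v} & isolates R v m].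

Lemma rank_bound (s : seq M) : exists a, forall x, x \in s -> rk x < a.
Proof.
elim: s => [|x s [a aP]]; first by exists (bound set0).
have [b bP] := omega1_gt (Order.max a (rk x)).
move: bP; rewrite gt_max => /andP[ab xb].
by exists b => y; rewrite inE => /orP[/eqP ->//|/aP]; move=> ya; apply: lt_trans ya ab.
Qed.

(** Closing off: cofinally many pieces of [M] are closed under an operation with
   countably many inputs over each piece. *)
Lemma closing (X : Type) (A : set X) (inp out : X -> seq M) :
  (forall g, countable [set x | A x /\ forall m, m \in inp x -> rk m < g]) ->
  exists B, forall g, closed_under B g -> forall x, A x ->
    (forall m, m \in inp x -> rk m < g) -> forall m, m \in out x -> rk m < g.
Proof.
move=> cA; pose S b := \bigcup_(x in [set x | A x /\ forall m, m \in inp x -> rk m <= b])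
  [set rk m | m in [set m | m \in out x]].
have cS b : countable (S b).
  apply: bigcup_countable.
    have [b' bb'] := omega1_gt b.
    by apply: countable_sub (cA b') => x [Ax xb]; split=> // m /xb mb; apply: le_lt_trans bb'.
  by move=> x _; apply: countable_im; apply/countable_injP; exists (index^~ (out x)) => y z;
    rewrite !inE => yx zx; apply: index_inj.
exists (fun b => bound (S b)) => g [[b0 b0g] gB] x Ax xg m mx.
have [b [bg xb]] : exists b, b < g /\ forall n, n \in inp x -> rk n <= b.
  elim: (inp x) xg => [|n s IH] sg; first by exists b0.
  have [n' ns|b [bg sb]] := IH; first by apply: sg; rewrite inE ns orbT.
  have ng : rk n < g by apply: sg; rewrite inE eqxx.
  exists (Order.max b (rk n)); rewrite gt_max bg ng; split=> // n'; rewrite inE le_max.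
  by move=> /orP[/eqP ->|/sb ->]; rewrite ?lexx ?orbT.
apply: lt_trans (gB b bg); apply: boundP => //.
by exists x => //; exists m.
Qed.

Lemma countable_maps R (P : pmap -> Prop) g : atomic_set R -> countable (univ R) ->
  (forall u, P u -> R u) -> countable [set u | P u /\ forall m, m \in unzip2 u -> rk m < g].
Proof.
move=> aR cR PR.
apply: (@countable_sub _ _ [set u | forall p, p \in u -> (univ R `*` [set m | rk m < g]) p]).
  move=> u [/PR Ru ug] [x m] xm; split; first exact: (as_within aR Ru xm).
  by apply: ug; apply/mem_unzip2; exists x.
by apply: countable_seqP; apply: countableX => //; apply: (rk_countable sysM).
Qed.

(** If [v1] and [m'] witness the failure, an elementary map that moves [m'] to [m]
    moves [v1] to [v2], so [m] has over [v2] the type of [m'] over [v1]. *)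
Lemma not_isolates R v m : atomic_set R -> R v -> ~ isolates R v m ->
  exists v1 v2, [/\ R v1, R v2, {subset v <= v1}, {subset v <= v2} &
    forall A q' c, atomic_set q' -> type_of A q' c m v1 -> type_of A q' c m v2 -> False].
Proof.
move=> aR Rv /existsNP[v1 /not_implyP[R1 /not_implyP[vv1 /existsNP[m']]]].
move=> /not_implyP[sm /not_implyP[Gm nGm]].
have [w [Gw mw wc]] := G_cover (unzip2 v1) (G_conv sysM Gm).
pose v2 := comp_rel v1 w; exists v1, v2; split=> //.
- by apply: (as_comp aR R1 Gw) => x b /comp_relP.
- move=> [x a] xa; apply/comp_relP; exists a; split; first exact: vv1.
  apply: mw; rewrite mem_conv mem_cat mem_diag eqxx andbT; apply/orP; right.
  by apply/mem_unzip2; exists x.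
move=> A q' c aq [_ sz q1] [_ _ q2]; apply: nGm.
have G1 : G (diag m ++ comp_rel (conv v1) v2).
  apply: (as_uniq aq q1 q2) => a b; rewrite mem_cat => /orP[|/comp_relP[x [+ xb]]].
    rewrite mem_diag => /andP[am /eqP <-].
    have /(zip_mid sz sz)[x [xa _]] : (a, a) \in zip m m.
      by rewrite zip_diag mem_diag am eqxx.
    by exists x; rewrite !mem_cat xa.
  by rewrite mem_conv => xa; exists x; rewrite !mem_cat xa xb !orbT.
apply: (G_comp sysM G1 (G_conv sysM Gw)) => a b; rewrite mem_cat => /orP[ab|].
  exists a; rewrite mem_cat mem_diag eqxx andbT mem_conv; split; last first.
    by apply: mw; rewrite mem_conv mem_cat ab.
  have : a \in unzip1 (zip m m') by apply/mem_unzip1; exists b.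
  by rewrite unzip1_zip ?sm // => ->.
rewrite mem_diag => /andP[av1 /eqP <-]; have [b' ab'] := wc a av1.
have /mem_unzip2[x xa] := av1.
exists b'; rewrite mem_conv; split=> //; rewrite mem_cat; apply/orP; right.
by apply/comp_relP; exists x; rewrite mem_conv; split=> //; apply/comp_relP; exists a.
Qed.

(** If the isolated types are not dense then some finite map has no isolating
    extension.  The types below it form a perfect set, and the generic one among
    them differs from each given type.  The level is closed under the choice of
    the two maps of [not_isolates], so that a generic embedding can be extended
    by the one that disagrees with the given type. *)
Lemma avoid_types q (I : Type) (Z : I -> ptype) : good q -> ~ dense (rel q) -> small I ->
  (forall i, exists R' c, atomic_set R' /\ Z i = type_of (members q) R' c) ->
  exists q' c, [/\ extends q q', good q', forall x, x \in c -> members q' x &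
    forall i, type_of (members q) (rel q') c <> Z i].
Proof.
move=> gq /existsNP[u0 /existsNP[m /not_implyP[R0 nd]]] sI ZT.
have [aR cV lq cP oP] := gq.
have h v : exists v12 : pmap * pmap, rel q v -> {subset u0 <= v} ->
    [/\ rel q v12.1, rel q v12.2, {subset v <= v12.1}, {subset v <= v12.2} &
    forall i, Z i m v12.1 -> Z i m v12.2 -> False].
  have [[Rv u0v]|n] := pselect (rel q v /\ {subset u0 <= v}); last by exists (v, v) => ? ?; case: n.
  have [|v1 [v2 [R1 R2 vv1 vv2 sep]]] := @not_isolates _ v m aR Rv.
    by move=> iso; apply: nd; exists v.
  exists (v1, v2) => _ _; split=> //= i; have [R' [c [aR' ->]]] := ZT i.
  exact: sep.
have [S SP] := choice h.
have [|B BP] := @closing pmap (fun v => rel q v /\ {subset u0 <= v})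
    unzip2 (fun v => unzip2 (S v).1 ++ unzip2 (S v).2).
  by move=> g; apply: (countable_maps g aR cV) => u [].
have [a aP] := rank_bound (m ++ unzip2 u0).
have [g gB] := closed_under_gt B (Order.max a (lev q)).
rewrite gt_max => /andP[ag lg].
have mg x : x \in m -> rk x < g by move=> xm; apply: lt_trans ag; apply: aP; rewrite mem_cat xm.
have ug : bounded g u0.
  move=> x n xn; apply: lt_trans ag; apply: aP; rewrite mem_cat; apply/orP; right.
  by apply/mem_unzip2; exists x.
have [|V [k [[eq gq' kE kD] [kV konto]]]] :=
    @generic_extension q g u0 I (fun i v => ~ Z i m v) gq (ltW lg) R0 ug sI.
  move=> i u Ru bu uu0; have [R1 R2 uv1 uv2 sep] := SP u Ru uu0.
  have out n : n \in unzip2 (S u).1 ++ unzip2 (S u).2 -> rk n < g.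
    by apply: (BP g gB u) => // n' /mem_unzip2[x]; exact: bu.
  have [Z1|nZ1] := pselect (Z i m (S u).1); last first.
    exists (S u).1; split=> // x n xn; apply: out; rewrite mem_cat; apply/orP; left.
    by apply/mem_unzip2; exists x.
  exists (S u).2; split=> //; last by move/(sep i Z1).
  move=> x n xn; apply: out; rewrite mem_cat; apply/orP; right.
  by apply/mem_unzip2; exists x.
have h' n : exists x, rk n < g -> V x /\ k x = n.
  have [ng|] := pselect (rk n < g); last by exists (bound set0).
  by have [x Vx kx] := konto _ ng; exists x.
have [l lP] := choice h'.
exists (State (induced V k) (prom q) g), (map l m); split=> //.
  move=> x /mapP[n nm ->]; rewrite /members univ_induced.
  by case: (lP n (mg n nm)).
move=> i E; have [v [Rv nZ kv]] := kD i.
apply: nZ; rewrite -E; split; [exact: as_within|by rewrite size_map|].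
have [h1 _ _ _] := eq; have [vV _] := h1 v Rv.
split.
  move=> x n; rewrite mem_cat => /orP[|/vV//] xn.
  by move: xn; rewrite zip_mapl => /mapP[n' nm [-> _]]; case: (lP n' (mg n' nm)).
apply: (G_refl sysM) => b b' /mem_mapk[x ->]; rewrite mem_cat => /orP[|/kv//].
rewrite zip_mapl => /mapP[n nm [-> ->]].
by case: (lP n (mg n nm)).
Qed.

(** A generic embedding of [q] into [M_g] contains, for each tuple [m] of [M_g], a
    map that isolates the type of [m], provided that [g] is closed under a choice
    of isolating maps that keeps their images in [M_g].  So each tuple of the extension has an isolated type over
    [q]. *)
Lemma atomic_extension q B a : good q -> dense (rel q) ->
  exists q', [/\ extends q q', good q', closed_under B (lev q'), a < lev q' &
    forall c : seq omega1, (forall x, x \in c -> members q' x) -> exists z u,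
      [/\ size c = size z, rel q u, rel q' (zip c z ++ u) & isolates (rel q) u z]].
Proof.
move=> gq dq; have [aR cV lq cP oP] := gq.
have h (vm : pmap * seq M) : exists v', rel q vm.1 ->
    [/\ rel q v', {subset vm.1 <= v'} & isolates (rel q) v' vm.2].
  have [Rv|nv] := pselect (rel q vm.1); last by exists [::].
  by have [v' ?] := dq vm.1 vm.2 Rv; exists v'.
have [S SP] := choice h.
have [|B1 B1P] := @closing (pmap * seq M)%type (fun vm => rel q vm.1)
    (fun vm => unzip2 vm.1 ++ vm.2) (fun vm => unzip2 (S vm)).
  move=> g; apply: (@countable_sub _ _ ([set u | rel q u /\ forall m, m \in unzip2 u -> rk m < g]
     `*` [set m : seq M | forall x, x \in m -> rk x < g])).
    move=> [v m] /= [Rv vg]; split; [split=> // x xv|move=> x xm]; apply: vg; rewrite mem_cat.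
      by rewrite xv.
    by rewrite xm orbT.
  apply: countableX; first by apply: (countable_maps g aR cV).
  by apply: countable_seqP; apply: (rk_countable sysM).
have [B2 B2P] := closed_under2 B B1.
have [g /B2P[gB gB1]] := closed_under_gt B2 (Order.max a (lev q)).
rewrite gt_max => /andP[ag lg].
have b0 : bounded g [::] by [].
have [||V [k [[eq gq' kE kD] [kV konto]]]] :=
    @generic_extension q g [::] (seq M) (fun m v => (forall x, x \in m -> rk x < g) -> isolates (rel q) v m)
    gq (ltW lg) (as_nil aR) b0.
- by apply: small_seq; apply: small_system.
- move=> m u Ru bu _; have [mg|nmg] := pselect (forall x, x \in m -> rk x < g); last by exists u; split.
  have [R1 uS iS] := SP (u, m) Ru; exists (S (u, m)); split=> //.
  move=> x n xn; apply: (B1P g gB1 (u, m)) => //= [n'|]; last by apply/mem_unzip2; exists x.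
  by rewrite mem_cat => /orP[/mem_unzip2[y]|/mg//]; apply: bu.
exists (State (induced V k) (prom q) g); split=> // c cq.
have cV' x : x \in c -> V x by move=> /cq; rewrite /members univ_induced.
have [u [Ru iu ku]] := kD (map k c).
exists (map k c), u; split; rewrite ?size_map //; last by apply: iu => x /mapP[y /cV' /kV yg ->].
have [h1 _ _ _] := eq; have [uV _] := h1 u Ru.
have zk x m : (x, m) \in zip c (map k c) -> x \in c /\ m = k x.
  by rewrite zip_mapr => /mapP[y yc [-> ->]].
split; first by move=> x m; rewrite mem_cat => /orP[/zk[/cV']|/uV].
apply: (G_refl sysM) => b b' /mem_mapk[x ->]; rewrite mem_cat => /orP[/zk[]|/ku//].
by [].
Qed.

(** * Density depends only on the level *)

Lemma as_change R u v : atomic_set R -> R u -> R v -> G (comp_rel (conv u) v).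
Proof.
move=> aR Ru Rv; apply: (as_uniq aR Ru Rv) => a b /comp_relP[x [xa xb]].
by exists x; rewrite mem_conv in xa.
Qed.

Lemma as_comp_rel R u w : atomic_set R -> R u -> G w -> R (comp_rel u w).
Proof. by move=> aR Ru Gw; apply: (as_comp aR Ru Gw) => x m /comp_relP. Qed.

(** The finite steps of a back-and-forth between two sets at level [g], which
    passes through [M_g]. *)
Definition same_image R R' g (e e' : pmap) :=
  [/\ R e, R' e', bounded g e & unzip2 e =i unzip2 e'].

Lemma same_imageC R R' g e e' : same_image R R' g e e' -> same_image R' R g e' e.
Proof.
move=> [Re Re' be ee]; split=> // x m xm.
have /mem_unzip2[y ym] : m \in unzip2 e by rewrite ee; apply/mem_unzip2; exists x.
exact: be ym.
Qed.

Lemma same_image_cover R R' g e e' (s : seq omega1) : atomic_set R -> level R g -> level R' g ->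
  same_image R R' g e e' -> (forall x, x \in s -> univ R x) ->
  exists e2 e2', [/\ same_image R R' g e2 e2', {subset e <= e2}, {subset e' <= e2'} &
    forall x, x \in s -> exists m, (x, m) \in e2].
Proof.
move=> aR lR lR' ee; elim: s => [|x s IH] sR; first by exists e, e'; split.
have [y ys|e2 [e2' [i2 ee2 ee2' es]]] := IH; first by apply: sR; rewrite inE ys orbT.
have [R2 R2' b2 i2E] := i2; have [m mg Rm] := lR.1 _ _ R2 b2 (sR x (mem_head _ _)).
have [_ _ b2' _] := same_imageC i2; have [y Ry] := lR'.2 _ _ R2' b2' mg.
exists ((x, m) :: e2), ((y, m) :: e2'); split.
- split=> // [z n|n]; first by rewrite inE => /orP[/eqP[_ ->]|/b2].
  by rewrite !inE i2E.
- by move=> z /ee2 ze; rewrite inE ze orbT.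
- by move=> z /ee2' ze; rewrite inE ze orbT.
move=> z; rewrite inE => /orP[/eqP ->|/es[n zn]]; first by exists m; rewrite inE eqxx.
by exists n; rewrite inE zn orbT.
Qed.

(** Moving a finite map from one atomic set to the other. *)
Definition move (e e' : pmap) u : pmap := comp_rel e' (comp_rel (conv e) u).

Lemma move_atomic R R' g e e' u : atomic_set R -> atomic_set R' -> same_image R R' g e e' ->
  R u -> R' (move e e' u).
Proof. by move=> aR aR' [Re Re' _ _] Ru; apply: as_comp_rel => //; apply: (as_change aR). Qed.

Lemma mem_move (e e' u : pmap) x y b a :
  (x, b) \in e -> (y, b) \in e' -> (x, a) \in u -> (y, a) \in move e e' u.
Proof.
move=> xb yb xa; apply/comp_relP; exists b; split=> //.
by apply/comp_relP; exists x; rewrite mem_conv.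
Qed.

Lemma unzip2_move R R' g e e' u a : same_image R R' g e e' ->
  (forall x, x \in unzip1 u -> exists m, (x, m) \in e) ->
  a \in unzip2 u -> a \in unzip2 (move e e' u).
Proof.
move=> [_ _ _ ee] cu /mem_unzip2[x xa].
have [|b xb] := cu x; first by apply/mem_unzip1; exists a.
have /mem_unzip2[y yb] : b \in unzip2 e' by rewrite -ee; apply/mem_unzip2; exists x.
apply/mem_unzip2; exists y; apply/comp_relP; exists b; split=> //.
by apply/comp_relP; exists x; rewrite mem_conv.
Qed.

(** Two sets at the same level are related by a back-and-forth, along which
    isolating maps can be moved. *)
Lemma dense_level R R' g : atomic_set R -> atomic_set R' -> level R g -> level R' g ->
  dense R -> dense R'.
Proof.
move=> aR aR' lR lR' dR u' m Ru'.
have i0 : same_image R' R g [::] [::] by split=> //; apply: as_nil.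
have [|e' [e [i1 _ _ c1]]] := same_image_cover (s := unzip1 u') aR' lR' lR i0.
  by move=> x /mem_unzip1[n]; apply: as_within.
have Ru : R (move e' e u') := move_atomic aR' aR i1 Ru'.
have [v [Rv uv iv]] := dR _ m Ru.
have [|e2 [e2' [i2 ee2 ee2' c2]]] := same_image_cover (s := unzip1 v) aR lR lR' (same_imageC i1).
  by move=> x /mem_unzip1[n]; apply: as_within.
have [_ _ _ i1E] := i1.
exists (move e2 e2' v); split; first exact: move_atomic i2 Rv.
  move=> [x a] xa; have [|b xb] := c1 x; first by apply/mem_unzip1; exists a.
  have /mem_unzip2[y yb] : b \in unzip2 e by rewrite -i1E; apply/mem_unzip2; exists x.
  apply: (mem_move (ee2 _ yb) (ee2' _ xb)).
  exact: uv _ (mem_move xb yb xa).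
move=> w' Rw' vw' m' sm Gm.
have [|e3' [e3 [i3 ee3' ee3 c3]]] := same_image_cover (s := unzip1 w') aR' lR' lR (same_imageC i2).
  by move=> x /mem_unzip1[n]; apply: as_within.
have [_ _ _ i2E] := i2.
have Rw : R (move e3' e3 w') := move_atomic aR' aR i3 Rw'.
have vw : {subset v <= move e3' e3 w'}.
  move=> [x a] xa; have [|b xb] := c2 x; first by apply/mem_unzip1; exists a.
  have /mem_unzip2[y yb] : b \in unzip2 e2' by rewrite -i2E; apply/mem_unzip2; exists x.
  apply: (mem_move (ee3' _ yb) (ee3 _ xb)).
  exact: vw' _ (mem_move xb yb xa).
have Gv : G (zip m m' ++ diag (unzip2 v)).
  apply: (G_sub Gm) => -[a b]; rewrite !mem_cat !mem_diag => /orP[->//|/andP[av ->]].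
  by rewrite andbT; apply/orP; right; apply: (unzip2_move i2 c2 av).
apply: (G_sub (iv _ Rw vw m' sm Gv)) => -[a b]; rewrite !mem_cat !mem_diag => /orP[->//|/andP[aw ->]].
by rewrite andbT; apply/orP; right; apply: (unzip2_move i3 c3 aw).
Qed.

(** * Chains of length omega_1 *)

Definition void_state : state := State (fun u => u = [::]) set0 (lub set0).

Lemma void_members : members void_state = set0.
Proof. by apply/seteqP; split=> // x []. Qed.

Lemma void_lev b : ~ b < lev void_state.
Proof. by move=> /(lubP (@countable0 omega1)).2[]. Qed.

Lemma void_good : good void_state.
Proof.
split; [|by rewrite void_members| |exact: countable0|by []].
  split=> //=.
  - move=> u w [|[x m] v] -> // _ /(_ x m (mem_head _ _)) [n []] //.
  - move=> u v [|[a b] w] -> // _; first by move=> _; apply: (G_refl sysM).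
    by move=> /(_ a b (mem_head _ _)) [n []].
  - by move=> u x m y n ->.
  - by move=> u x _ [].
by split=> [u x _ _ []|u m _ _ /void_lev].
Qed.

Lemma void_dense : dense (rel void_state).
Proof. by move=> u m /= ->; exists [::]; split=> //= u' ->. Qed.

Definition raises a q q' := [/\ extends q q', good q' & a < lev q'].

Lemma raise q a : good q -> exists q', raises a q q'.
Proof.
move=> gq; have [aR cV lq cP oP] := gq; have [g] := omega1_gt (Order.max a (lev q)).
rewrite gt_max => /andP[ag lg]; have b0 : bounded g [::] by [].
have sF : small False by exists (fun i : False => match i return omega1 with end).
have [[]|V [k [[eq gq' _ _] _]]] :=
    @generic_extension q g [::] False (fun _ _ => True) gq (ltW lg) (as_nil aR) b0 sF.
by exists (State (induced V k) (prom q) g).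
Qed.

(** Chains of conditions along a branch [f] of the binary tree.  The step at [a]
    may look back at the earlier conditions, so that the tasks that they leave
    can be carried out later. *)
Section Recursion.
Variables (init : state) (step : omega1 -> bool -> (omega1 -> state) -> state -> state).
Hypothesis init_good : good init.
Hypothesis step_good : forall a b H q, good q ->
  raises a q (step a b H q).

Definition cut (H : omega1 -> state) a : omega1 -> state := fun b => if b <= a then H b else init.

Definition chain_body f a (H : omega1 -> state) : state :=
  if `[< exists b, b < a >]
  then sup_state [set b | b < a] (fun b => step b (f b) (cut H b) (H b)) else init.

Definition chain (f : omega1 -> bool) : omega1 -> state :=
  projT1 (cid (omega1_rec (chain_body f) init)).

Definition next f a := step a (f a) (cut (chain f) a) (chain f a).

Lemma cut_cut H a b : b < a -> cut (fun c => if c < a then H c else init) b = cut H b.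
Proof.
by move=> ba; apply/funext => c; rewrite /cut; case: ifP => // cb; rewrite (le_lt_trans cb ba).
Qed.

Lemma sup_state_ext I (P : set I) q q' : (forall i, P i -> q i = q' i) ->
  sup_state P q = sup_state P q'.
Proof.
move=> qq'; congr State.
- apply/funext => u; apply/propext.
  by split=> -[i Pi h]; exists i; rewrite ?qq' // -?qq'.
- by apply: eq_bigcupr => i Pi; rewrite qq'.
congr lub; apply/seteqP; split=> _ [i Pi <-]; exists i; rewrite ?qq' //.
Qed.

Lemma chainE f a : chain f a = chain_body f a (chain f).
Proof.
have HE := projT2 (cid (omega1_rec (chain_body f) init)); rewrite -/(chain f) in HE.
rewrite HE /chain_body; case: asboolP => // _; apply: sup_state_ext => b /= ba.
by rewrite cut_cut // ba.
Qed.
Lemma chain0 f a : ~ (exists b, b < a) -> chain f a = init.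
Proof. by move=> n; rewrite chainE /chain_body; case: asboolP. Qed.

Lemma chainS f a : (exists b, b < a) -> chain f a = sup_state [set b | b < a] (next f).
Proof. by move=> e; rewrite chainE /chain_body; case: asboolP. Qed.

Lemma chain_local f f' a : (forall b, b < a -> f b = f' b) -> chain f a = chain f' a.
Proof.
elim/omega1_ind: a => a IH ff'.
have [a0|a0] := pselect (exists b, b < a); last by rewrite !chain0.
rewrite !chainS //; apply: sup_state_ext => b ba; rewrite /next ff' //.
have E c : c <= b -> chain f c = chain f' c.
  move=> cb; apply: IH; first exact: le_lt_trans ba.
  by move=> d dc; apply: ff'; apply: lt_trans dc (le_lt_trans cb ba).
rewrite E //; congr step; apply/funext => c; rewrite /cut; case: ifP => // /E //.
Qed.

Lemma chain_main f a : good (chain f a) /\ forall b, b < a -> extends (next f b) (chain f a).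
Proof.
elim/omega1_ind: a => a IH.
have [a0|a0] := pselect (exists b, b < a); last first.
  by rewrite chain0 //; split=> // b ba; case: a0; exists b.
have nextP b : b < a -> extends (chain f b) (next f b) /\ good (next f b).
  by move=> /IH[gb _]; have [] := step_good b (f b) (cut (chain f) b) gb.
have nn b c : c < a -> b < c -> extends (next f b) (next f c).
  by move=> ca bc; have [_ /(_ _ bc) h] := IH _ ca; apply: extends_trans h (nextP c ca).1.
have cP := below_countable a.
have chP b c : b < a -> c < a -> extends (next f b) (next f c) \/ extends (next f c) (next f b).
  move=> ba ca; case: (ltgtP b c) => [bc|cb|->]; [left|right|left]; [exact: nn|exact: nn|exact: extends_refl].
have gP b : b < a -> good (next f b) by move=> /nextP[].
rewrite chainS //; split; first exact: (sup_good cP chP gP a0).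
by move=> b ba; apply: (extends_sup cP chP).
Qed.

Lemma chain_good f a : good (chain f a). Proof. by have [] := chain_main f a. Qed.

Lemma next_good f a : good (next f a).
Proof. by have [] := step_good a (f a) (cut (chain f) a) (chain_good f a). Qed.

Lemma chain_next f a : extends (chain f a) (next f a).
Proof. by have [] := step_good a (f a) (cut (chain f) a) (chain_good f a). Qed.

Lemma next_chain f a b : a < b -> extends (next f a) (chain f b).
Proof. by move=> ab; have [_ h] := chain_main f b; apply: h. Qed.

Lemma chain_le f a b : a <= b -> extends (chain f a) (chain f b).
Proof.
rewrite le_eqVlt => /orP[/eqP ->|/(next_chain f)]; first exact: extends_refl.
exact: extends_trans (chain_next f a).
Qed.

Lemma chain_init f a : extends init (chain f a).
Proof.
have [m _ mP] := @omega1_min setT a I.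
rewrite -(@chain0 f m) ?chain_le ?mP //; first exact/chain_le/mP.
by move=> [b]; rewrite ltNge mP.
Qed.

Lemma chain_lev f : exists B, forall a, closed_under B a -> lev (chain f a) = a.
Proof.
exists (fun b => lev (next f b)) => a [a0 aB]; rewrite chainS //=.
have [ub lu] := lubP (countable_im (fun b => lev (next f b)) (below_countable a)).
apply/eqP; rewrite eq_le; apply/andP; split; rewrite leNgt; apply/negP.
  by move=> /lu[_ [b ba <-]]; rewrite ltNge => /negP; apply; apply/ltW/aB.
set l := lub _ in ub lu * => la.
have [_ _ ll] := step_good l (f l) (cut (chain f) l) (chain_good f l).
by have := ub _ (ex_intro2 _ _ l la erefl); rewrite leNgt /next ll.
Qed.

Lemma members_chain f a x : members (chain f a) x -> members init x \/
  exists2 b, b < a & members (next f b) x.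
Proof.
have [a0|a0] := pselect (exists b, b < a); last by rewrite chain0 //; left.
by rewrite chainS // members_sup => -[b ba]; right; exists b.
Qed.

Definition limit f : pmap -> Prop := fun u => exists a, rel (chain f a) u.

Lemma limit_chain f a u : limit f u -> within (members (chain f a)) u -> rel (chain f a) u.
Proof.
move=> [b Ru] ua; case: (ltP a b) => [/ltW ab|ba].
  by have [_ h _ _] := chain_le f ab; apply: h.
by have [h _ _ _] := chain_le f ba; apply: h.
Qed.

Lemma univ_limit f x : univ (limit f) x <-> exists a, members (chain f a) x.
Proof. by split=> [[m [a Rx]]|[a [m Rx]]]; [exists a, m|exists m, a]. Qed.

Lemma limit_atomic f : atomic_set (limit f).
Proof.
have -> : limit f = rel (sup_state setT (chain f)).
  by apply/funext => u; apply/propext; split=> [[a ?]|[a _ ?]]; exists a.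
apply: (@sup_atomic _ setT (chain f)) => [a b _ _|a _|]; last by exists (bound set0).
  by case: (leP a b) => [/(chain_le f)|/ltW/(chain_le f)]; [left|right].
exact: chain_good.
Qed.

Lemma limit_cover f (s : seq omega1) : (forall x, x \in s -> univ (limit f) x) ->
  exists a, forall x, x \in s -> members (chain f a) x.
Proof.
elim: s => [|x s IH] sf; first by exists (bound set0).
have [y ys|a sa] := IH; first by apply: sf; rewrite inE ys orbT.
have /univ_limit[b xb] := sf x (mem_head _ _); exists (Order.max a b) => y.
rewrite inE => /orP[/eqP ->|/sa].
  by apply: members_extends xb; apply: chain_le; rewrite le_max lexx orbT.
by apply: members_extends; apply: chain_le; rewrite le_max lexx.
Qed.

Lemma limit_type f a A c : A `<=` members (chain f a) -> (forall x, x \in c -> members (chain f a) x) ->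
  type_of A (limit f) c = type_of A (rel (chain f a)) c.
Proof.
move=> Aa ca; apply/funext => z; apply/funext => u; apply/propext; split=> -[uA sz Rz].
  split=> //; apply: limit_chain => // x m; rewrite mem_cat => /orP[xm|/uA/Aa//].
  apply: ca; have : x \in unzip1 (zip c z) by apply/mem_unzip1; exists m.
  by rewrite unzip1_zip ?sz.
by split=> //; exists a.
Qed.
End Recursion.

Definition rich R := atomic_set R /\ forall u m, R u -> exists x, R ((x, m) :: u).

Lemma limit_rich init step : good init -> (forall a b H q, good q ->
    raises a q (step a b H q)) ->
  forall f, rich (limit init step f).
Proof.
move=> ig sg f; split; first exact: limit_atomic.
move=> u m [a Ru]; have [b bP] := rank_bound (m :: unzip2 u).
pose c := Order.max a b; have [d cd] := omega1_gt c.
have ad : a <= d by apply: ltW; apply: le_lt_trans cd; rewrite le_max lexx.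
have [h _ _ _] := chain_le ig sg f ad.
have [_ _ [_ l2] _ _] := chain_good ig sg f d.
have cl : c < lev (chain init step f d).
  have [_ _ _] := next_chain ig sg f cd; apply: lt_le_trans.
  by have [_ _] := sg c (f c) (cut init (chain init step f) c) _ (chain_good ig sg f c).
have bd n : n \in m :: unzip2 u -> rk n < lev (chain init step f d).
  by move=> nm; apply: lt_trans cl; apply: lt_le_trans (bP n nm) _; rewrite le_max lexx orbT.
have [||x Rx] := l2 u m (h _ Ru); last by exists x, d.
  by move=> x n xn; apply: bd; rewrite inE; apply/orP; right; apply/mem_unzip2; exists x.
exact: bd (mem_head _ _).
Qed.

(** * Constructible sets *)

Definition isolated_over R A x := exists u m, [/\ within A u, R ((x, m) :: u) &
  forall u', R u' -> within A u' -> {subset u <= u'} -> forall m',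
    G ((m, m') :: diag (unzip2 u)) -> G ((m, m') :: diag (unzip2 u'))].

Definition lex (p q : omega1 * nat) := (p.1 < q.1) || (p.1 == q.1) && (p.2 < q.2)%N.

(** Stages are countable ordinals and each stage adds countably many names, so
    the index ordinal is presented as the lexicographic [omega_1 * omega]. *)
Definition constructible_set R := exists r : omega1 -> omega1 * nat,
  (forall x y, univ R x -> univ R y -> r x = r y -> x = y) /\
  forall x, univ R x -> isolated_over R [set y | univ R y /\ lex (r y) (r x)] x.

(** Over a finite set, a tuple that lists the whole set isolates. *)
Lemma isolated_over_finite R A x (s : seq omega1) : atomic_set R -> univ R x ->
  (forall y, A y -> univ R y) -> (forall y, A y -> y \in s) -> isolated_over R A x.
Proof.
move=> aR Rx AR As; pose t := [seq y <- s | `[< A y >]].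
have tA y : y \in t -> A y by rewrite mem_filter => /andP[/asboolP].
have [z [sz Rz]] := as_tuple (c := t) aR (as_nil aR) (fun y h => AR y (tA y h)).
rewrite cats0 in Rz.
have [m Rm] := as_ext aR Rz Rx.
exists (zip t z), m; split=> //.
  move=> y n yn; apply: tA; have : y \in unzip1 (zip t z) by apply/mem_unzip1; exists n.
  by rewrite unzip1_zip ?sz.
move=> u' Ru' u'A uu' m' Gm; apply: (G_sub Gm) => -[a b]; rewrite !inE => /orP[->//|].
rewrite !mem_diag => /andP[/mem_unzip2[y ya] ->]; rewrite andbT; apply/orP; right.
have yt : y \in t by rewrite mem_filter; apply/andP; split; [apply/asboolP; exact: u'A ya|exact/As/(u'A _ _ ya)].
have : y \in unzip1 (zip t z) by rewrite unzip1_zip ?sz.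
move=> /mem_unzip1[b' yb']; have -> : a = b' by apply/(as_inj aR Ru' ya (uu' _ yb')).
by apply/mem_unzip2; exists y.
Qed.

Lemma countable_constructible R : atomic_set R -> countable (univ R) -> constructible_set R.
Proof.
move=> aR /countableW[f fi]; exists (fun x => (bound set0, f x)).
split=> [x y Rx Ry [/fi]|x Rx]; first exact.
have h n : exists y, forall y', univ R y' -> f y' = n -> y' = y.
  have [[y [Ry fy]]|H] := pselect (exists y, univ R y /\ f y = n).
    by exists y => y' Ry' fy'; apply: fi => //; rewrite fy.
  by exists (bound set0) => y' Ry' fy'; case: H; exists y'.
have [e eP] := choice h.
apply: (@isolated_over_finite _ _ x (map e (iota 0 (f x)))) => // [y []//|y [Ry]].
rewrite /lex /= ltxx eqxx /= => lt; apply/mapP; exists (f y); last exact: eP.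
by rewrite mem_iota.
Qed.

Definition nondense_levels : set omega1 := [set g | exists q, [/\ good q, lev q = g & ~ dense (rel q)]].

Lemma nondenseP q : good q -> nondense_levels (lev q) <-> ~ dense (rel q).
Proof.
move=> gq; split=> [[q' [gq' eq' nd]] d|nd]; last by exists q.
have [a l c p o] := gq; have [a' c' l' p' o'] := gq'; apply: nd.
by apply: (dense_level a a' c _ d); rewrite -eq'.
Qed.

Section Constructible.
Variable B : omega1 -> omega1.
Hypothesis denseB : forall q, good q -> closed_under B (lev q) -> dense (rel q).

Let atomic_step q q' := forall c : seq omega1, (forall x, x \in c -> members q' x) -> exists z u,
  [/\ size c = size z, rel q u, rel q' (zip c z ++ u) & isolates (rel q) u z].

Lemma ex_atomic_step (aq : omega1 * state) : exists q', good aq.2 ->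
  raises aq.1 aq.2 q' /\ (dense (rel aq.2) -> closed_under B (lev q') /\ atomic_step aq.2 q').
Proof.
have [gq|] := pselect (good aq.2); last by exists void_state.
have [d|nd] := pselect (dense (rel aq.2)).
  by have [q' [? ? ? ? ?]] := atomic_extension B aq.1 gq d; exists q'.
by have [q' [? ? ?]] := raise aq.1 gq; exists q'.
Qed.

(** If the isolated types are dense at the levels closed under [B], a chain of
    atomic extensions through such levels never stops, and its union is
    constructible. *)
Lemma closed_dense_constructible : exists R, rich R /\ constructible_set R.
Proof.
have [St StP] := choice ex_atomic_step.
pose step a (b : bool) (H : omega1 -> state) q := St (a, q).
have sg a b H q : good q -> raises a q (step a b H q).
  by move=> gq; have [] := StP (a, q) gq.
pose C := chain void_state step (fun=> false); pose N := next void_state step (fun=> false).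
have NE a : N a = St (a, C a) by [].
have Cg a : good (C a) := chain_good void_good sg _ a.
have Cd a : dense (rel (C a)).
  elim/omega1_ind: a => a IH.
  have [a0|a0] := pselect (exists b, b < a); last by rewrite /C chain0 //; exact: void_dense.
  have cN b : b < a -> closed_under B (lev (N b)).
    by move=> ba; rewrite NE; have [_ /(_ (IH b ba))[]] := StP (b, C b) (Cg b).
  apply: denseB; first exact: Cg.
  rewrite /C chainS //=; have [ub lu] := lubP (countable_im (fun b => lev (N b)) (below_countable a)).
  split.
    have [b ba] := a0; have [[c cb] _] := cN b ba; exists c; apply: lt_le_trans cb _.
    by apply: ub; exists b.
  move=> c /lu[_ [b ba <-]] cb; have [_ /(_ _ cb) h] := cN b ba; apply: lt_le_trans h _.
  by apply: ub; exists b.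
have Na a : atomic_step (C a) (N a).
  by rewrite NE; have [_ /(_ (Cd a))[]] := StP (a, C a) (Cg a).
exists (limit void_state step (fun=> false)); split; first exact: limit_rich void_good sg _.
set R := limit _ _ _.
have aR : atomic_set R := limit_atomic void_good sg _.
have RC a u : rel (C a) u -> R u by exists a.
have CR a u : R u -> within (members (C a)) u -> rel (C a) u := @limit_chain _ _ void_good sg _ a u.
have stage x : exists a, univ R x -> members (N a) x /\ forall b, members (N b) x -> a <= b.
  have [Rx|] := pselect (univ R x); last by exists (bound set0).
  have /(univ_limit _ _ _ x)[a xa] := Rx.
  have [//|[b _ xb]] := members_chain xa; first by rewrite void_members.
  by have [c ? ?] := omega1_min (A := [set b | members (N b) x]) xb; exists c.
have [st stP] := choice stage.
have num a : exists f : omega1 -> nat, forall x y, members (N a) x -> members (N a) y -> f x = f y -> x = y.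
  have [_ cN _ _ _] := next_good void_good sg (fun=> false) a.
  by have [f fi] := countableW cN; exists f.
have [f fP] := choice num.
exists (fun x => (st x, f (st x) x)); split.
  move=> x y Rx Ry [e1 e2]; rewrite -e1 in e2; apply: (fP (st x)) => //.
    exact: (stP x Rx).1.
  by rewrite e1; apply: (stP y Ry).1.
move=> x Rx; set a := st x; set n := f a x.
have xN : members (N a) x := (stP x Rx).1.
(* The members added at the stage of [x], up to [x]. *)
have inv k : exists y, forall y', members (N a) y' -> f a y' = k -> y' = y.
  have [[y [Ry fy]]|H] := pselect (exists y, members (N a) y /\ f a y = k).
    by exists y => y' Ry' fy'; apply: (fP a) => //; rewrite fy.
  by exists (bound set0) => y' Ry' fy'; case: H; exists y'.
have [e eP] := choice inv.
set A := [set y | _].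
pose c := [seq y <- map e (iota 0 n) | `[< A y /\ members (N a) y >]].
have cA y : y \in c -> A y /\ members (N a) y by rewrite mem_filter => /andP[/asboolP].
have [|[|m z] [u [//sz Ru Rzu iso]]] := Na a (x :: c).
  by move=> y; rewrite inE => /orP[/eqP -> //|/cA[]].
have [//sz'] : (size c).+1 = (size z).+1 := sz; move: sz' => [sz'].
have CA y : members (C a) y -> A y.
  move=> ya; split; first by apply/univ_limit; exists a.
  have [//|[b ba yb]] := members_chain ya; first by rewrite void_members.
  rewrite /lex /=; apply/orP; left; apply: le_lt_trans ba.
  by have [|_] := stP y; [apply/univ_limit; exists a|apply].
have NR v : rel (N a) v -> R v.
  move=> Rv; have [b ab] := omega1_gt a; exists b.
  by have [h _ _ _] := next_chain void_good sg (fun=> false) ab; apply: h.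
have zc y k : (y, k) \in zip c z -> y \in c.
  move=> yk; have : y \in unzip1 (zip c z) by apply/mem_unzip1; exists k.
  by rewrite unzip1_zip ?sz'.
exists (zip c z ++ u), m; split.
- move=> y k; rewrite mem_cat => /orP[/zc/cA[]//|/(as_within _ Ru) yu].
  by apply: CA; apply: yu; have [] := Cg a.
- exact: NR Rzu.
move=> u' Ru' u'A uu' m' Gm.
pose u2 := [seq p <- u' | `[< members (C a) p.1 >]].
have Ru2 : rel (C a) u2.
  apply: CR; first by apply: (as_sub aR Ru') => p; rewrite mem_filter => /andP[].
  by move=> y k; rewrite mem_filter => /andP[/asboolP].
have uu2 : {subset u <= u2}.
  move=> [y k] yk; rewrite mem_filter uu' ?andbT ?mem_cat ?yk ?orbT //.
  by apply/asboolP; have [aC _ _ _ _] := Cg a; apply: (as_within aC Ru yk).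
have G2 : G (zip (m :: z) (m' :: z) ++ diag (unzip2 u2)).
  apply: (iso _ Ru2 uu2) => //; rewrite /= zip_diag; apply: (G_sub Gm) => -[b b'].
  rewrite !inE !mem_cat !mem_diag /unzip2 map_cat mem_cat => /orP[->//|].
  move=> /orP[/andP[bz ->]|/andP[-> ->]]; last by rewrite !orbT.
  have /mem_unzip2[y yb] : b \in unzip2 (zip c z) by rewrite unzip2_zip ?sz'.
  apply/orP; right; rewrite andbT; apply/orP; left; apply/mapP; exists (y, b) => //.
apply: (G_sub G2) => -[b b'] /=; rewrite !inE zip_diag !mem_cat !mem_diag => /orP[->//|].
move=> /andP[/mem_unzip2[y yb] ->]; rewrite !andbT; apply/orP; right.
have [yC|nyC] := pselect (members (C a) y).
  apply/orP; right; apply/mem_unzip2; exists y; rewrite mem_filter yb andbT; exact/asboolP.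
have [Ry] := u'A y b yb; rewrite /lex /= => ltyx.
have sya : st y = a.
  move: ltyx => /orP[lt|/andP[/eqP //]]; case: nyC.
  apply: members_extends (next_chain void_good sg (fun=> false) lt) _ (stP y Ry).1.
have yN : members (N a) y by rewrite -sya; apply: (stP y Ry).1.
have yc : y \in c.
  rewrite mem_filter; apply/andP; split; first by apply/asboolP; split=> //; apply: u'A yb.
  apply/mapP; exists (f a y); last exact: eP.
  by move: ltyx; rewrite sya ltxx eqxx /= mem_iota.
have /mem_unzip1[k yk] : y \in unzip1 (zip c z) by rewrite unzip1_zip ?sz'.
have -> : b = k by apply/(as_inj aR Ru' yb (uu' _ _)) => //; rewrite mem_cat yk.
apply/orP; left; have : k \in unzip2 (zip c z) by apply/mem_unzip2; exists y.
by rewrite unzip2_zip ?sz'.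
Qed.
End Constructible.

Lemma stationary_nondense : (forall R, rich R -> ~ constructible_set R) ->
  stationary nondense_levels.
Proof.
move=> nc; apply/stationaryP => B; apply: contrapT => H.
have [|R [rR cR]] := @closed_dense_constructible B; last exact: nc cR.
move=> q gq Bq; apply: contrapT => /(nondenseP gq) nd.
by apply: H; exists (lev q).
Qed.

(** * Possible types *)

Definition possible A q : set ptype := [set p | exists q' c,
  [/\ extends q q', good q', forall x, x \in c -> members q' x & p = type_of A (rel q') c]].

Definition stable A q := forall q', extends q q' -> good q' -> possible A q `<=` possible A q'.

(** If a possible type could be omitted, then promising to omit it would make
    it impossible. *)
Lemma stable_forced A q p : good q -> stable A q -> possible A q p ->
  exists u0 ys z, valid (rel q) u0 ys /\ forces (rel q) A p u0 ys z.
Proof.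
move=> gq st pq; apply: contrapT => nf.
have om : omitted (rel q) A p.
  by move=> u0 ys z val frc; apply: nf; exists u0, ys, z.
have [aR cV lq cP oP] := gq.
pose q' := State (rel q) ((A, p) |` prom q) (lev q).
have gq' : good q'.
  split=> //=; first by apply: countable_cup => //; apply: countable1.
  by move=> A' p' [[-> ->]|/oP].
have [|q2 [c [e2 [a2 _ _ _ o2] c2 pE]]] := st q' _ gq' p pq.
  by split=> // x ?; right.
have [_ _ pr _] := e2; have := o2 A p (pr _ (or_introl erefl)).
by rewrite pE; apply: realised_not_omitted.
Qed.

(** There are [aleph_1] tests, and each forces at most one type. *)
Lemma stable_enum A q : good q -> A `<=` members q -> stable A q -> exists Z : omega1 -> ptype,
  (forall i, possible A q (Z i)) /\ forall p, possible A q p -> exists i, Z i = p.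
Proof.
move=> gq Aq st.
have sT := @small_test omega1 (ex_intro _ id (fun x y => id)).
have h (p : {p | possible A q p}) : exists t : (pmap * seq (seq M * omega1)) * seq M, valid (rel q) t.1.1 t.1.2 /\
    forces (rel q) A (sval p) t.1.1 t.1.2 t.2.
  by have [u0 [ys [z ?]]] := stable_forced gq st (svalP p); exists ((u0, ys), z).
have [t tP] := choice h.
have sP : small {p | possible A q p}.
  apply: embeds_trans sT; exists t => -[p pp] [p' pp'] E; apply: eq_exist => /=.
  have [val f] := tP (exist _ p pp); have [_ f'] := tP (exist _ p' pp'); rewrite -E in f'.
  have [q1 [c1 [_ [a1 _ _ _ _] _ E1]]] := pp; have [q2 [c2 [_ [a2 _ _ _ _] _ E2]]] := pp'.
  move: val f f'; move: (t _) => t0 /=; rewrite E1 E2; exact: (forces_inj a1 a2 Aq).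
have p0 : possible A q (type_of A (rel q) [::]).
  by exists q, [::]; split=> //; apply: extends_refl.
have [e eP] := small_enum (exist _ _ p0) sP.
exists (fun i => sval (e i)); split=> [i|p pp]; first exact: svalP.
by have [i ei] := eP (exist _ p pp); exists i; rewrite ei.
Qed.

Definition iso_by (h h' : omega1 -> omega1) R R' :=
  [/\ forall x, univ R x -> univ R' (h x) /\ h' (h x) = x,
      forall y, univ R' y -> univ R (h' y) /\ h (h' y) = y &
      forall u, within (univ R) u -> R u <-> R' [seq (h p.1, p.2) | p <- u]].

Definition iso_set R R' := exists h h', iso_by h h' R R'.

Lemma map_within (h : omega1 -> omega1) A A' u : (forall x, A x -> A' (h x)) -> within A u ->
  within A' [seq (h p.1, p.2) | p <- u].
Proof. by move=> hA uA x m /mapP[[y n] /uA /hA Ah [-> _]]. Qed.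

Lemma map_cancel (h h' : omega1 -> omega1) A u : (forall x, A x -> h' (h x) = x) -> within A u ->
  [seq (h' p.1, p.2) | p <- [seq (h p.1, p.2) | p <- u]] = u.
Proof.
move=> hK uA; rewrite -map_comp -[RHS]map_id; apply/eq_in_map => -[x m] /uA Ax /=.
by rewrite hK.
Qed.

Lemma iso_set_sym R R' : iso_set R R' -> iso_set R' R.
Proof.
move=> [h [h' [hP h'P hR]]]; exists h', h; split=> // u uR'.
have uR : within (univ R) [seq (h' p.1, p.2) | p <- u].
  by apply: map_within uR' => y /h'P[].
by rewrite (hR _ uR) (@map_cancel h' h (univ R')) // => y /h'P[].
Qed.

Lemma iso_set_trans R R' R2 : iso_set R R' -> iso_set R' R2 -> iso_set R R2.
Proof.
move=> [h [h' [hP h'P hR]]] [k [k' [kP k'P kR]]]; exists (k \o h), (h' \o k'); split.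
- by move=> x /hP[/kP[? e] e'] /=; rewrite e.
- by move=> x /k'P[/h'P[? e] e'] /=; rewrite e.
move=> u uR; rewrite (hR _ uR) kR; last by apply: map_within uR => x /hP[].
by rewrite -map_comp.
Qed.

Lemma map_zip_fst (h : omega1 -> omega1) (c : seq omega1) (z : seq M) u :
  [seq (h p.1, p.2) | p <- zip c z ++ u] = zip (map h c) z ++ [seq (h p.1, p.2) | p <- u].
Proof. by rewrite map_cat; congr (_ ++ _); elim: c z => [|x c IH] [|y z] //=; rewrite IH. Qed.

Lemma zip_within A (c : seq omega1) (z : seq M) u : size c = size z -> (forall x, x \in c -> A x) ->
  within A u -> within A (zip c z ++ u).
Proof.
move=> sz cA uA x m; rewrite mem_cat => /orP[xm|/uA//].
by apply: cA; have : x \in unzip1 (zip c z) by [apply/mem_unzip1; exists m]; rewrite unzip1_zip ?sz.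
Qed.

(** * First case: a tree over a fixed countable set *)

Definition types_in A R R' := forall c, (forall x, x \in c -> univ R x) -> exists c',
  (forall x, x \in c' -> univ R' x) /\ type_of A R c = type_of A R' c'.

Section FirstCase.
Variable q0 : state.
Hypothesis good0 : good q0.
Hypothesis unstable : forall q, extends q0 q -> good q -> ~ stable (members q0) q.
Hypothesis Phi : weak_diamond setT.
Let A := members q0.

Lemma unstable_split (q : state) : exists sp : bool -> state, extends q0 q -> good q ->
  [/\ forall b, extends q (sp b), forall b, good (sp b) &
   exists c, (forall x, x \in c -> members (sp true) x) /\
     ~ possible A (sp false) (type_of A (rel (sp true)) c)].
Proof.
have [[e g]|n] := pselect (extends q0 q /\ good q); last by exists (fun=> q) => ? ?; case: n.
have /existsNP[q' /not_implyP[e' /not_implyP[g' /existsNP[p]]]] := unstable e g.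
move=> /not_implyP[[q1 [c [e1 g1 c1 pE]]] np].
exists (fun b => if b then q1 else q') => _ _; split; [by case|by case|].
by exists c; rewrite -pE.
Qed.

Lemma ex_raise (a : omega1) : exists rs : state -> state, forall q, good q -> raises a q (rs q).
Proof.
have h q : exists q', good q -> raises a q q'.
  have [g|] := pselect (good q); last by exists q.
  by have [q' ?] := raise a g; exists q'.
by have [rs rsP] := choice h; exists rs.
Qed.

(** Along the branch, each step follows one side of [unstable_split].  At the
    first difference of two branches, the limit on the side of [true] realises
    over [A] a type that is impossible on the side of [false]. *)
Lemma first_tree : exists N : (omega1 -> bool) -> pmap -> Prop,
  [/\ forall f, rich (N f), forall f, A `<=` univ (N f) &
   forall f f', types_in A (N f) (N f') -> types_in A (N f') (N f) -> f = f'].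
Proof.
have [sp spP] := choice unstable_split; have [rs rsP] := choice ex_raise.
pose step a (b : bool) (H : omega1 -> state) q := rs a
  (if `[< extends q0 q /\ good q >] then sp q b else q).
have sg a b H q : good q -> raises a q (step a b H q).
  move=> g; rewrite /step; case: asboolP => [[e _]|_]; last exact: rsP.
  have [e1 g1 _] := spP q e g; have [e2 g2 l2] := rsP a _ (g1 b).
  by split=> //; apply: extends_trans (e1 b) e2.
pose C := chain q0 step; pose N := limit q0 step.
have Ce f a : extends q0 (C f a) := chain_init good0 sg f a.
have Cg f a : good (C f a) := chain_good good0 sg f a.
have AC f a : A `<=` members (C f a) := members_extends (Ce f a).
have split_at f a b : a < b -> extends (sp (C f a) (f a)) (C f b).
  move=> ab; apply: extends_trans (next_chain good0 sg f ab); rewrite /next /step -/(C f a).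
  case: asboolP => [_|[]//]; have [_ g1 _] := spP _ (Ce f a) (Cg f a).
  by have [] := rsP a _ (g1 (f a)).
exists N; split.
- exact: limit_rich.
- by move=> f x Ax; apply/univ_limit; exists (bound set0); apply: AC.
suff H (f f' : omega1 -> bool) a : (forall b, b < a -> f b = f' b) -> f a -> ~~ f' a ->
    types_in A (N f) (N f') -> False.
  move=> f f' H1 H2; apply/funext; elim/omega1_ind => a IH.
  case E: (f a); case E': (f' a) => //; exfalso.
    by apply: (H f f' a IH _ _ H1); rewrite ?E ?E'.
  by apply: (H f' f a _ _ _ H2); rewrite ?E ?E' // => b /IH.
move=> ff' fa f'a H1; have [b ab] := omega1_gt a.
have CE : C f a = C f' a := chain_local q0 step ff'.
have [e1 g1 [c [c1 np]]] := spP _ (Ce f a) (Cg f a).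
have cb x : x \in c -> members (C f b) x.
  by move=> /c1; apply: members_extends; rewrite -[X in sp _ X]fa; apply: split_at.
have [x /cb xb|c' [c'N E]] := H1 c; first by apply/univ_limit; exists b.
have [d dP] := limit_cover good0 sg c'N; pose b' := Order.max b d.
have c'b x : x \in c' -> members (C f' b') x.
  by move=> /dP; apply: members_extends; apply: chain_le; rewrite // le_max lexx orbT.
apply: np; exists (C f' b'), c'; split=> //.
  rewrite CE -(negbTE f'a); apply: split_at; apply: lt_le_trans ab _.
  by rewrite le_max lexx.
rewrite -(limit_type good0 sg (AC f' b') c'b) -/(N f') -E.
rewrite (limit_type good0 sg (AC f b) cb); apply/esym.
have -> : sp (C f a) true = sp (C f a) (f a) by rewrite fa.
apply: type_of_extends; first exact: split_at.
  by apply: subset_trans (AC f a) (members_extends (e1 _)).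
by rewrite fa.
Qed.
End FirstCase.

Lemma type_of_fixed R R' (h : omega1 -> omega1) A c :
  (forall u, within (univ R) u -> R u <-> R' [seq (h p.1, p.2) | p <- u]) ->
  A `<=` univ R -> (forall x, A x -> h x = x) -> (forall x, x \in c -> univ R x) ->
  type_of A R c = type_of A R' (map h c).
Proof.
move=> hR AR hA cR; apply/funext => z; apply/funext => u; apply/propext.
have hu : within A u -> [seq (h p.1, p.2) | p <- u] = u.
  by move=> uA; rewrite -[RHS]map_id; apply/eq_in_map => -[x m] /uA/hA /= ->.
have E (sz : size c = size z) : within A u -> R (zip c z ++ u) <-> R' (zip (map h c) z ++ u).
  move=> uA; rewrite -{2}(hu uA) -map_zip_fst; apply: hR.
  by apply: zip_within => // x m /uA/AR.
split=> -[uA sz Rz]; split=> //; first by rewrite size_map.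
- exact/E.
- by rewrite size_map in sz.
- by rewrite size_map in sz; apply/E.
Qed.

(** Isomorphic limits realise the same types over [A], provided the isomorphism
    fixes [A].  So a limit is determined by its isomorphism class and by the
    images of the members of [A] in a representative of this class, and there are
    fewer maps from [A] to omega_1 than limits. *)
Lemma first_case q0 : good q0 ->
  (forall q, extends q0 q -> good q -> ~ stable (members q0) q) -> weak_diamond setT ->
  exists N : (omega1 -> bool) -> pmap -> Prop, (forall f, rich (N f)) /\
    forall f f', f <> f' -> ~ iso_set (N f) (N f').
Proof.
move=> g0 us wd; have [N [rN AN Ninj]] := first_tree g0 us.
set A := members q0 in AN Ninj.
have [_ cA _ _ _] := g0.
have [enA enAP] := countable_enum (bound set0) cA.
pose cls f : set (omega1 -> bool) := [set f' | iso_set (N f) (N f')].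
have iso_refl f : iso_set (N f) (N f).
  exists id, id; split=> // u _; suff -> : [seq (id p.1, p.2) | p <- u] = u by [].
  by rewrite -[RHS]map_id; apply: eq_map => -[].
have cls_eq f f' : iso_set (N f) (N f') -> cls f = cls f'.
  move=> ff'; apply/seteqP; split=> f2.
    exact/iso_set_trans/iso_set_sym.
  exact: iso_set_trans.
pose rep f := xget (fun=> false) (cls f).
have repP f : iso_set (N f) (N (rep f)).
  by rewrite /rep; case: xgetP => [f' -> //|/(_ f)[]]; apply: iso_refl.
have rep_eq f f' : iso_set (N f) (N f') -> rep f = rep f'.
  by move=> ff'; rewrite /rep (cls_eq _ _ ff').
have isoP f : exists hh, iso_by hh.1 hh.2 (N f) (N (rep f)).
  by have [h [h' ?]] := repP f; exists (h, h').
have [hh hhP] := choice isoP.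
pose Q := {f | rep f = f}.
have repK f : rep (rep f) = rep f by apply/esym/rep_eq/repP.
pose t f : Q := exist _ (rep f) (repK f).
pose e f : nat -> omega1 := fun n => (hh f).1 (enA n).
have half f f' : rep f = rep f' -> e f = e f' -> types_in A (N f) (N f').
  move=> rr ee c cf; have [h1 h1' hR] := hhP f; have [k1 k1' kR] := hhP f'; rewrite -rr in k1 k1' kR.
  pose phi x := (hh f').2 ((hh f).1 x).
  exists (map phi c); split; first by move=> _ /mapP[x /cf/h1[? _] ->]; apply: (k1' _ _).1.
  apply: type_of_fixed => // [u uf|x Ax]; last first.
    have [n En] := enAP _ Ax; rewrite /phi -En; have -> : (hh f).1 (enA n) = (hh f').1 (enA n).
      exact: (congr1 (@^~ n) ee).
    by case: (k1 (enA n)) => //; apply: AN; rewrite En.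
  rewrite (hR _ uf) (kR [seq (phi p.1, p.2) | p <- u]); last first.
    by apply: map_within uf => x /h1[? _]; apply: (k1' _ _).1.
  rewrite -map_comp; suff -> : [seq ((hh f).1 p.1, p.2) | p <- u] =
      [seq ((fun p => ((hh f').1 p.1, p.2)) \o (fun p => (phi p.1, p.2))) i | i <- u] by [].
  apply/eq_in_map => -[x m] /uf/h1[hx _] /=.
  by rewrite (k1' _ hx).2.
have fib f f' : t f = t f' -> e f = e f' -> f = f'.
  move=> /(congr1 sval) /= rr ee; apply: Ninj; exact: half.
have D2 : embeds ((nat -> omega1) * (nat -> omega1)) (nat -> omega1).
  exists (fun x n => if odd n then x.1 n./2 else x.2 n./2) => -[x y] [x' y'] E.
  congr (_, _); apply/funext => n.
    by have /= := congr1 (@^~ n.*2.+1) E; rewrite odd_double uphalf_double.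
  by have /= := congr1 (@^~ n.*2) E; rewrite odd_double doubleK.
have [b bb] := omega1_gt (bound set0).
have d01 : (fun=> bound set0) <> (fun=> b) :> (nat -> omega1).
  by move=> /(congr1 (@^~ 0%N)) E; rewrite E ltxx in bb.
have [i ii] := embeds_fibers d01 D2 (weak_diamond_no_embedding wd) fib.
exists (fun f => N (sval (i f))); split=> // f f' ne iso'; apply: ne; apply: ii.
apply: eq_sig_hprop => [x|]; first exact: Prop_irrelevance.
by rewrite -(svalP (i f)) -(svalP (i f')) (rep_eq _ _ iso').
Qed.

(** * Second case: the weak diamond *)

Section SecondCase.
Hypothesis stab : forall q, good q -> exists q', [/\ extends q q', good q' & stable (members q) q'].

(** A condition whose isolated types are not dense has a stable extension, with
    an enumeration of its possible types, and an extension realising a type that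
    is not among them. *)
Record splitting (q q0 q1 : state) (c : seq omega1) (Z : omega1 -> ptype) : Prop := {
  split0 : extends q q0;
  split0_good : good q0;
  split0_stable : stable (members q) q0;
  split1 : extends q q1;
  split1_good : good q1;
  split_tuple : forall x, x \in c -> members q1 x;
  split_enum : forall p, possible (members q) q0 p -> exists i, Z i = p;
  split_type : ~ possible (members q) q0 (type_of (members q) (rel q1) c)
}.

Lemma ex_splitting q : good q -> ~ dense (rel q) -> exists q0 q1 c Z, splitting q q0 q1 c Z.
Proof.
move=> gq nd; have [q0 [e0 g0 s0]] := stab gq.
have [Z [Zp Zon]] := stable_enum g0 (members_extends e0) s0.
have [||q1 [c [e1 g1 c1 nZ]]] := @avoid_types q omega1 Z gq nd.
- by exists id.
- move=> i; have [q' [c [_ [a' _ _ _ _] _ ->]]] := Zp i.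
  by exists (rel q'), c.
exists q0, q1, c, Z; split=> // /Zon[i E]; apply: (nZ i); exact: esym.
Qed.

Lemma choose_splitting : exists (s0 s1 : state -> state) (c : state -> seq omega1) (Z : state -> omega1 -> ptype),
  forall q, good q -> ~ dense (rel q) -> splitting q (s0 q) (s1 q) (c q) (Z q).
Proof.
have h q : exists t : (state * state) * (seq omega1 * (omega1 -> ptype)), good q -> ~ dense (rel q) ->
    splitting q t.1.1 t.1.2 t.2.1 t.2.2.
  have [[g n]|H] := pselect (good q /\ ~ dense (rel q)).
    by have [q0 [q1 [c [Z ?]]]] := ex_splitting g n; exists ((q0, q1), (c, Z)).
  by exists ((q, q), ([::], fun _ _ _ => True)) => g n; case: H.
have [t tP] := choice h.
by exists (fun q => (t q).1.1), (fun q => (t q).1.2), (fun q => (t q).2.1), (fun q => (t q).2.2).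
Qed.

Lemma choose_realisation : exists r : set omega1 -> ptype -> state -> state, forall A p q, good q ->
  [/\ extends q (r A p q), good (r A p q) & possible A q p ->
    exists c, (forall x, x \in c -> members (r A p q) x) /\ p = type_of A (rel (r A p q)) c].
Proof.
have h (t : (set omega1 * ptype) * state) : exists q', good t.2 -> [/\ extends t.2 q', good q' &
    possible t.1.1 t.2 t.1.2 ->
    exists c, (forall x, x \in c -> members q' x) /\ t.1.2 = type_of t.1.1 (rel q') c].
  have [[q' [c [e g c' E]]]|n] := pselect (possible t.1.1 t.2 t.1.2).
    by exists q' => _; split=> // _; exists c.
  by exists t.2 => g; split=> //; apply: extends_refl.
have [r rP] := choice h.
by exists (fun A p q => r ((A, p), q)) => A p q; apply: (rP ((A, p), q)).
Qed.

(** The tree of conditions: at a condition where the isolated types are not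
    dense, [false] passes to the stable extension and [true] realises the type
    that is impossible there.  Meanwhile all the possible types of the stable
    conditions met so far are realised one by one, so that the limit realises
    exactly those. *)
Lemma second_tree : exists (C : (omega1 -> bool) -> omega1 -> state) (N : (omega1 -> bool) -> pmap -> Prop)
    (s0 s1 : state -> state) (c : state -> seq omega1),
  [/\ forall f, rich (N f),
      forall f a, good (C f a),
      forall (f f' : omega1 -> bool) a, (forall b, b < a -> f b = f' b) -> C f a = C f' a,
      forall f, exists B, forall a, closed_under B a -> lev (C f a) = a &
      forall f x, univ (N f) x <-> exists a, members (C f a) x] /\
  [/\ forall f a b, a <= b -> extends (C f a) (C f b),
      forall f a x, members (C f a) x -> exists2 b, b < a & forall a', b < a' -> members (C f a') x,
      forall q, good q -> ~ dense (rel q) -> ~ possible (members q) (s0 q) (type_of (members q) (rel (s1 q)) (c q)),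
      forall (f : omega1 -> bool) a, f a -> ~ dense (rel (C f a)) -> (forall x, x \in c (C f a) -> univ (N f) x) /\
         type_of (members (C f a)) (rel (s1 (C f a))) (c (C f a)) = type_of (members (C f a)) (N f) (c (C f a)) &
      forall (f : omega1 -> bool) a p, ~~ f a -> ~ dense (rel (C f a)) -> possible (members (C f a)) (s0 (C f a)) p <->
         exists d, (forall x, x \in d -> univ (N f) x) /\ p = type_of (members (C f a)) (N f) d].
Proof.
have [s0 [s1 [c [Z sP]]]] := choose_splitting.
have [r rP] := choose_realisation.
have [rs rsP] := choice (ex_raise).
have [sg sgP] := omega1_cofinal_enum.
have [pr pri] := embeds_omega1_square.
have [dec decP] := @small_enum (omega1 * omega1) (bound set0, bound set0) embeds_omega1_square.
pose spl (b : bool) q := if `[< good q /\ ~ dense (rel q) >] then if b then s1 q else s0 q else q.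
pose task a (H : omega1 -> state) := r (members (H (dec (sg a)).1)) (Z (H (dec (sg a)).1) (dec (sg a)).2).
pose step a b H q := rs a (task a H (spl b q)).
have splP b q : good q -> extends q (spl b q) /\ good (spl b q).
  move=> gq; rewrite /spl; case: asboolP => [[_ nd]|_]; last by split=> //; apply: extends_refl.
  by have S := sP q gq nd; case: b; split; case: S.
have stP a b H q : good q -> raises a q (step a b H q).
  move=> gq; have [e1 g1] := splP b q gq.
  have [e2 g2 _] := rP (members (H (dec (sg a)).1)) (Z (H (dec (sg a)).1) (dec (sg a)).2) _ g1.
  have [e3 g3 l3] := rsP a _ g2; split=> //.
  exact: extends_trans e1 (extends_trans e2 e3).
pose C := chain void_state step; pose N := limit void_state step.
have Cg f a : good (C f a) := chain_good void_good stP f a.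
have spl_next f a b : a < b -> extends (spl (f a) (C f a)) (C f b).
  move=> ab; apply: extends_trans (next_chain void_good stP f ab); rewrite /next /step -/(C f a).
  have [_ g1] := splP (f a) _ (Cg f a).
  have [e2 g2 _] := rP (members (cut void_state (C f) a (dec (sg a)).1))
    (Z (cut void_state (C f) a (dec (sg a)).1) (dec (sg a)).2) _ g1.
  by have [e3 _ _] := rsP a _ g2; apply: extends_trans e2 e3.
have splE f a : ~ dense (rel (C f a)) -> spl (f a) (C f a) = if f a then s1 (C f a) else s0 (C f a).
  by move=> nd; rewrite /spl; case: asboolP => // n; case: n.
have Cle f a b : a <= b -> extends (C f a) (C f b) := @chain_le _ _ void_good stP f a b.
exists C, N, s0, s1, c; split; split.
- exact: (limit_rich void_good stP).
- exact: Cg.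
- by move=> f f' a; apply: chain_local.
- by move=> f; apply: (chain_lev void_good stP).
- exact: univ_limit.
- exact: Cle.
- move=> f a x /members_chain[|[b ba xb]]; first by rewrite void_members.
  exists b => // a' ba'; apply: members_extends xb; exact: (next_chain void_good stP).
- by move=> q gq nd; case: (sP q gq nd).
- move=> f a fa nd; have [b ab] := omega1_gt a.
  have := spl_next f a b ab; rewrite splE // fa => e1.
  have S := sP _ (Cg f a) nd.
  have cb x : x \in c (C f a) -> members (C f b) x.
    by move=> /(split_tuple S); apply: members_extends.
  split; first by move=> x /cb xb; apply/univ_limit; exists b.
  rewrite (limit_type void_good stP _ cb) -/(C f b); last by apply/members_extends/Cle/ltW.
  apply/esym/type_of_extends => //; last exact: split_tuple S.
  exact: members_extends (split1 S).
move=> f a p fa nd; have S := sP _ (Cg f a) nd.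
have s0_next b : a < b -> extends (s0 (C f a)) (C f b).
  by move=> /(spl_next f); rewrite splE // (negbTE fa).
split=> [pp|[d [df ->]]].
  have [i Zi] := split_enum S pp.
  have [j ej] := decP (a, i).
  have [b ab sgb] := sgP j a.
  have eb : extends (s0 (C f a)) (spl (f b) (C f b)).
    exact: extends_trans (s0_next b ab) (splP _ _ (Cg f b)).1.
  have [_ gb] := splP (f b) _ (Cg f b).
  have pb := split0_stable S eb gb pp.
  have [e2 g2 /(_ pb) [d [d2 E]]] := rP (members (C f a)) p _ gb.
  have [e3 g3 _] := rsP b _ g2.
  have [b' bb'] := omega1_gt b.
  have e4 : extends (r (members (C f a)) p (spl (f b) (C f b))) (C f b').
    apply: extends_trans e3 _; have := next_chain void_good stP f bb'.
    rewrite /next /step /task -/(C f) sgb ej /= /cut (ltW ab).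
    by rewrite -/(C f) Zi.
  have d4 x : x \in d -> members (C f b') x by move=> /d2; apply: members_extends.
  exists d; split; first by move=> x /d4 xb; apply/univ_limit; exists b'.
  have aA : members (C f a) `<=` members (C f b').
    by apply/members_extends/Cle/ltW/(lt_trans ab).
  rewrite {1}E (limit_type void_good stP aA d4) -/(C f b').
  apply/esym/type_of_extends => //.
  apply: subset_trans (members_extends e2).
  exact: subset_trans (members_extends (split0 S)) (members_extends eb).
have [b db] := limit_cover void_good stP df.
have [b' ab'] := omega1_gt (Order.max a b).
move: ab'; rewrite gt_max => /andP[ab' bb'].
have db' x : x \in d -> members (C f b') x by move=> /db; apply: members_extends; apply/Cle/ltW.
exists (C f b'), d; split=> //; first exact: s0_next.
by apply: (limit_type void_good stP _ db'); apply/members_extends/Cle/ltW.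
Qed.

(** The image of a type under a finite part of a bijection of the names. *)
Definition transport (e : omega1 -> omega1 -> bool) (p : ptype) : ptype := fun z u =>
  exists w : seq ((omega1 * omega1) * M), [/\ forall t, t \in w -> e t.1.1 t.1.2,
    u = [seq (t.1.2, t.2) | t <- w] & p z [seq (t.1.1, t.2) | t <- w]].

Section Transport.
Variables (h h' : omega1 -> omega1) (e : omega1 -> omega1 -> bool) (A A' : set omega1).
Hypothesis eh : forall x y, e x y -> h x = y.
Hypothesis Ae : forall x, A x -> e x (h x).
Hypothesis hK : forall x, A x -> h' (h x) = x.

Lemma transport_half p p' : (forall z u, p z u -> within A u) -> (forall z u, p' z u -> within A u) ->
  transport e p = transport e p' -> forall z u, p z u -> p' z u.
Proof.
move=> pA p'A E z u pu; have uA := pA _ _ pu.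
have : transport e p z [seq (h p.1, p.2) | p <- u].
  exists [seq ((p.1, h p.1), p.2) | p <- u]; split.
  - by move=> t /mapP[[x m] /uA/Ae ? ->].
  - by rewrite -map_comp.
  - by rewrite -map_comp (@eq_map _ _ _ id) ?map_id // => -[].
rewrite E => -[w [we wu p'w]]; suff <- : [seq (t.1.1, t.2) | t <- w] = u by [].
rewrite -(map_cancel hK uA) wu -map_comp; apply/eq_in_map => -[[x y] m] /= tw.
have Ax : A x by apply: (p'A _ _ p'w x m); apply/mapP; exists ((x, y), m).
by have /= <- := eh (we _ tw); rewrite hK.
Qed.

Lemma transport_inj p p' : (forall z u, p z u -> within A u) -> (forall z u, p' z u -> within A u) ->
  transport e p = transport e p' -> p = p'.
Proof.
move=> pA p'A E; apply/funext => z; apply/funext => u; apply/propext.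
by split; [exact: transport_half E z u|exact: transport_half (esym E) z u].
Qed.

Hypothesis hA : forall x, A x -> A' (h x).
Hypothesis h'A : forall y, A' y -> A (h' y) /\ h (h' y) = y.

Lemma transport_type R R' c : A `<=` univ R -> (forall x, x \in c -> univ R x) ->
  (forall u, within (univ R) u -> R u <-> R' [seq (h p.1, p.2) | p <- u]) ->
  transport e (type_of A R c) = type_of A' R' (map h c).
Proof.
move=> AR cR hR; apply/funext => z; apply/funext => u; apply/propext; split.
  move=> [w [we -> [wA sz Rz]]].
  have -> : [seq (t.1.2, t.2) | t <- w] = [seq (h p.1, p.2) | p <- [seq (t.1.1, t.2) | t <- w]].
    by rewrite -map_comp; apply/eq_in_map => t /we /eh /= ->.
  split; [exact: map_within hA wA|by rewrite size_map|].
  rewrite -map_zip_fst; apply/hR => //; apply: zip_within => // x m /wA /AR //.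
move=> [uA']; rewrite size_map => sz Rz; exists [seq ((h' p.1, p.1), p.2) | p <- u].
have uA : within A [seq (h' p.1, p.2) | p <- u] by apply: map_within uA' => y /h'A[].
split.
- move=> t /mapP[[y m] /uA' /h'A [Ay hy] ->] /=.
  by rewrite -{2}hy; apply: Ae.
- by rewrite -map_comp (@eq_map _ _ _ id) ?map_id // => -[].
rewrite -map_comp; split=> //; apply/hR; first by apply: zip_within => // x m /uA/AR.
by rewrite map_zip_fst (@map_cancel h' h A') // => y /h'A[].
Qed.
End Transport.

(** The models are indexed by subsets [X] of omega_1: on the [i]-th part of the
    stationary set of nondense levels, the branch of [X] follows the guess of the
    weak diamond if [i] belongs to [X], and is constantly [false] otherwise.  If
    [i] is in [X] but not in [Y], an isomorphism from the first limit to the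
    second one sends the type split at the level [a] to a type that is possible
    for the stable condition of the branch of [Y] or not; this is known at [a],
    and the right guess refutes the isomorphism. *)
Lemma second_case : stationary nondense_levels -> Phi_star ->
  exists N : (omega1 -> bool) -> pmap -> Prop, (forall f, rich (N f)) /\
    forall f f', f <> f' -> ~ iso_set (N f) (N f').
Proof.
move=> statS phi.
have [C [N [s0 [s1 [c [[rN gC Cloc Clev Nuniv] [Cle Clim spl one zero]]]]]]] := second_tree.
have [St [statSt StS Stdisj]] := ulam statS.
have [pr pri] : small (omega1 * omega1 * nat) by apply: small_prod; [exact: embeds_omega1_square|exact: embeds_nat_omega1].
(* The functions on which the diamond bears code two branches and a relation on
   names; [F] asks whether the type split on the first branch is sent by the
   relation to a type that is impossible for the second one. *)
pose d0 (e : omega1 -> bool) x := e (pr ((x, x), 0%N)).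
pose d1 (e : omega1 -> bool) x := e (pr ((x, x), 1%N)).
pose d2 (e : omega1 -> bool) x y := e (pr ((x, y), 2)).
pose cp f a := type_of (members (C f a)) (rel (s1 (C f a))) (c (C f a)).
pose F (e : omega1 -> bool) a : bool := `[< ~ possible (members (C (d1 e) a)) (s0 (C (d1 e) a))
  (transport (d2 e) (cp (d0 e) a)) >].
have [g gP] := choice (fun i => weak_diamond_trunc (phi _ (statSt i)) F).
pose br (X : omega1 -> bool) a := `[< exists i, [/\ X i, St i a & g i a] >].
have brE X i a : St i a -> br X a = X i && g i a.
  move=> Sia; apply/asboolP/andP => [[j [Xj Sja gja]]|[Xi gi]]; last by exists i.
  by rewrite (Stdisj _ _ _ Sia Sja).
suff main (X Y : omega1 -> bool) i : X i -> ~~ Y i -> ~ iso_set (N (br X)) (N (br Y)).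
  exists (fun X => N (br X)); split=> // X Y XY iso; apply: XY; apply/funext => i.
  case E: (X i); case E': (Y i) => //; exfalso.
    by apply: (main X Y i) iso; rewrite ?E ?E'.
  by apply: (main Y X i) (iso_set_sym iso); rewrite ?E ?E'.
move=> Xi nYi [h [h' [hP h'P hR]]].
set f := br X in hP h'P hR; set f' := br Y in hP h'P hR.
(* The triple formed by the two branches and the isomorphism. *)
pose e (y : omega1) := `[< exists t, pr t = y /\ match t.2 with 0 => f t.1.1 | 1 => f' t.1.1
  | _ => h t.1.1 == t.1.2 end >].
have eE x y n : e (pr ((x, y), n)) = match n with 0 => f x | 1 => f' x | _ => h x == y end.
  apply/asboolP/idP => [[t [/pri -> H]]|H]; first by case: n H => [|[]].
  by exists ((x, y), n); split=> //; case: n H => [|[]].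
(* At a level [a] closed under [B1], ..., [B7], the two conditions are at level
   [a] with names below [a], the isomorphism matches their names, and the code
   [e] restricted to [a] determines all this. *)
have stage f2 x : exists a, univ (N f2) x -> members (C f2 a) x.
  have [/Nuniv[a xa]|] := pselect (univ (N f2) x); last by exists (bound set0).
  by exists a.
pose st f2 := projT1 (choice (stage f2)).
have stP f2 : forall x, univ (N f2) x -> members (C f2 (st f2 x)) x := projT2 (choice (stage f2)).
have [B1 B1P] := Clev f; have [B2 B2P] := Clev f'.
have [nx nxP] := choice omega1_gt.
have cM f2 b : countable (members (C f2 b)) by have [] := gC f2 b.
pose B3 b := bound (members (C f (nx b))).
pose B4 b := bound (members (C f' (nx b))).
pose B5 b := bound [set st f' (h x) | x in members (C f (nx b))].
pose B6 b := bound [set st f (h' x) | x in members (C f' (nx b))].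
pose le b := [set x : omega1 | x < b] `|` [set b].
have cle b : countable (le b) by apply: countable_cup => //; apply: below_countable.
pose B7 b := bound [set pr t | t in (le b `*` le b) `*` setT].
have [B BP] := closed_under_all (nth B1 [:: B1; B2; B3; B4; B5; B6; B7]) (countableP _).
have := gP i e; move=> /stationaryP/(_ B)[a [Sia Fa] /BP aB].
have Cmem f2 x : members (C f2 a) x -> exists2 b, b < a & members (C f2 (nx b)) x.
  by move=> /Clim[b ba bP]; exists b => //; apply: bP; apply: nxP.
have la : lev (C f a) = a by apply: B1P; exact: (aB 0%N).
have la' : lev (C f' a) = a by apply: B2P; exact: (aB 1%N).
have Aa x : members (C f a) x -> x < a.
  by move=> /Cmem[b ba xb]; apply: lt_trans ((aB 2%N).2 _ ba); apply: boundP.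
have A'a x : members (C f' a) x -> x < a.
  by move=> /Cmem[b ba xb]; apply: lt_trans ((aB 3%N).2 _ ba); apply: boundP.
have AN f2 x : members (C f2 a) x -> univ (N f2) x by move=> xa; apply/Nuniv; exists a.
have hA x : members (C f a) x -> members (C f' a) (h x).
  move=> xa; have /hP[hx _] := AN _ _ xa; have [b ba xb] := Cmem _ _ xa.
  apply: members_extends (stP f' _ hx); apply: Cle; apply: ltW.
  apply: lt_trans ((aB 4%N).2 _ ba); apply: boundP; first exact: countable_im.
  by exists x.
have h'A y : members (C f' a) y -> members (C f a) (h' y) /\ h (h' y) = y.
  move=> ya; have /h'P[hy hK] := AN _ _ ya; split=> //; have [b ba yb] := Cmem _ _ ya.
  apply: members_extends (stP f _ hy); apply: Cle; apply: ltW.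
  apply: lt_trans ((aB 5%N).2 _ ba); apply: boundP; first exact: countable_im.
  by exists y.
have pra x y n : x < a -> y < a -> pr ((x, y), n) < a.
  move=> xa ya; have xya : Order.max x y < a by rewrite gt_max xa.
  apply: lt_trans ((aB 6%N).2 _ xya); apply: boundP.
    by apply: countable_im; apply: countableX => //; apply: countableX.
  exists ((x, y), n) => //; split=> //; split; rewrite /le /=.
    by have : x <= Order.max x y by [rewrite le_max lexx]; rewrite le_eqVlt => /orP[/eqP|]; [right|left].
  by have : y <= Order.max x y by [rewrite le_max lexx orbT]; rewrite le_eqVlt => /orP[/eqP|]; [right|left].
have hK x : members (C f a) x -> h' (h x) = x by move=> /AN /hP[].
set e' := trunc e a in Fa.
have C0 : C (d0 e') a = C f a by apply: Cloc => b ba; rewrite /d0 /e' /trunc pra // eE.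
have C1 : C (d1 e') a = C f' a by apply: Cloc => b ba; rewrite /d1 /e' /trunc pra // eE.
have eh x y : d2 e' x y -> h x = y by rewrite /d2 /e' /trunc eE => /andP[_ /eqP].
have Ae x : members (C f a) x -> d2 e' x (h x).
  by move=> xa; rewrite /d2 /e' /trunc pra ?eE ?eqxx ?(Aa _ xa) ?(A'a _ (hA _ xa)).
have nd : ~ dense (rel (C f a)) by apply/(nondenseP (gC f a)); rewrite la; apply: StS Sia.
have nd' : ~ dense (rel (C f' a)) by apply/(nondenseP (gC f' a)); rewrite la'; apply: StS Sia.
have f'a : ~~ f' a by rewrite /f' (brE _ i) // (negbTE nYi).
have fa : f a = g i a by rewrite /f (brE _ i) // Xi.
have tT d : (forall x, x \in d -> univ (N f) x) -> transport (d2 e') (type_of (members (C f a)) (N f) d) =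
    type_of (members (C f' a)) (N f') (map h d).
  by move=> dN; apply: (transport_type eh Ae hA h'A) => // x /AN.
move: Fa; rewrite /F C1 /cp C0 -fa; case E: (f a); last first.
  move=> /asboolPn/contrapT/(zero f' a _ f'a nd')[d' [d'N E']].
  pose d := map h' d'.
  have dN x : x \in d -> univ (N f) x by move=> /mapP[y /d'N/h'P[? _] ->].
  have hd : map h d = d' by rewrite -map_comp -[RHS]map_id; apply/eq_in_map => y /d'N/h'P[_ /= ->].
  have := tT d dN; rewrite hd -E' => /(transport_inj eh Ae hK) E2.
  apply: (spl _ (gC f a) nd); apply/(zero f a _ _ nd); first by rewrite E.
  exists d; split=> //; apply/esym; apply: E2; by move=> z u [].
move=> /asboolP; apply; apply/(zero f' a _ f'a nd').
have [cN ->] := one f a E nd; rewrite tT //; exists (map h (c (C f a))); split=> //.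
by move=> _ /mapP[x /cN/hP[? _] ->].
Qed.
End SecondCase.

(** Either each condition has an extension that is stable over it, or some
    condition has none. *)
Theorem many_rich_sets : Phi_star -> (forall R, rich R -> ~ constructible_set R) ->
  exists N : (omega1 -> bool) -> pmap -> Prop, (forall f, rich (N f)) /\
    forall f f', f <> f' -> ~ iso_set (N f) (N f').
Proof.
move=> phi nc.
have [stab|] := pselect (forall q, good q -> exists q', [/\ extends q q', good q' & stable (members q) q']).
  exact: second_case stab (stationary_nondense nc) phi.
move=> /existsNP[q /not_implyP[gq /forallNP H]].
apply: (first_case gq) => [q' e g s|]; first by apply: (H q').
apply: phi; apply/stationaryP => B; have [a aB _] := closed_under_gt B (bound set0).
by exists a.
Qed.
End System.

(** * Formulas *)

Section Renaming.
Variable L : language.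

Fixpoint ren_term n m (s : 'I_n -> 'I_m) (t : term L n) : term L m :=
  match t with
  | Var i => Var L (s i)
  | App f ts => App (fun i => ren_term s (ts i))
  end.

Definition lift_ren n m (s : 'I_n -> 'I_m) : 'I_n.+1 -> 'I_m.+1 :=
  fun i => oapp (lift ord0 \o s) ord0 (unlift ord0 i).

Fixpoint ren n (phi : formula L n) : forall m, ('I_n -> 'I_m) -> formula L m :=
  match phi with
  | Bot _ => fun m _ => Bot L m
  | Equ _ t u => fun m s => Equ (ren_term s t) (ren_term s u)
  | Rel _ r ts => fun m s => Rel (fun i => ren_term s (ts i))
  | Imp _ phi psi => fun m s => Imp (ren phi s) (ren psi s)
  | All _ phi => fun m s => All (ren phi (lift_ren s))
  end.

Variable M : structure L.

Lemma eval_ren n m (s : 'I_n -> 'I_m) (t : term L n) (e : 'I_m -> M) :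
  eval e (ren_term s t) = eval (e \o s) t.
Proof. by elim: t => //= f ts IH; congr finterp; apply/funext => i; apply: IH. Qed.

Lemma env_cons_lift n m (s : 'I_n -> 'I_m) (e : 'I_m -> M) x :
  env_cons x e \o lift_ren s = env_cons x (e \o s).
Proof.
apply/funext => i; rewrite /env_cons /lift_ren /=.
by case: (unlift ord0 i) => [j|] /=; rewrite ?liftK ?unlift_none.
Qed.

Lemma sat_ren n (phi : formula L n) m (s : 'I_n -> 'I_m) (e : 'I_m -> M) :
  sat (ren phi s) e <-> sat phi (e \o s).
Proof.
elim: phi m s e => {n} [n|n t u|n r ts|n phi IH psi IH'|n phi IH] m s e //=.
- by rewrite !eval_ren.
- by rewrite (_ : (fun i => eval e (ren_term s (ts i))) = fun i => eval (e \o s) (ts i)) //;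
    apply/funext => i; apply: eval_ren.
- by rewrite IH IH'.
by split=> H x; have := H x; rewrite IH env_cons_lift.
Qed.

Definition Exi n (phi : formula L n.+1) : formula L n := Neg (All (Neg phi)).

Lemma sat_Exi n (phi : formula L n.+1) (e : 'I_n -> M) :
  sat (Exi phi) e <-> exists x, sat phi (env_cons x e).
Proof.
split=> [H|[x Hx] H]; last exact: H Hx.
by apply: contrapT => /forallNP.
Qed.

Lemma pformula_set0 n (phi : pformula (set0 : set M) n) :
  exists psi : formula L n, forall e, psat phi e <-> sat psi e.
Proof.
pose no (j : 'I_(nparam phi)) : False := set_mem (valP (param (p := phi) j)).
pose s (i : 'I_(n + nparam phi)) : 'I_n := match fintype.split i with
  | inl j => j | inr j => False_rect _ (no j) end.
exists (ren (pform phi) s) => e; rewrite sat_ren /psat.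
suff -> : env_cat e (fun j => val (param (p := phi) j)) = e \o s by [].
by apply/funext => i; rewrite /env_cat /s /=; case: fintype.split => // j; case: (no j).
Qed.

Definition pformula_of n (psi : formula L n) : pformula (set0 : set M) n :=
  PFormula (nparam := 0) (ren psi (lshift 0)) (fun j => False_rect _ (notF (ltn_ord j))).

Lemma psat_pformula_of n (psi : formula L n) e : psat (pformula_of psi) e <-> sat psi e.
Proof.
rewrite /psat /= sat_ren.
set e2 := env_cat _ _; suff -> : e2 \o lshift 0 = e by [].
by apply/funext => i; rewrite /e2 /env_cat /= (unsplitK (inl i)).
Qed.

(** The formula [th] is a complete formula for [a]. *)
Definition isolating n (th : formula L n) (a : 'I_n -> M) :=
  sat th a /\ forall b : 'I_n -> M, sat th b -> forall psi : formula L n, sat psi a <-> sat psi b.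

Lemma atomicP : atomic M <-> forall n (a : 'I_n -> M), exists th, isolating th a.
Proof.
split=> [at_M n a|H n a].
  have [phi pa iso] := at_M n a; have [th thP] := pformula_set0 phi.
  exists th; split=> [|b /thP thb psi]; first exact/thP.
  have half (chi : formula L n) : sat chi a -> sat chi b.
    move=> ca; apply/psat_pformula_of; apply: iso thb.
    exact/psat_pformula_of.
  split; first exact: half.
  by move=> pb; apply: contrapT => /(half (Neg psi)); apply.
have [th [tha iso]] := H n a; exists (pformula_of th); first exact/psat_pformula_of.
move=> psi pa x /psat_pformula_of thx; have [chi chiP] := pformula_set0 psi.
by apply/chiP/(iso _ thx)/chiP.
Qed.

End Renaming.

Section Isomorphism.
Variables (L : language) (A B : structure L) (h : A -> B).
Hypothesis h_bij : bijective h.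
Hypothesis h_fun : forall f (x : 'I_(farity f) -> A), h (finterp x) = finterp (h \o x).
Hypothesis h_rel : forall r (x : 'I_(rarity r) -> A), rinterp x <-> rinterp (h \o x).

Lemma eval_iso n (t : term L n) (e : 'I_n -> A) : h (eval e t) = eval (h \o e) t.
Proof. by elim: t => //= f ts IH; rewrite h_fun; congr finterp; apply/funext => i; apply: IH. Qed.

Lemma sat_iso n (phi : formula L n) (e : 'I_n -> A) : sat phi e <-> sat phi (h \o e).
Proof.
elim: phi e => {n} [n|n t u|n r ts|n phi IH psi IH'|n phi IH] e //=.
- by rewrite -!eval_iso; split=> [->//|/(bij_inj h_bij)].
- by rewrite h_rel (_ : h \o _ = fun i => eval (h \o e) (ts i)) //;
    apply/funext => i; apply: eval_iso.
- by rewrite IH IH'.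
have consE x : h \o env_cons x e = env_cons (h x) (h \o e).
  by apply/funext => i; rewrite /env_cons /=; case: unlift.
split=> H x; last by rewrite IH consE.
by have [g _ gK] := h_bij; have := H (g x); rewrite IH consE gK.
Qed.
End Isomorphism.

(** * Counting formulas *)

Section Counting.
Variable L : language.
Variable es : symbol L -> omega1.
Hypothesis es_inj : injective es.

Fixpoint term_tree n (t : term L n) : GenTree.tree omega1 :=
  match t with
  | Var i => GenTree.Node i [::]
  | App f ts => GenTree.Node 0 (GenTree.Leaf (es (inl f)) ::
      [seq term_tree (ts i) | i <- enum 'I_(farity f)])
  end.

Fixpoint formula_tree n (phi : formula L n) : GenTree.tree omega1 :=
  match phi with
  | Bot _ => GenTree.Node 0 [::]
  | Equ _ t u => GenTree.Node 1 [:: term_tree t; term_tree u]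
  | Rel _ r ts => GenTree.Node 2 (GenTree.Leaf (es (inr r)) ::
      [seq term_tree (ts i) | i <- enum 'I_(rarity r)])
  | Imp _ phi psi => GenTree.Node 3 [:: formula_tree phi; formula_tree psi]
  | All _ phi => GenTree.Node 4 [:: formula_tree phi]
  end.

Lemma eq_map_enum (T : Type) k (f g : 'I_k -> T) :
  [seq f i | i <- enum 'I_k] = [seq g i | i <- enum 'I_k] -> forall i, f i = g i.
Proof.
by move=> /eq_in_map E i; apply: E; rewrite mem_enum.
Qed.

Lemma term_tree_inj n : injective (@term_tree n).
Proof.
elim=> [i|f ts IH] [j|g us] //=; first by case=> /val_inj ->.
case=> /es_inj[E]; subst g => /eq_map_enum E; congr App.
by apply/funext => i; apply: IH.
Qed.

Lemma formula_tree_inj n : injective (@formula_tree n).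
Proof.
move=> phi; elim: phi => {n} [n|n t u|n r ts|n phi IH psi IH'|n phi IH] psi'.
- by case: n / psi'.
- by case: n / psi' t u => //= n t' u' t u [/term_tree_inj -> /term_tree_inj ->].
- case: n / psi' ts => //= n r' ts' ts [/es_inj [E]]; subst r' => /eq_map_enum E.
  by congr Rel; apply/funext => i; apply/term_tree_inj/E.
- by case: n / psi' phi IH psi IH' => //= n p q phi IH psi IH' [/IH -> /IH' ->].
- by case: n / psi' phi IH => //= n p phi IH [/IH ->].
Qed.

Lemma small_formula : small {n & formula L n}.
Proof.
have sT : small (GenTree.tree omega1).
  apply: (@embeds_trans _ (seq (nat + omega1))).
    by exists (@GenTree.encode omega1); apply: pcan_inj (@GenTree.codeK omega1).
  by apply: small_seq; apply: small_sum; [exact: embeds_nat_omega1|exists id].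
apply: embeds_trans (small_prod embeds_nat_omega1 sT).
exists (fun p => (projT1 p, formula_tree (projT2 p))) => -[n phi] [m psi] /= [E]; subst m.
by move=> /formula_tree_inj ->.
Qed.
End Counting.

(** * Constructible models *)

Definition lex_index (P : pred (omega1 *l nat)) : Type := {p | P p}.
HB.instance Definition _ P := SubChoice.on (lex_index P).
HB.instance Definition _ P :=
  [SubChoice_isSubOrder of lex_index P by <: with Order.default_display].

Lemma lex_lt (p q : omega1 *l nat) : (p < q) = lex p q.
Proof.
rewrite Order.ProdLexiOrder.ltEprodlexi /lex.
by case: (ltgtP p.1 q.1); rewrite //= ?andbF ?orbF // => ->; rewrite lexx.
Qed.

Lemma lex_index_wo P : well_order (@Order.le _ (lex_index P)).
Proof.
apply: antisymmetric_well_order => [|A [x0 Ax0]]; first exact: le_anti.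
pose A1 := [set a | exists2 i : lex_index P, i \in A & (val i).1 = a].
have [a [i Ai ia] amin] := @omega1_min A1 _ (ex_intro2 _ _ x0 Ax0 erefl).
pose A2 n := `[< exists2 i : lex_index P, i \in A & val i = (a, n) >].
have hA2 : exists n, A2 n.
  by exists (val i).2; apply/asboolP; exists i; rewrite // -ia -surjective_pairing.
have [n /asboolP[j Aj ja] nmin] := ex_minnP hA2.
exists j; split=> // z Az; rewrite -[j <= z]/(val j <= val z) Order.ProdLexiOrder.leEprodlexi ja /=.
rewrite amin /=; last by exists z.
apply/implyP => za; apply: nmin; apply/asboolP; exists z => //.
rewrite [val z]surjective_pairing; congr pair; apply/eqP.
by rewrite eq_le za amin //; exists z.
Qed.

(** * The finite elementary maps of an atomic model *)

Section AtomicModel.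
Variables (L : language) (es : symbol L -> omega1).
Hypothesis es_inj : injective es.
Variable K : structure L.
Hypothesis atomic_K : atomic K.

Definition point := {classic K}.

Definition elementary (w : seq (point * point)) := forall n (phi : formula L n) (t : 'I_n -> point * point),
  (forall i, t i \in w) -> sat phi (fun i => (t i).1 : K) <-> sat phi (fun i => (t i).2 : K).

Lemma elementary_refl w : (forall a b, (a, b) \in w -> a = b) -> elementary w.
Proof.
move=> wd n phi t tw; suff -> : (fun i => (t i).1 : K) = fun i => (t i).2 by [].
by apply/funext => i; apply: wd; rewrite -surjective_pairing.
Qed.

Lemma elementary_conv w : elementary w -> elementary (conv w).
Proof.
move=> ew n phi t tw; rewrite (ew n phi (fun i => ((t i).2, (t i).1))) // => i.
by rewrite -mem_conv -surjective_pairing.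
Qed.

Lemma elementary_comp w1 w2 w : elementary w1 -> elementary w2 ->
  (forall a c, (a, c) \in w -> exists b, (a, b) \in w1 /\ (b, c) \in w2) -> elementary w.
Proof.
move=> e1 e2 w12 n phi t tw.
have h i : exists b, ((t i).1, b) \in w1 /\ (b, (t i).2) \in w2.
  by apply: w12; rewrite -surjective_pairing.
have [b bP] := choice h.
rewrite (e1 n phi (fun i => ((t i).1, b i))) => [|i]; last by case: (bP i).
by rewrite (e2 n phi (fun i => (b i, (t i).2))) => // i; case: (bP i).
Qed.

Lemma elementary_sub w v : elementary w -> {subset v <= w} -> elementary v.
Proof. by move=> ew vw n phi t tv; apply: ew => i; apply: vw. Qed.

Lemma elementary_inj w a b a' b' : elementary w -> (a, b) \in w -> (a', b') \in w ->
  a = a' <-> b = b'.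
Proof.
move=> ew ab ab'; have := ew 2%N (Equ (Var L ord0) (Var L ord_max))
  (fun i => if i == ord0 then (a, b) else (a', b')).
by rewrite /=; apply=> i; case: ifP.
Qed.

Lemma elementary_of_tuple n (a b : 'I_n -> point) (w : seq (point * point)) :
  (forall phi : formula L n, sat phi (a : 'I_n -> K) <-> sat phi (b : 'I_n -> K)) ->
  (forall p, p \in w -> exists i, p = (a i, b i)) -> elementary w.
Proof.
move=> ab wab m phi t tw; have h i : exists j, t i = (a j, b j) by apply: wab.
have [s sP] := choice h.
have -> : (fun i => (t i).1 : K) = (a : 'I_n -> K) \o s by apply/funext => i; rewrite sP.
have -> : (fun i => (t i).2 : K) = (b : 'I_n -> K) \o s by apply/funext => i; rewrite sP.
by have := ab (ren phi s); rewrite !sat_ren.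
Qed.

Lemma elementary_ext w a : elementary w -> exists b, elementary ((a, b) :: w).
Proof.
move=> ew; have [p0] := carrier_inhabited K; pose d : point * point := (p0, p0).
pose x i := (nth d w i).1; pose y i := (nth d w i).2; pose n := size w.
have [th [tha iso]] := (atomicP K).1 atomic_K n.+1 (env_cons (a : K) (fun i : 'I_n => x i)).
have : sat (Exi th) (fun i : 'I_n => x i : K) by apply/sat_Exi; exists a.
rewrite (ew n (Exi th) (fun i : 'I_n => nth d w i)) => [/sat_Exi[b thb]|i]; last exact: mem_nth.
exists b; apply: (@elementary_of_tuple n.+1 (env_cons (a : K) (fun i : 'I_n => x i))
   (env_cons (b : K) (fun i : 'I_n => y i))).
  exact: iso.
move=> p; rewrite inE => /orP[/eqP ->|pw]; first by exists ord0; rewrite /env_cons unlift_none.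
have ltn : (index p w < n)%N by rewrite index_mem.
exists (lift ord0 (Ordinal ltn)); rewrite /env_cons liftK /= /x /y nth_index //.
exact: surjective_pairing.
Qed.

Lemma elementary_cover w (s : seq point) : elementary w ->
  exists v, [/\ elementary v, {subset w <= v} & forall a, a \in s -> exists b, (a, b) \in v].
Proof.
move=> ew; apply: (@extend_cover _ _ elementary (fun=> True)) => // v x ev _ _.
exact: (elementary_ext x ev).
Qed.

Lemma isolating_tagged n (th : formula L n) (x : 'I_n -> K) m (th' : formula L m) (y : 'I_m -> K) :
  isolating th x -> sat th' y -> existT (formula L) n th = existT (formula L) m th' ->
  exists e : n = m, forall psi : formula L n, sat psi x <-> sat psi (y \o cast_ord e).
Proof.
move=> iso + E; have e : n = m := congr1 (@projT1 _ _) E; subst m.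
have <- := eq_from_Tagged E => thy; exists erefl => psi.
rewrite (_ : y \o _ = y); last by apply/funext => i /=; congr y; apply: val_inj.
by case: iso => _; apply.
Qed.

(** Each type is isolated by a formula, and there are at most omega_1 formulas. *)
Lemma type_enum : exists rep : omega1 -> seq point, forall a : seq point,
  exists i, size (rep i) = size a /\ elementary (zip (rep i) a).
Proof.
have [p0] := carrier_inhabited K.
pose tup (a : seq point) (i : 'I_(size a)) : K := nth p0 a i.
pose F := {n & formula L n}.
pose complete (f : F) a := exists2 th : formula L (size a), f = existT _ _ th & isolating th (tup a).
have h (f : F) : exists a, forall b, complete f b -> size a = size b /\ elementary (zip a b).
  have [[a [th af iso]]|H] := pselect (exists a, complete f a); last first.
    by exists [::] => b bf; case: H; exists b.
  exists a => b [th' bf [thb _]]; rewrite af in bf.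
  have [sz H] := isolating_tagged iso thb bf; split=> //.
  apply: (@elementary_of_tuple (size a) (tup a) (tup b \o cast_ord sz)); first exact: H.
  move=> p /(nthP ((p0 : point), (p0 : point)))[i]; rewrite size_zip => lti <-.
  have {}lti : (i < size a)%N by rewrite (leq_trans lti) ?geq_minl.
  by exists (Ordinal lti); rewrite nth_zip.
have [r rP] := choice h.
have [e eP] := small_enum (existT _ 0%N (Bot L 0) : F) (small_formula es_inj).
exists (fun i => r (e i)) => a; have [th iso] := (atomicP K).1 atomic_K _ (tup a).
by have [i ei] := eP (existT _ _ th); exists i; apply: rP; exists th.
Qed.

(** * A filtration by countable homogeneous sets *)

Definition homogeneous (Y : set point) := forall w a, elementary w ->
  (forall x y, (x, y) \in w -> Y x /\ Y y) -> Y a -> exists2 b, Y b & elementary ((a, b) :: w).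

(** Countably many rounds of extending maps between points already present. *)
Lemma homogeneous_closure (X : set point) : countable X ->
  exists Y, [/\ X `<=` Y, countable Y & homogeneous Y].
Proof.
move=> cX.
have h (wa : seq (point * point) * point) : exists b, elementary wa.1 -> elementary ((wa.2, b) :: wa.1).
  have [ew|] := pselect (elementary wa.1); last by exists wa.2.
  by have [b eb] := elementary_ext wa.2 ew; exists b.
have [E EP] := choice h.
pose S (Z : set point) : set point := Z `|` E @`
  ([set w | forall p, p \in w -> (Z `*` Z) p] `*` Z).
pose Y n := iter n S X.
have cY n : countable (Y n).
  elim: n => //= n IH; apply: countable_cup => //; apply: countable_im.
  by apply: countableX => //; apply: countable_seqP; apply: countableX.
have Yle m n x : (m <= n)%N -> Y m x -> Y n x.
  by move=> /subnKC <- Yx; elim: (n - m)%N => [|k IH]; rewrite ?addn0 // addnS; left.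
exists (\bigcup_n Y n); split.
- by move=> x Xx; exists 0%N.
- by apply: bigcup_countable.
move=> w a ew wY [k _ Yka].
have [n [kn wn]] : exists n, (k <= n)%N /\ forall p, p \in w -> (Y n `*` Y n) p.
  elim: w wY {ew} => [|[x y] w IH] wY; first by exists k.
  have [x' y' xy|n [kn wn]] := IH; first by apply: wY; rewrite inE xy orbT.
  have [[i _ xi] [j _ yj]] := wY x y (mem_head _ _).
  exists (maxn n (maxn i j)); split; first by rewrite leq_max kn.
  move=> p; rewrite inE => /orP[/eqP ->|/wn[p1 p2]]; split=> /=.
  - by apply: Yle xi; rewrite !leq_max leqnn orbT.
  - by apply: Yle yj; rewrite !leq_max leqnn !orbT.
  - by apply: Yle p1; rewrite leq_max leqnn.
  - by apply: Yle p2; rewrite leq_max leqnn.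
exists (E (w, a)); last exact: (EP (w, a)).
exists n.+1 => //; right; exists (w, a) => //; split=> //=.
exact: Yle Yka.
Qed.

(** The stage [a] contains the [a]-th tuple of an enumeration of representatives
    of all types. *)
Lemma filtration : exists Y : omega1 -> set point,
  [/\ forall a, countable (Y a), forall a, homogeneous (Y a),
      forall a b, a <= b -> Y a `<=` Y b &
      forall s : seq point, exists a r, [/\ size r = size s, forall x, x \in r -> Y a x
        & elementary (zip r s)]].
Proof.
have [rep repP] := type_enum.
have h (X : set point) : exists Y : set point, countable X -> [/\ X `<=` Y, countable Y & homogeneous Y].
  have [cX|] := pselect (countable X); last by exists X.
  by have [Y YP] := homogeneous_closure cX; exists Y.
have [cl clP] := choice h.
pose base a (H : omega1 -> set point) := (\bigcup_(b in [set b | b < a]) H b) `|` [set x | x \in rep a].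
have [Y YE] := omega1_rec (fun a H => cl (base a H)) set0.
have cs (s : seq point) : countable [set x | x \in s].
  by apply: (@countableI _ _ (index^~ s)) => x y xs ys; apply: index_inj.
have cbase a : countable (base a (fun b => if b < a then Y b else set0)).
  elim/omega1_ind: a => a IH; apply: countable_cup => //.
  apply: bigcup_countable => [|b /= ba]; first exact: below_countable.
  by rewrite ba YE; have [_ ? _] := clP _ (IH b ba).
have YP a := clP _ (cbase a); have {}YP a : [/\ base a (fun b => if b < a then Y b else set0) `<=` Y a,
    countable (Y a) & homogeneous (Y a)] by rewrite YE.
exists Y; split.
- by move=> a; case: (YP a).
- by move=> a; case: (YP a).
- move=> a b; rewrite le_eqVlt => /orP[/eqP -> //|ab] x Yx.
  by have [Yb _ _] := YP b; apply: Yb; left; exists a => //=; rewrite ab.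
move=> s; have [a [sz ea]] := repP s; exists a, (rep a); split=> //.
by move=> x xr; have [Ya _ _] := YP a; apply: Ya; right.
Qed.

(** The union of the filtration, whose elements have as rank the least stage that
    contains them.  It need not be all of [K], but it realises all the types of
    [K]. *)
Lemma atomic_system : exists (M : choiceType) (v : M -> point) (rk : M -> omega1),
  [/\ injective v,
      system (fun w : seq (M * M) => elementary [seq (v p.1, v p.2) | p <- w]) rk &
      forall (s : seq M) (y : point), exists y' : M,
        elementary ((y, v y') :: diag [seq v x | x <- s])].
Proof.
have [Y [cY hY Yle Yrep]] := filtration.
pose M : choiceType := {x : point | `[< exists a, Y a x >]}.
pose v (x : M) : point := val x.
have stage (x : M) : exists a, Y a (v x) /\ forall b, Y b (v x) -> a <= b.
  have /asboolP[a Ya] := valP x.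
  by have [m Ym mlb] := omega1_min (A := [set b | Y b (v x)]) Ya; exists m.
have [rk rkP] := choice stage.
have Yrk (x : M) a : rk x <= a -> Y a (v x) by move=> xa; apply: Yle xa _ (rkP x).1.
have lift a p : Y a p -> exists x : M, v x = p /\ rk x <= a.
  move=> Yp; have H : `[< exists a, Y a p >] by apply/asboolP; exists a.
  by exists (exist _ p H); split=> //; apply: (rkP (exist _ p H)).2.
pose G (w : seq (M * M)) := elementary [seq (v p.1, v p.2) | p <- w].
have memG (w : seq (M * M)) p q : (p, q) \in [seq (v r.1, v r.2) | r <- w] ->
    exists x y, [/\ p = v x, q = v y & (x, y) \in w].
  by move=> /mapP[[x y] xy [-> ->]]; exists x, y.
have Gmem (w : seq (M * M)) x y : (x, y) \in w -> (v x, v y) \in [seq (v r.1, v r.2) | r <- w].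
  by move=> xy; apply/mapP; exists (x, y).
have hom a (w : seq (M * M)) x : G w -> (forall y z, (y, z) \in w -> rk y <= a /\ rk z <= a) ->
    rk x <= a -> exists2 y, rk y <= a & G ((x, y) :: w).
  move=> Gw wa xa; have [|q Yq eq] := hY a _ (v x) Gw _ (Yrk _ _ xa).
    by move=> p q /memG[y [z [-> -> /wa[ya za]]]]; split; apply: Yrk.
  by have [y [yq ya]] := lift a q Yq; exists y => //; rewrite /G /= yq.
have bnd (w : seq (M * M)) x g : rk x < g -> (forall y z, (y, z) \in w -> rk y < g /\ rk z < g) ->
    exists a, [/\ a < g, rk x <= a & forall y z, (y, z) \in w -> rk y <= a /\ rk z <= a].
  move=> xg; elim: w => [|[y z] w IH] wg; first by exists (rk x).
  have [y' z' h|a [ag xa wa]] := IH; first by apply: wg; rewrite inE h orbT.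
  have [yg zg] := wg y z (mem_head _ _).
  exists (Order.max a (Order.max (rk y) (rk z))); rewrite !gt_max ag yg zg le_max xa; split=> //.
  move=> y' z'; rewrite inE => /orP[/eqP[-> ->]|/wa[ya za]]; rewrite !le_max ?lexx ?orbT //.
  by rewrite ya za.
exists M, v, rk; split.
- exact: val_inj.
- split.
  + have [p0] := carrier_inhabited K; have [a [[|r0 r] [//= _ rY _]]] := Yrep [:: p0 : point].
    by have [x _] := lift a r0 (rY _ (mem_head _ _)); exists x.
  + by move=> w wd; apply: elementary_refl => p q /memG[x [y [-> -> /wd ->]]].
  + move=> w Gw; apply: (elementary_sub (elementary_conv Gw)) => -[p q] /memG[x [y [-> -> xy]]].
    by rewrite mem_conv; apply: Gmem; rewrite -mem_conv.
  + move=> w1 w2 w G1 G2 w12; apply: (elementary_comp G1 G2) => p q /memG[x [y [-> -> /w12[z [xz zy]]]]].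
    by exists (v z); split; apply: Gmem.
  + move=> w x Gw.
    have [b xb] := omega1_gt (rk x).
    have [a [xa wa]] : exists a, rk x <= a /\ forall y z, (y, z) \in w -> rk y <= a /\ rk z <= a.
      elim: w {Gw} => [|[y z] w [a [xa wa]]]; first by exists (rk x).
      exists (Order.max a (Order.max (rk y) (rk z))); rewrite le_max xa; split=> //.
      move=> y' z'; rewrite inE => /orP[/eqP[-> ->]|/wa[ya za]]; rewrite !le_max ?lexx ?orbT //.
      by rewrite ya za.
    by have [y _ Gy] := hom a w x Gw wa xa; exists y.
  + move=> w x y x' y' Gw xy xy'.
    have vE p q : p = q <-> v p = v q by split=> [->//|/val_inj].
    by rewrite (vE x) (vE y); apply: (elementary_inj Gw); apply: Gmem.
  + move=> g; apply: (@countable_sub _ _ (v @^-1` (\bigcup_(a in [set a | a < g]) Y a))).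
      by move=> x /= xg; exists (rk x) => //; apply: Yrk.
    have /countableW[f fi] : countable (\bigcup_(a in [set a | a < g]) Y a).
      by apply: bigcup_countable => // ; apply: below_countable.
    by apply: (@countableI _ _ (f \o v)) => x y xY yY /(fi _ _ xY yY)/val_inj.
  + move=> g w x Gw wg xg; have [a [ag xa wa]] := bnd w x g xg wg.
    by have [y ya Gy] := hom a w x Gw wa xa; exists y => //; apply: le_lt_trans ag.
move=> s y; have [a [[|r0 r] [//= [sz] rY er]]] := Yrep (y :: map v s).
have [b [ab sb]] : exists b, a <= b /\ forall x, x \in s -> rk x <= b.
  elim: s {sz er} => [|x s [b [ab sb]]]; first by exists a.
  exists (Order.max b (rk x)); rewrite le_max ab; split=> // z.
  by rewrite inE le_max => /orP[/eqP ->|/sb ->]; rewrite ?lexx ?orbT.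
have er' : elementary (zip r (map v s)).
  by apply: (elementary_sub er) => p pz; rewrite inE pz orbT.
have [||q Yq eq] := hY b _ r0 er'.
- move=> p q pq.
  have pr : p \in unzip1 (zip r (map v s)) by apply/mem_unzip1; exists q.
  have qs : q \in unzip2 (zip r (map v s)) by apply/mem_unzip2; exists p.
  rewrite unzip1_zip ?sz // in pr; rewrite unzip2_zip ?sz // in qs.
  split; first by apply: Yle ab _ (rY _ _); rewrite inE pr orbT.
  by have /mapP[x xs ->] := qs; apply/Yrk/sb.
- by apply: Yle ab _ (rY _ _); rewrite mem_head.
have [y' [yq _]] := lift b q Yq; exists y'; rewrite yq.
apply: (elementary_comp (elementary_conv er) eq) => p p'; rewrite inE => /orP[/eqP[-> ->]|].
  by exists r0; rewrite mem_conv !inE !eqxx.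
rewrite mem_diag => /andP[ps /eqP <-].
have /mem_unzip2[p1 pp] : p \in unzip2 (zip r (map v s)) by rewrite unzip2_zip ?sz.
by exists p1; rewrite mem_conv !inE pp !orbT.
Qed.

(** * The model of a rich set *)

Section Model.
Variables (M : choiceType) (v : M -> point) (rk : M -> omega1).
Notation G := (fun w : seq (M * M) => elementary [seq (v p.1, v p.2) | p <- w]).
Hypothesis v_inj : injective v.
Hypothesis sysM : system G rk.
Hypothesis v_rich : forall (s : seq M) (y : point), exists y' : M,
  elementary ((y, v y') :: diag [seq v x | x <- s]).

Section OneSet.
Variable R : seq (omega1 * M) -> Prop.
Hypothesis rR : rich G R.
Let aR : atomic_set G R := rR.1.

Definition carr := {x : omega1 | univ R x}.

(** The tuple [e] of names has been given the type of [a], through a map into [M]. *)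
Definition linked (I : Type) (e : I -> carr) (a : I -> K) := exists u w,
  [/\ R u, elementary w &
      forall i, exists m, (sval (e i), m) \in u /\ (v m, a i : point) \in w].

Lemma linked_sub (I J : Type) (e : I -> carr) a (s : J -> I) :
  linked e a -> linked (e \o s) (a \o s).
Proof. by move=> [u [w [Ru ew h]]]; exists u, w; split=> // j; apply: h. Qed.

Definition join (I J T : Type) (e : I -> T) (x : J -> T) (ij : I + J) : T :=
  match ij with inl i => e i | inr j => x j end.

Lemma linked_cover (I : Type) k (e : I -> carr) a (x : 'I_k -> carr) : linked e a ->
  exists c, linked (join e x) (join a c).
Proof.
move=> [u [w [Ru ew h]]].
have [|u' [Ru' uu' cu']] := as_cover (s := map (fun i => sval (x i)) (enum 'I_k)) aR Ru.
  by move=> y /mapP[i _ ->]; apply: (svalP (x i)).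
have [w' [ew' ww' cw']] := elementary_cover [seq v p.2 | p <- u'] ew.
have hx i : exists c : K, exists m, (sval (x i), m) \in u' /\ (v m, c : point) \in w'.
  have [|m xm] := cu' (sval (x i)); first by apply/mapP; exists i; rewrite ?mem_enum.
  have [|c mc] := cw' (v m); first by apply/mapP; exists (sval (x i), m).
  by exists c, m.
have [c cP] := choice hx; exists c, u', w'; split=> // -[i|j] /=; last exact: cP.
by have [m [em ma]] := h i; exists m; split; [exact: uu'|exact: ww'].
Qed.

Lemma linked_back (I : Type) (e : I -> carr) a (c : K) : linked e a ->
  exists x : carr, linked (join e (fun=> x : carr)) (join a (fun _ : unit => c)).
Proof.
move=> [u [w [Ru ew h]]].
have [b eb] := elementary_ext (c : point) (elementary_conv ew).
have [y ey] := v_rich (unzip2 u) b.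
have [x Rx] := rR.2 u y Ru.
have xR : univ R x by apply: (as_within sysM aR Rx (mem_head _ _)).
pose w' := (v y, c : point) :: [seq p <- w | p.1 \in map v (unzip2 u)].
exists (exist _ x xR), ((x, y) :: u), w'; split=> //.
  apply: (elementary_comp (elementary_conv ey) (elementary_conv eb)) => p q.
  rewrite inE => /orP[/eqP[-> ->]|]; first by exists b; rewrite !mem_conv !inE !eqxx.
  rewrite mem_filter => /andP[/= pu pq]; exists p; rewrite !inE !mem_conv.
  by rewrite mem_diag pu eqxx pq !orbT.
move=> [i|j] /=; last by exists y; rewrite !inE !eqxx.
have [m [em ma]] := h i; exists m; rewrite !inE em orbT mem_filter ma andbT; split=> //.
by apply/orP; right; apply/mapP; exists m => //; apply/mem_unzip2; exists (sval (e i)).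
Qed.

Lemma linked_change (I : Type) (e : I -> carr) a b : linked e a -> linked e b ->
  exists w, elementary w /\ forall i, (a i : point, b i : point) \in w.
Proof.
move=> [u [w [Ru ew h]]] [u' [w' [Ru' ew' h']]].
have Gu : G (comp_rel (conv u) u').
  apply: (as_uniq aR Ru Ru') => m n /comp_relP[x [xm xn]]; exists x.
  by rewrite mem_conv in xm.
exists (comp_rel (conv w) (comp_rel [seq (v p.1, v p.2) | p <- comp_rel (conv u) u'] w')); split.
  have e1 : elementary (comp_rel [seq (v p.1, v p.2) | p <- comp_rel (conv u) u'] w').
    by apply: (elementary_comp Gu ew') => p q /comp_relP.
  by apply: (elementary_comp (elementary_conv ew) e1) => p q /comp_relP.
move=> i; have [m [em ma]] := h i; have [m' [em' mb]] := h' i.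
apply/comp_relP; exists (v m); rewrite mem_conv; split=> //.
apply/comp_relP; exists (v m'); split=> //; apply/mapP; exists (m, m') => //.
by apply/comp_relP; exists (sval (e i)); rewrite mem_conv.
Qed.

Lemma linked_type n (e : 'I_n -> carr) a b (phi : formula L n) :
  linked e a -> linked e b -> sat phi a <-> sat phi b.
Proof.
move=> ea eb; have [w [ew h]] := linked_change ea eb.
exact: (ew n phi (fun i => (a i : point, b i : point))).
Qed.

Lemma linked_inj (I : Type) (e : I -> carr) a i j : linked e a -> e i = e j <-> a i = a j.
Proof.
move=> [u [w [Ru ew h]]]; have [m [em ma]] := h i; have [n [en na]] := h j.
have [mn nm] := elementary_inj ew ma na; have [xm mx] := as_inj aR Ru em en.
split=> [E|/nm/v_inj/mx E]; first by apply: mn; congr v; apply: xm; rewrite E.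
by apply: eq_sig_hprop E => x; exact: Prop_irrelevance.
Qed.

Lemma linked_ord0 (e : 'I_0 -> carr) (a : 'I_0 -> K) : linked e a.
Proof.
exists [::], [::]; split=> [||[]//]; first exact: as_nil aR.
exact: elementary_refl.
Qed.

Lemma linked_total n (e : 'I_n -> carr) : exists a, linked e a.
Proof.
have e0 : 'I_0 -> carr by case.
have a0 : 'I_0 -> K by case.
have [c /(@linked_sub _ 'I_n _ _ inr)] := linked_cover e (linked_ord0 e0 a0).
by exists c.
Qed.

(** The graph of [f] is defined by the types, since the value of [f] at [a] is
    determined in [K] by an equation. *)
Definition fun_graph (f : fsym L) (x : 'I_(farity f) -> carr) (y : carr) := exists a,
  linked (join x (fun=> y)) (join a (fun _ : unit => finterp a)).

Lemma fun_graph_total f x : exists y, @fun_graph f x y.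
Proof.
have [a xa] := linked_total x; have [y xy] := linked_back (finterp a) xa.
by exists y, a.
Qed.

Lemma carr_inhabited : inhabited carr.
Proof.
have [m _] := sys_inhabited sysM; have [x Rx] := rR.2 [::] m (as_nil aR).
by apply: inhabits; exists x; apply: (as_within sysM aR Rx (mem_head _ _)).
Qed.

Definition model : structure L := Structure carr_inhabited
  (fun f x => projT1 (cid (@fun_graph_total f x)))
  (fun r x => exists a, linked x a /\ rinterp (r := r) a).

Lemma model_fun f (x : 'I_(farity f) -> model) : fun_graph x (finterp x).
Proof. exact: projT2 (cid (@fun_graph_total f x)). Qed.

(** The image of [x] in [K] is determined by the image [a] of [e], because each of
    its entries is the value of a term. *)
Lemma linked_terms n k (e : 'I_n -> model) a (x : 'I_k -> model) (ts : 'I_k -> term L n) :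
  linked e a -> (forall i, linked (join e (fun=> x i)) (join a (fun _ : unit => eval a (ts i)))) ->
  linked (join e x) (join a (fun i => eval a (ts i))).
Proof.
move=> ea ht; have [c ec] := linked_cover x ea.
suff <- : c = fun i => eval a (ts i) by [].
apply/funext => i.
pose pick (T : Type) (z : 'I_n.+1 -> T) := z.
pose s (j : 'I_n.+1) : 'I_n + 'I_k := if unlift ord0 j is Some j' then inl j' else inr i.
pose s' (j : 'I_n.+1) : 'I_n + unit := if unlift ord0 j is Some j' then inl j' else inr tt.
have l1 := linked_sub s ec; have := linked_sub s' (ht i).
have -> : join e (fun=> x i) \o s' = join e x \o s.
  by apply/funext => j; rewrite /s /s' /=; case: unlift.
move=> l2; have := linked_type (Equ (Var L ord0) (ren_term (lift ord0) (ts i))) l1 l2.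
rewrite /= !eval_ren /s /s' unlift_none /=.
have -> : (join a c \o s) \o lift ord0 = a by apply/funext => j; rewrite /s /= liftK.
have -> : (join a (fun=> eval a (ts i)) \o s') \o lift ord0 = a.
  by apply/funext => j; rewrite /s' /= liftK.
by move=> H; apply/H.
Qed.

Lemma linked_eval n (t : term L n) (e : 'I_n -> model) a : linked e a ->
  linked (join e (fun=> eval e t)) (join a (fun _ : unit => eval a t)).
Proof.
move=> ea; elim: t => [i|f ts IH] /=.
  have := linked_sub (fun j : 'I_n + unit => if j is inl j' then j' else i) ea.
  congr linked; by apply/funext => -[].
set x := fun i => eval e (ts i); set b := fun i => eval a (ts i).
have xb : linked (join e x) (join a b) by apply: linked_terms ea IH.
have [c [u [w [Ru ew h]]]] := linked_cover (fun _ : 'I_1 => finterp (x : 'I_(farity f) -> model)) xb.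
have l1 : linked (join (join e x) (fun _ : 'I_1 => finterp (x : 'I_(farity f) -> model))) (join (join a b) c).
  by exists u, w.
have [a' l2] := model_fun x.
pose s (j : 'I_(farity f).+1) : ('I_n + 'I_(farity f)) + 'I_1 :=
  if unlift ord0 j is Some j' then inl (inr j') else inr ord0.
pose s' (j : 'I_(farity f).+1) : 'I_(farity f) + unit :=
  if unlift ord0 j is Some j' then inl j' else inr tt.
have l1' := linked_sub s l1; have := linked_sub s' l2.
have -> : join x (fun=> finterp (x : 'I_(farity f) -> model)) \o s' =
    join (join e x) (fun _ : 'I_1 => finterp (x : 'I_(farity f) -> model)) \o s.
  by apply/funext => j; rewrite /s /s' /=; case: unlift.
move=> l2'; have := linked_type
  (Equ (Var L ord0) (App (fun i : 'I_(farity f) => Var L (lift ord0 i)))) l1' l2'.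
rewrite /= /s /s' unlift_none /=.
rewrite (_ : (fun i => _) = b); last by apply/funext => j /=; rewrite liftK.
rewrite (_ : (fun i => _) = a'); last by apply/funext => j /=; rewrite liftK.
move=> [_ /(_ erefl) <-].
have := linked_sub (fun j : 'I_n + unit => match j with inl j' => inl (inl j') | inr _ => inr ord0 end) l1.
by congr linked; apply/funext => -[].
Qed.

(** Induction on formulas; the quantifier goes back and forth by [linked_back] and
    [linked_cover]. *)
Lemma truth n (phi : formula L n) (e : 'I_n -> model) a : linked e a -> sat phi e <-> sat phi a.
Proof.
elim: phi e a => {n} [n|n t u|n r ts|n phi IH psi IH'|n phi IH] e a ea //=.
- pose tu (i : 'I_2) := if i == ord0 then t else u.
  have l := linked_terms ea (fun i => linked_eval (tu i) ea).
  exact: (linked_inj (inr ord0) (inr ord_max) l).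
- have := linked_terms ea (fun i => linked_eval (ts i) ea).
  move=> /(linked_sub inr) l; split=> [[b [lb rb]]|ra]; last by exists (fun i => eval a (ts i)).
  exact: (linked_type (Rel (fun i => Var L i)) lb l).1.
- by rewrite (IH _ _ ea) (IH' _ _ ea).
pose s (j : 'I_n.+1) : 'I_n + unit := if unlift ord0 j is Some j' then inl j' else inr tt.
pose s1 (j : 'I_n.+1) : 'I_n + 'I_1 := if unlift ord0 j is Some j' then inl j' else inr ord0.
have sE (T : structure L) (x : T) (z : 'I_n -> T) : join z (fun=> x) \o s = env_cons x z.
  by apply/funext => j; rewrite /s /env_cons /=; case: unlift.
have s1E (T : structure L) (x : 'I_1 -> T) (z : 'I_n -> T) : join z x \o s1 = env_cons (x ord0) z.
  by apply/funext => j; rewrite /s1 /env_cons /=; case: unlift.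
split=> H x.
  have [y l] := linked_back x ea; have := linked_sub s l.
  by rewrite (sE model) (sE K) => /IH <-.
have [c l] := linked_cover (fun _ : 'I_1 => x : carr) ea; have := linked_sub s1 l.
by rewrite (s1E model) (s1E K) => /IH ->.
Qed.

Lemma truth_sentence (s : sentence L) : holds model s <-> holds K s.
Proof. exact/truth/linked_ord0. Qed.

Lemma isolating_model n (th : formula L n) (e : 'I_n -> model) a :
  linked e a -> isolating th a -> isolating th e.
Proof.
move=> ea [tha iso]; split; first exact/(truth th ea).
move=> x thx psi; have [b xb] := linked_total x.
have H := iso _ ((truth th xb).1 thx) psi.
by apply: iff_trans (truth psi ea) (iff_trans H (iff_sym (truth psi xb))).
Qed.

Lemma atomic_model : atomic model.
Proof.
apply/atomicP => n e; have [a ea] := linked_total e.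
have [th thP] := (atomicP K).1 atomic_K n a.
by exists th; apply: isolating_model ea thP.
Qed.

Lemma linked_of n (e : 'I_n -> carr) (m : 'I_n -> M) u : R u ->
  (forall i, (sval (e i), m i) \in u) -> linked e (fun i => v (m i) : K).
Proof.
move=> Ru eu; exists u, (diag (map v (unzip2 u))); split=> //.
  by apply: elementary_refl => a b; rewrite mem_diag => /andP[_ /eqP].
move=> i; exists (m i); split; first exact: eu.
by rewrite mem_diag eqxx andbT; apply/map_f/mem_unzip2; exists (sval (e i)).
Qed.

Lemma set_of_linked n (e : 'I_n -> carr) (m : 'I_n -> M) u : linked e (fun i => v (m i) : K) ->
  (forall p, p \in u -> exists i, p = (sval (e i), m i)) -> R u.
Proof.
move=> [u' [w [Ru' ew h]]] ue.
have [m' m'P] := choice h.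
apply: (as_comp aR Ru' (w := [seq (m' i, m i) | i <- enum 'I_n])).
  apply: (elementary_sub ew) => p; rewrite -map_comp => /mapP[i _ ->] /=.
  by case: (m'P i).
move=> x n' /ue[i [-> ->]]; exists (m' i); split; first by case: (m'P i).
by apply/mapP; exists i; rewrite ?mem_enum.
Qed.

Lemma linked_trans (I : Type) (e : I -> carr) a b w : linked e a -> elementary w ->
  (forall i, (a i : point, b i : point) \in w) -> linked e b.
Proof.
move=> [u [w' [Ru ew' h]]] ew ab; exists u, (comp_rel w' w); split=> //.
  by apply: (elementary_comp ew' ew) => p q /comp_relP.
by move=> i; have [m [em ma]] := h i; exists m; split=> //; apply/comp_relP; exists (a i).
Qed.

(** The structure of the model determines [R], so that an isomorphism of models
    is one of atomic sets. *)
Lemma set_type n (e : 'I_n -> model) (m : 'I_n -> M) (u : seq (omega1 * M)) :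
  (forall p, p \in u <-> exists i, p = (sval (e i), m i)) ->
  R u <-> forall phi : formula L n, sat phi e <-> sat phi (fun i => v (m i) : K).
Proof.
move=> ue; split=> [Ru phi|H].
  by apply: truth; apply: (linked_of Ru) => i; apply/ue; exists i.
have [a ea] := linked_total e.
have eam : elementary [seq (a i : point, v (m i)) | i <- enum 'I_n].
  apply: (@elementary_of_tuple n (a : 'I_n -> point) (fun i => v (m i))).
    by move=> phi; apply: iff_trans (iff_sym (truth phi ea)) (H phi).
  by move=> p /mapP[i _ ->]; exists i.
apply: (@set_of_linked n e m) => [|p /ue //]; apply: linked_trans ea eam _ => i.
by apply/mapP; exists i; rewrite ?mem_enum.
Qed.

Lemma pmap_tuple (u : seq (omega1 * M)) : within (univ R) u ->
  exists n (e : 'I_n -> carr) (m : 'I_n -> M), forall p, p \in u <-> exists i, p = (sval (e i), m i).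
Proof.
move=> uR; pose t := tnth (in_tuple u).
have tR i : univ R (t i).1 by apply: (uR _ (t i).2); rewrite -surjective_pairing; apply: mem_tnth.
exists (size u), (fun i => exist _ (t i).1 (tR i)), (fun i => (t i).2) => p.
split=> [/(tnthP (in_tuple u))[i ->]|[i ->]]; first by exists i; rewrite -surjective_pairing.
by rewrite -surjective_pairing; apply: mem_tnth.
Qed.

End OneSet.

Definition ext R R' (h : carr R -> carr R') (x : omega1) : omega1 :=
  if pselect (univ R x) is left p then sval (h (exist _ x p)) else x.

Lemma ext_val R R' (h : carr R -> carr R') c : ext h (sval c) = sval (h c).
Proof.
rewrite /ext; case: pselect => [p|]; last by case; apply: (svalP c).
by congr (sval (h _)); apply: eq_sig_hprop => // x; apply: Prop_irrelevance.
Qed.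

Lemma isomorphic_iso_set R R' (rR : rich G R) (rR' : rich G R') :
  isomorphic (model rR) (model rR') -> iso_set R R'.
Proof.
move=> [h [h_bij h_fun h_rel]]; have [g hK gK] := h_bij.
exists (ext h), (ext g); split=> [x Rx|x R'x|u uR].
- by rewrite (ext_val h (exist _ x Rx)) ext_val hK; split=> //; apply: (svalP (h _)).
- by rewrite (ext_val g (exist _ x R'x)) ext_val gK; split=> //; apply: (svalP (g _)).
have [n [e [m ue]]] := pmap_tuple uR.
have ue' p : p \in [seq (ext h q.1, q.2) | q <- u] <-> exists i, p = (sval ((h \o e) i), m i).
  split=> [/mapP[q /ue[i ->] ->]|[i ->]]; first by exists i; rewrite ext_val.
  by apply/mapP; exists (sval (e i), m i); [apply/ue; exists i|rewrite ext_val].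
have S := set_type (e := e : 'I_n -> model rR) ue.
have S' := set_type (e := h \o e : 'I_n -> model rR') ue'.
rewrite S S'; split=> H phi; have := sat_iso h_bij h_fun h_rel phi e; have := H phi.
  by move=> <- ->.
by move=> <- ->.
Qed.

Lemma linked_cons R (rR : rich G R) u m k (c : model rR) (d : 'I_k -> model rR) (z : 'I_k -> M) :
  R ((sval c, m) :: u) -> (forall j, (sval (d j), z j) \in u) ->
  linked (env_cat (fun _ : 'I_1 => c) d) (fun i => v (if fintype.split i is inr j then z j else m) : K).
Proof.
move=> Rcu du; apply: (linked_of (u := (sval c, m) :: u)) => // i.
by rewrite /env_cat inE; case: fintype.split => j; rewrite ?eqxx // du orbT.
Qed.

(** A finite map of [R] that isolates its next element isolates it by the
    complete formula of the image tuple. *)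
Lemma isolated_model R (rR : rich G R) (A : set (model rR)) (c : model rR) :
  isolated_over G R [set sval d | d in A] (sval c) -> isolated (@tp _ (model rR) A 1 (fun=> c)).
Proof.
have aR := rR.1; move=> [u [m [uA Ru H]]]; pose t := tnth (in_tuple u).
have tu j : t j \in u by apply: mem_tnth.
have hp j : exists d : A, sval (val d) = (t j).1.
  have [|d Ad dj] := uA (t j).1 (t j).2; first by rewrite -surjective_pairing.
  by exists (SigSub (mem_set Ad)).
have [p pP] := choice hp.
have pu j : (sval (val (p j)), (t j).2) \in u by rewrite pP -surjective_pairing.
pose img m' (i : 'I_(1 + size u)) := if fintype.split i is inr j then (t j).2 else m'.
have [th [thc iso]] := (atomicP K).1 atomic_K _ (fun i => v (img m i) : K).
exists (PFormula th p); first exact: (truth th (linked_cons Ru pu)).2 thc.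
move=> [l chi q] psic y psiy.
have yE : y = fun=> y ord0 by apply/funext => i; rewrite (ord1 i).
have [|u1 [Ru1 uu1 cu1]] := as_cover (s := [seq sval (val (q j)) | j <- enum 'I_l]) aR Ru.
  by move=> x /mapP[j _ ->]; apply: (svalP (val (q j))).
pose u' := [seq x <- u1 | `[< [set sval d | d in A] x.1 >]].
have u'u1 : {subset (sval c, m) :: u' <= u1}.
  move=> x; rewrite inE => /orP[/eqP ->|]; last by rewrite mem_filter => /andP[].
  by apply: uu1; rewrite mem_head.
have u'A : within [set sval d | d in A] u'.
  by move=> x n; rewrite mem_filter => /andP[/asboolP].
have Rc := as_sub sysM aR Ru1 u'u1.
have Ru' : R u' by apply: (as_sub sysM aR Rc) => x xu; rewrite inE xu orbT.
have uu' : {subset u <= u'}.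
  move=> [x n] xu; rewrite mem_filter uu1 ?inE ?xu ?orbT // andbT.
  by apply/asboolP; apply: uA xu.
have hz j : exists z, (sval (val (q j)), z) \in u'.
  have [|z zj] := cu1 (sval (val (q j))); first by apply/map_f; rewrite mem_enum.
  exists z; rewrite mem_filter zj andbT; apply/asboolP; exists (val (q j)) => //.
  exact/set_mem/(valP (q j)).
have [z zP] := choice hz.
have [m' Rm'] := as_ext aR Ru' (svalP (y ord0)).
have pu' j : (sval (val (p j)), (t j).2) \in u' by apply: uu'.
have Gm : G ((m, m') :: diag (unzip2 u)).
  have thm' : sat th (fun i => v (img m' i) : K).
    by rewrite yE in psiy; apply: (truth th (linked_cons Rm' pu')).1 psiy.
  apply: (@elementary_of_tuple _ (fun i => v (img m i)) (fun i => v (img m' i))).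
    exact: iso thm'.
  move=> w /mapP[[n n'] + ->]; rewrite inE => /orP[/eqP[-> ->]|].
    by exists (lshift (size u) ord0); rewrite /img (unsplitK (inl ord0)).
  rewrite mem_diag => /andP[/mem_unzip2[x /(tnthP (in_tuple u))[j E]] /eqP <-].
  by exists (rshift 1 j); rewrite /img (unsplitK (inr j)) /t -E.
have e := H u' Ru' u'A uu' m' Gm.
rewrite yE; apply: (truth chi (linked_cons Rm' zP)).2.
have psim := (truth chi (linked_cons Rc zP)).1 psic.
pose vz n (i : 'I_(1 + l)) := v (if fintype.split i is inr j then z j else n).
apply: (e _ chi (fun i => (vz m i, vz m' i)) _).1 psim => i; rewrite /vz.
case: fintype.split => j; first by rewrite mem_head.
rewrite inE; apply/orP; right; apply/mapP; exists (z j, z j) => //.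
by rewrite mem_diag eqxx andbT; apply/mem_unzip2; exists (sval (val (q j))).
Qed.

Lemma constructible_model R (rR : rich G R) : constructible_set G R -> constructible (model rR).
Proof.
move=> [r [r_inj r_iso]].
pose P (p : omega1 *l nat) := `[< exists2 x, univ R x & r x = p >].
have h (i : lex_index P) : exists c : model rR, r (sval c) = val i.
  by have /asboolP[x Rx xi] := valP i; exists (exist _ x Rx).
have [a aP] := choice h.
have a_onto (c : model rR) : exists i, a i = c.
  have Pc : P (r (sval c)) by apply/asboolP; exists (sval c) => //; apply: (svalP c).
  exists (exist P (r (sval c)) Pc : lex_index P); apply: eq_sig_hprop => [x|]; first exact: Prop_irrelevance.
  by apply: r_inj; [apply: (svalP (a _))|apply: (svalP c)|apply: aP].
exists _, (lex_index P), a; split; first exact: lex_index_wo.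
  by apply/seteqP; split=> // c _; have [i <-] := a_onto c; exists i.
move=> i; apply: isolated_model.
suff -> : [set sval d | d in a @` [set j | j < i]] = [set y | univ R y /\ lex (r y) (r (sval (a i)))].
  exact/r_iso/(svalP (a i)).
have ltP j : (j < i) = lex (r (sval (a j))) (r (sval (a i))).
  by rewrite !aP -lex_lt; apply: ltEsub.
apply/seteqP; split=> [y [_ [j /= ji <-] <-]|y [Ry ly]].
  by split; [apply: (svalP (a j))|rewrite -ltP].
have [j ja] := a_onto (exist _ y Ry).
by exists (a j); [exists j => //=; rewrite ltP ja|rewrite ja].
Qed.

(** A countable atomic set is constructible. *)
Lemma card_model R (rR : rich G R) : ~ constructible_set G R ->
  [set: model rR] #= [set: omega1].
Proof.
move=> ncR; have /embeds_uncountable[f fi] : ~ countable (univ R).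
  by move=> /(countable_constructible sysM rR.1).
rewrite card_eq_le; apply/andP; split; apply/card_leTT; last by exists f.
by exists sval => x y E; apply: eq_sig_hprop E => z; apply: Prop_irrelevance.
Qed.
End Model.
End AtomicModel.

Theorem theorem1p4 (Hphi : Phi_star) (Hcov : cov_meager_ge omega2)
  (L : language) (HL : [set: symbol L] #= [set: omega1])
  (T : set (sentence L)) (HT : complete_theory T)
  (Hatomic : exists M : structure L, models M T /\ atomic M)
  (Hconstr : ~ exists M : structure L, models M T /\ constructible M) :
  exists M : (omega1 -> bool) -> structure L,
    (forall i, [/\ models (M i) T, atomic (M i) &
                   [set: carrier (M i)] #= [set: omega1]]) /\
    (forall i j, i <> j -> ~ isomorphic (M i) (M j)).
Proof.
have [es es_inj] : exists es : symbol L -> omega1, injective es.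
  by apply/card_leTT; move: HL; rewrite card_eq_le => /andP[].
have [K [KT atomic_K]] := Hatomic.
have [M [v [rk [v_inj sysM v_rich]]]] := atomic_system es_inj atomic_K.
pose G (w : seq (M * M)) := elementary [seq (v p.1, v p.2) | p <- w].
pose mod R (rR : rich G R) := model atomic_K sysM v_rich rR.
have mod_T R (rR : rich G R) : models (mod R rR) T.
  by move=> s Ts; apply/truth_sentence => //; apply: KT.
have ncR R : rich G R -> ~ constructible_set G R.
  move=> rR cR; apply: Hconstr; exists (mod R rR); split; first exact: mod_T.
  exact: constructible_model.
have [N [rN N_iso]] := many_rich_sets sysM Hcov Hphi ncR.
exists (fun i => mod (N i) (rN i)); split=> [i|i j ij].
  by split; [exact: mod_T|exact: atomic_model|exact/card_model/ncR].
by move=> iso_ij; apply: (N_iso _ _ ij); apply: isomorphic_iso_set iso_ij.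
Qed.
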